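(* Let $u$ solve $$\frac{du}{dt}+\delta Au+\mathcal{B}(u,u)=f$$ with initial condition on the global attractor $\mathcal{A}$. Let $S(t,s,\mathcal{W})\hat m_0$ denote the solution at time $t\ge s$ of $$\frac{d\hat m}{dt}+\delta A\hat m+\mathcal{B}(\hat m,\hat m)+\omega A^{-2\alpha}P_\lambda(\hat m-u)=f+\frac{d\mathcal{W}}{dt},\qquad\hat m(s)=\hat m_0 .$$ If $\lambda=\infty$, assume $4\alpha+2\beta>1$ and $\alpha>-\tfrac12$. Let $\gamma$ be the largest positive constant such that $$\tfrac12\gamma|h|^2\le\langle\omega A^{-2\alpha}P_\lambda h,h\rangle+\tfrac12\delta\|h\|^2\qquad\text{for all }h\in\mathcal{V}.$$ Let $t\in\mathbb{R}$ and assume that there are an initial condition $\hat m_0^{(1)}\in\mathcal{H}$ and $\eta>0$ such that, almost surely, $$\limsup_{s\to-\infty}\frac{4K}{t-s}\int_s^t\|S(\tau,s,\mathcal{W})\hat m_0^{(1)}\|^2\,d\tau<\gamma-2\eta .$$ Let $\hat m_0^{(2)}\in\mathcal{H}$ be any other initial condition. Then, almost surely, $$\lim_{s\to-\infty}\bigl|S(t,s,\mathcal{W})\hat m_0^{(1)}-S(t,s,\mathcal{W})\hat m_0^{(2)}\bigr|\cdot e^{\eta(t-s)}=0 .$$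
   Context: Let $L>0$ and let $\mathbb{T}^2=[0,L)^2$ with periodic boundary conditions. $\mathcal{H}$ is the closure in $L^2(\mathbb{T}^2,\mathbb{R}^2)$ of the $\mathbb{R}^2$-valued divergence-free trigonometric polynomials with zero mean; $P:L^2(\mathbb{T}^2,\mathbb{R}^2)\to\mathcal{H}$ is the Leray–Helmholtz orthogonal projector. $A=-\frac{L^2}{4\pi^2}P\Delta$ is the (rescaled) Stokes operator; it is diagonal in the Fourier basis $\psi_k(x)=\frac{k^\perp}{|k|}e^{2\pi i k\cdot x/L}$, $k\in\mathbb{Z}^2\setminus\{0\}$, $k^\perp=(k_2,-k_1)^T$, with eigenvalues $|k|^2$, so its smallest eigenvalue is $1$. For $s\in\mathbb{R}$, $\mathcal{H}^s$ is the domain of $A^{s/2}$ with norm $\|v\|_s^2=\langle v,A^sv\rangle$; $\mathcal{V}=\mathcal{H}^1$ with norm $\|\cdot\|$, and $|\cdot|$ is the norm on $\mathcal{H}=\mathcal{H}^0$. For $\lambda\in\mathbb{N}\cup\{\infty\}$, $P_\lambda\sum_ku_k\psi_k=\sum_{|2\pi k|^2<\lambda L^2}u_k\psi_k$ (so $P_\infty=I$). $\mathcal{B}(u,v)=\frac12P(u\cdot\nabla v)+\frac12P(v\cdot\nabla u)$. $\delta=4\pi^2\nu/L^2$ with viscosity $\nu>0$, and $f\in\mathcal{H}$ is a time-independent forcing. The equation for $u$ is the 2D Navier–Stokes equation; it generates a semigroup on $\mathcal{H}^1$ with a global attractor $\mathcal{A}$, and solutions starting on $\mathcal{A}$ exist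 for all $t\in\mathbb{R}$ and are bounded in $\mathcal{V}$ uniformly in $t\in\mathbb{R}$. $\omega,\sigma_0>0$ and $\alpha,\beta\in\mathbb{R}$ are parameters; $W$ is a two-sided cylindrical Brownian motion in $Y=P_\lambda\mathcal{H}$, and $\mathcal{W}=\omega\sigma_0A^{-2\alpha-\beta}P_\lambda W\in C(\mathbb{R},\mathcal{H})$. For $\phi\ge0$ let $Z_\phi(t)=\int_{-\infty}^te^{-(t-s)(\delta A+\phi)}\,d\mathcal{W}(s)$, in its version with continuous paths in $\mathcal{V}$. The equation for $\hat m$ is solved path-wise for each fixed path of $\mathcal{W}$, via $v=\hat m-Z_\phi$, which satisfies a PDE with random coefficients and has a unique solution $v\in C^0_{\mathrm{loc}}([s,\infty),\mathcal{H})\cap L^2_{\mathrm{loc}}([s,\infty),\mathcal{V})$. $K'\ge1$ denotes a constant such that for all $v,w,z\in\mathcal{V}$: $\langle\mathcal{B}(v,v)-\mathcal{B}(w,w),v-w\rangle\le K'\|w\|\,\|v-w\|\,|v-w|$, $|\langle\mathcal{B}(w,v),v\rangle|\le K'\|w\|\,\|v\|\,|v|$ and $|\langle\mathcal{B}(w,v),z\rangle|\le K'\|v\|\,\|w\|\,\|z\|$. Set $K=(K')^2/\delta$. *)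

(* Defs.v *)
From HB Require Import structures.
From mathcomp Require Import all_boot all_order all_algebra.
From mathcomp Require Import complex.
From mathcomp Require Import all_classical all_reals all_analysis.

Set Implicit Arguments.
Unset Strict Implicit.
Unset Printing Implicit Defensive.

Import Order.TTheory GRing.Theory Num.Theory.
Import numFieldNormedType.Exports.

Local Open Scope classical_set_scope.
Local Open Scope ring_scope.
Local Open Scope complex_scope.

(* Vector fields on the torus are functions on the plane of which only the
   values on [0,L)^2 matter.  Elements of L^2 are not quotiented: two fields
   represent the same element of L^2 iff [normH L (u - v) = 0]. *)
Notation mode := 'rV[int]_2.
Notation field R := (R * R -> 'rV[R]_2).

(* Fourier coefficients of an R^2-valued function or distribution.  They carry
   the objects that need not belong to L^2, such as [B u v] or [A u]. *)
Notation coefs R := (mode -> 'rV[R[i]]_2).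

Section Torus.
Context {R : realType}.
Variable L : R.

Definition torus : set (R * R) := `[0, L[ `*` `[0, L[.

Definition leb2 := (@lebesgue_measure R \x @lebesgue_measure R)%E.

Definition tint (g : R * R -> R) : R := \int[leb2]_(x in torus) g x.

Definition in_L2 (u : field R) : Prop := forall j : 'I_2,
  measurable_fun torus (fun x => u x 0 j) /\
  (\int[leb2]_(x in torus) ((u x 0 j) ^+ 2)%:E < +oo)%E.

Definition inner (u v : field R) : R :=
  tint (fun x => \sum_(j < 2) u x 0 j * v x 0 j).

Definition normH (u : field R) : R := Num.sqrt (inner u u).

(* 2 pi k . x / L *)
Definition phase (k : mode) (x : R * R) : R :=
  2 * pi * ((k 0 0)%:~R * x.1 + (k 0 1)%:~R * x.2) / L.

Definition fourier (u : field R) : coefs R := fun k =>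
  \row_j ((tint (fun x => u x 0 j * cos (phase k x)) / L ^+ 2) -i*
          (tint (fun x => u x 0 j * sin (phase k x)) / L ^+ 2)).

Definition sqabs (k : mode) : R := \sum_(j < 2) ((k 0 j)%:~R) ^+ 2.

(* Divergence-free means that the amplitudes are orthogonal to the wave
   vector, zero mean that the wave vector 0 is absent. *)
Definition divfree_trig_poly (p : field R) : Prop :=
  exists (s : seq mode) (a b : mode -> 'rV[R]_2),
    (forall k, k \in s -> [/\ k != 0,
       \sum_(j < 2) (k 0 j)%:~R * a k 0 j = 0 &
       \sum_(j < 2) (k 0 j)%:~R * b k 0 j = 0]) /\
    p = fun x => \sum_(k <- s) (cos (phase k x) *: a k + sin (phase k x) *: b k).

Definition in_H (u : field R) : Prop :=
  in_L2 u /\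
  forall e : R, 0 < e -> exists2 p, divfree_trig_poly p & normH (u - p) < e.

(* Unordered sum of a (summable) family of real numbers. *)
Definition rsum (a : mode -> R) : R :=
  fine (\esum_(k in setT) (Num.max (a k) 0)%:E) -
  fine (\esum_(k in setT) (Num.max (- a k) 0)%:E).

Definition csum (a : mode -> R[i]) : R[i] :=
  rsum (fun k => complex.Re (a k)) +i* rsum (fun k => complex.Im (a k)).

(* The L^2 duality bracket of two real-valued distributions, expressed by
   their Fourier coefficients (Parseval, with |T^2| = L^2). *)
Definition pairing (c d : coefs R) : R :=
  L ^+ 2 * rsum (fun k => complex.Re (\sum_(j < 2) c k 0 j * (d k 0 j)^*)).

Definition sqabs_row (z : 'rV[R[i]]_2) : R :=
  \sum_(j < 2) (complex.Re (z 0 j) ^+ 2 + complex.Im (z 0 j) ^+ 2).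

(* A^s is diagonal in the Fourier basis, with eigenvalues |k|^(2s). *)
Definition Apow (s : R) (c : coefs R) : coefs R := fun k =>
  ((sqabs k) `^ s)%:C *: c k.

(* ||v||_s^2 = <v, A^s v>, infinite when v is not in H^s *)
Definition sqnormHs (s : R) (u : field R) : \bar R :=
  ((L ^+ 2)%:E *
   \esum_(k in setT) ((sqabs k) `^ s * sqabs_row (fourier u k))%:E)%E.

Definition in_Hs (s : R) (u : field R) : Prop :=
  in_H u /\ (sqnormHs s u < +oo)%E.

Definition normHs (s : R) (u : field R) : R := Num.sqrt (fine (sqnormHs s u)).

Definition in_V := in_Hs 1.
Definition normV := normHs 1.

(* Leray-Helmholtz projector: (P c)(k) = c(k) - k (k . c(k)) / |k|^2, without
   the mean. *)
Definition leray (c : coefs R) : coefs R := fun k =>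
  if k == 0 then 0 else
  c k - ((sqabs k)^-1)%:C *:
        ((\sum_(j < 2) ((k 0 j)%:~R * c k 0 j)) *: map_mx intr k).

Definition deriv_coefs (j : 'I_2) (c : coefs R) : coefs R := fun k =>
  ((2 * pi / L * (k 0 j)%:~R) *i) *: c k.

Definition laplacian (c : coefs R) : coefs R := fun k =>
  \sum_(j < 2) deriv_coefs j (deriv_coefs j c) k.

Definition stokes (c : coefs R) : coefs R := fun k =>
  (- (L ^+ 2 / (4 * pi ^+ 2)))%:C *: leray (laplacian c) k.

(* Fourier coefficients of (u . nabla) v = \sum_j u_j d_j v: products become
   convolutions. *)
Definition advection (c d : coefs R) : coefs R := fun k =>
  \row_l \sum_(j < 2) csum (fun p => c p 0 j * deriv_coefs j d (k - p) 0 l).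

Definition Bilin (c d : coefs R) : coefs R := fun k =>
  2^-1 *: leray (advection c d) k + 2^-1 *: leray (advection d c) k.

Definition B (u v : field R) : coefs R := Bilin (fourier u) (fourier v).

(* |2 pi k|^2 < lambda L^2; [None] stands for lambda = infinity. *)
Definition observed (lambda : option nat) (k : mode) : bool :=
  if lambda is Some n then (2 * pi) ^+ 2 * sqabs k < n%:R * L ^+ 2 else true.

Definition Plam (lambda : option nat) (c : coefs R) : coefs R := fun k =>
  if observed lambda k then c k else 0.

Definition nudging (alpha : R) (lambda : option nat) (c : coefs R) : coefs R :=
  Apow (- (2 * alpha)) (Plam lambda c).

(* Continuity on I of a curve, for a given norm on fields. *)
Definition continuous_for (N : field R -> R) (I : set R) (u : R -> field R) :=
  forall t0, I t0 -> N (u t - u t0) @[t --> within I (nbhs t0)] --> (0 : R).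

Definition time_integral (s t : R) (F : R -> 'rV[R[i]]_2) : 'rV[R[i]]_2 :=
  \row_j ((\int[@lebesgue_measure R]_(r in `[s, t]) complex.Re (F r 0 j)) +i*
          (\int[@lebesgue_measure R]_(r in `[s, t]) complex.Im (F r 0 j))).

(* du/dt + delta A u + B(u,u) = f, integrated in time and tested against each
   Fourier mode. *)
Definition nse_solution (delta : R) (f : field R) (I : set R)
    (u : R -> field R) : Prop :=
  [/\ forall t, I t -> in_V (u t),
      continuous_for normV I u &
      forall s t, I s -> I t -> s <= t -> forall k,
        fourier (u t) k = fourier (u s) k + time_integral s t (fun r =>
          fourier f k - delta%:C *: stokes (fourier (u r)) k
          - B (u r) (u r) k)].

(* Global attractor in V: compact, invariant, and attracting bounded sets.
   The solution semigroup on V enters through its trajectories. *)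
Definition global_attractor (delta : R) (f : field R) (att : set (field R)) :=
  let traj := nse_solution delta f `[0, +oo[ in
  [/\ forall a, att a -> in_V a,
      forall a : nat -> field R, (forall n, att (a n)) ->
        exists (sub : nat -> nat) (b : field R),
          [/\ {homo sub : m n / (m < n)%N}, att b &
              normV (a (sub n) - b) @[n --> \oo] --> (0 : R)],
      forall u, traj u -> att (u 0) -> forall t, 0 <= t ->
        exists2 a, att a & normH (u t - a) = 0,
      forall a, att a -> forall t, 0 <= t ->
        exists2 u, traj u & att (u 0) /\ normH (u t - a) = 0 &
      forall M e : R, 0 < e -> exists T : R, forall u,
        traj u -> normV (u 0) <= M -> forall t, T <= t -> 0 <= t ->
        exists2 a, att a & normV (u t - a) < e].

(* m solves, for one path [Z] of the process Z_phi and from time s on,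
     dm/dt + delta A m + B(m,m) + omega A^(-2 alpha) P_lambda (m - u)
       = f + dW/dt,   m(s) = m0,
   in the sense that v = m - Z solves
     dv/dt + delta A v + B(v + Z, v + Z)
       + omega A^(-2 alpha) P_lambda (v + Z - u) = f + phi Z,
     v(s) = m0 - Z(s)
   (recall that dZ + (delta A + phi) Z dt = dW). *)
Definition filter_solution (delta om alpha phi : R) (lambda : option nat)
    (f : field R) (u Z : R -> field R) (s : R) (m0 : field R)
    (m : R -> field R) : Prop :=
  let v := fun t => m t - Z t in
  [/\ (forall t, s <= t -> in_H (v t)) /\ continuous_for normH `[s, +oo[ v,
      forall T, s <= T ->
        (\int[@lebesgue_measure R]_(r in `[s, T]) sqnormHs 1 (v r) < +oo)%E,
      normH (v s - (m0 - Z s)) = 0 &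
      forall t, s <= t -> forall k,
        fourier (v t) k = fourier (v s) k + time_integral s t (fun r =>
          fourier f k + phi%:C *: fourier (Z r) k
          - delta%:C *: stokes (fourier (v r)) k
          - B (v r + Z r) (v r + Z r) k
          - om%:C *: nudging alpha lambda (fourier (v r + Z r - u r)) k)].

(* An orthonormal basis of H, indexed by the nonzero modes: the normalized
   real part of psi_k for k in a half-plane, its imaginary part for k in the
   opposite one. *)
Definition positive_mode (k : mode) : bool :=
  (0 < k 0 0) || ((k 0 0 == 0) && (0 < k 0 1)).

Definition kperp (k : mode) : 'rV[R]_2 :=
  \row_j (if j == 0 then (k 0 1)%:~R else - (k 0 0)%:~R).

Definition basisH (k : mode) : field R := fun x =>
  (Num.sqrt 2 / L * (if positive_mode k then cos (phase k x)
                     else sin (phase k x)) / Num.sqrt (sqabs k)) *: kperp k.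

End Torus.

Section Noise.
Context {R : realType} {d : measure_display} {Omega : measurableType d}.
Variable Pr : probability Omega R.

(* Two-sided standard real Brownian motion; [normal_prob] takes the standard
   deviation. *)
Definition brownian (W : R -> Omega -> R) : Prop :=
  [/\ forall t, measurable_fun setT (W t),
      {ae Pr, forall w, W 0 w = 0 /\ continuous (fun t => W t w)},
      forall s t, s < t -> forall X : set R, measurable X ->
        Pr ((fun w => W t w - W s w) @^-1` X) =
        normal_prob 0 (Num.sqrt (t - s)) X &
      forall (n : nat) (t : nat -> R), (forall i, t i <= t i.+1) ->
      forall X : 'I_n -> set R, (forall i, measurable (X i)) ->
      let E (i : 'I_n) := (fun w => W (t i.+1) w - W (t i) w) @^-1` X i in
        fine (Pr (\bigcap_i E i)) = \prod_(i < n) fine (Pr (E i))].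

(* Mutual independence of a family of real processes, on the pi-systems of
   finite-dimensional cylinders. *)
Definition independent_processes (I : eqType) (D : pred I)
    (W : I -> R -> Omega -> R) : Prop :=
  forall (F : seq I), uniq F -> all D F ->
  forall (n : nat) (t : 'I_n -> R) (X : I -> 'I_n -> set R),
    (forall k i, measurable (X k i)) ->
    let E k := \bigcap_i (W k (t i) @^-1` X k i) in
    fine (Pr (\bigcap_(k in [set` F]) E k)) = \prod_(k <- F) fine (Pr (E k)).

(* W = \sum_k W_k e_k with independent Brownian motions W_k, k ranging over the
   basis [basisH] of Y = P_lambda H. *)
Definition cylindrical_brownian (L : R) (lambda : option nat)
    (W : mode -> R -> Omega -> R) : Prop :=
  let D := [pred k : mode | (k != 0) && observed L lambda k] in
  (forall k, D k -> brownian (W k)) /\ independent_processes D W.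

(* An H-valued process, with measurable coordinates. *)
Definition process (L : R) (X : R -> Omega -> field R) : Prop :=
  forall k t, k != 0 ->
    measurable_fun setT (fun w => inner L (X t w) (basisH L k)).

(* WW = omega sigma0 A^(-2 alpha - beta) P_lambda W, with paths in C(R, H) *)
Definition coloured_noise (L om sigma0 alpha beta : R) (lambda : option nat)
    (W : mode -> R -> Omega -> R) (WW : R -> Omega -> field R) : Prop :=
  process L WW /\
  {ae Pr, forall w,
    [/\ forall t, in_H L (WW t w),
        continuous_for (normH L) setT (WW ^~ w) &
        forall t k, k != 0 -> inner L (WW t w) (basisH L k) =
          if observed L lambda k then
            om * sigma0 * (sqabs k) `^ (- (2 * alpha) - beta) * W k t w
          else 0]}.

Definition ms_cvg {T : Type} (F : set_system T) (X : T -> Omega -> R)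
    (Y : Omega -> R) : Prop :=
  (\int[Pr]_w ((X i w - Y w) ^+ 2)%:E)%E @[i --> F] --> (0 : \bar R)%E.

(* Y = int_a^b g dw for a continuous deterministic integrand g, as the
   mean-square limit of Riemann sums. *)
Definition wiener_integral (g : R -> R) (W : R -> Omega -> R) (a b : R)
    (Y : Omega -> R) : Prop :=
  measurable_fun setT Y /\
  ms_cvg \oo (fun (n : nat) (w : Omega) =>
    let r (i : nat) : R := a + (b - a) * (i%:R / n%:R) in
    \sum_(i < n) g (r i) * (W (r i.+1) w - W (r i) w)) Y.

(* Y = int_{-oo}^b g dw *)
Definition wiener_integral_ninfty (g : R -> R) (W : R -> Omega -> R) (b : R)
    (Y : Omega -> R) : Prop :=
  measurable_fun setT Y /\
  exists2 J : R -> Omega -> R,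
    forall a, a < b -> wiener_integral g W a b (J a) &
    ms_cvg (ninfty_nbhs R) J Y.

(* Z(t) = int_{-oo}^t exp(-(t-s)(delta A + phi)) dWW(s), coordinatewise in the
   eigenbasis of A, with paths continuous in V *)
Definition ou_process (L delta phi : R) (WW Z : R -> Omega -> field R) : Prop :=
  [/\ process L Z,
      forall k t, k != 0 ->
        wiener_integral_ninfty
          (fun s => expR (- ((t - s) * (delta * sqabs k + phi))))
          (fun s w => inner L (WW s w) (basisH L k)) t
          (fun w => inner L (Z t w) (basisH L k)) &
      {ae Pr, forall w, (forall t, in_V L (Z t w)) /\
                        continuous_for (normV L) setT (Z ^~ w)}].

End Noise.

Section Constants.
Context {R : realType}.
Variable L : R.

Definition bilinear_bounds (K' : R) : Prop :=
  1 <= K' /\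
  forall v w z : field R, in_V L v -> in_V L w -> in_V L z ->
  [/\ pairing L (B L v v - B L w w) (fourier L (v - w))
        <= K' * normV L w * normV L (v - w) * normH L (v - w),
      `|pairing L (B L w v) (fourier L v)|
        <= K' * normV L w * normV L v * normH L v &
      `|pairing L (B L w v) (fourier L z)|
        <= K' * normV L v * normV L w * normV L z].

Definition coercive (delta om alpha : R) (lambda : option nat) (gamma : R) :=
  forall h, in_V L h ->
    2^-1 * gamma * normH L h ^+ 2 <=
    pairing L (fun k => om%:C *: nudging L alpha lambda (fourier L h) k)
      (fourier L h) + 2^-1 * delta * normV L h ^+ 2.

Definition largest_coercive (delta om alpha : R) (lambda : option nat)
    (gamma : R) : Prop :=
  [/\ 0 < gamma, coercive delta om alpha lambda gamma &
      forall g, 0 < g -> coercive delta om alpha lambda g -> g <= gamma].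

End Constants.

(* Main.v *)
Require Import Defs.
From HB Require Import structures.
From mathcomp Require Import all_boot all_order all_algebra.
From mathcomp Require Import complex.
From mathcomp Require Import all_classical all_reals all_analysis.
From mathcomp Require Import measurable_realfun.
From mathcomp Require Import ring lra zify.
Import Order.TTheory GRing.Theory Num.Theory.
Import numFieldNormedType.Exports.
Set Implicit Arguments.
Unset Strict Implicit.
Unset Printing Implicit Defensive.
Local Open Scope classical_set_scope.
Local Open Scope ring_scope.

(** Along a fixed path of the noise, the difference e = m1 - m2 of two solutions
    satisfies a deterministic equation, since the noise, the forcing and the
    observed solution u cancel:

      de/dt + delta A e + B(m1,m1) - B(m2,m2) + omega A^(-2 alpha) P_lambda e = 0.

    Testing it with e, the first bound on B makes the nonlinear term at most
    K' ||m1|| ||e|| |e| ([tri_lower]).  Young's inequality splits this product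
    between half of the viscous dissipation and K ||m1||^2 |e|^2, and what is
    left of the dissipation together with the nudging is at least gamma |e|^2 by
    coercivity.  Hence

      d|e|^2/dt <= (K ||m1||^2 - gamma) |e|^2,

    and Gronwall's lemma bounds |e(t)|^2 by |e(s)|^2 times the exponential of
    K int_s^t ||m1||^2 - gamma (t - s) ([gap_contraction]).  For s close to -oo
    the hypothesis bounds K int_s^t ||m1||^2 by (gamma - 2 eta) (t - s) / 4, where
    gamma - 2 eta > 0 because the time average is nonnegative, so that
    |e(t)|^2 exp (2 eta (t - s)) tends to 0 exponentially ([decay]).

    The solutions lie in V only for almost every time and satisfy the equation
    mode by mode, integrated in time, so that testing with e has to be
    justified.  Each Fourier coefficient of e is a primitive of an integrable
    function, which is enough for the chain rule for its square
    ([sqr_primitive]).  Summing over a box of modes gives the energy balance of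
    the truncation of e ([box_energy]); truncations are in V, so that coercivity
    applies to them ([coercive_box]).  The passage to the limit of large boxes is
    a dominated convergence in time ([gap_energy]).  The third bound on B
    would only dominate <B(m,m), z> by ||m||^2 ||z||, a product of three square
    integrable functions of time.  The first bound, used with w = 0 for v and
    - v, shows that <B(v,v), v> = 0 ([tri_diag0]); polarizing this cubic
    identity gives <B(m,m), z> = - 2 <B(z,m), m> ([tri_swap]), to which the
    second bound applies: <B(m,m), z> is dominated by ||z|| ||m|| |m|, where |m|
    is bounded in time ([tri_bound]).

    These manipulations of B on Fourier coefficients rest on the absolute
    convergence of its trilinear form on V ([trilinear_bound]), and on the
    description of H and V by Fourier coefficients ([in_H_coefs], [parseval],
    [in_V_coef]), which is extracted from the density of the divergence-free
    trigonometric polynomials in H. *)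

(** * Absolutely continuous functions of time *)

Section TimeCalculus.
Context {R : realType}.
Notation mu := (@lebesgue_measure R).
Implicit Types (a b : R) (F G X : R -> R).

Definition int_on a b F := mu.-integrable `[a, b] (EFin \o F).

(** The telescoping principle behind the product rules below: no pointwise
    derivative is available for an integral of a merely integrable function,
    but an additive function of intervals which is small relatively to
    another one on short intervals has to vanish. *)
Lemma additive_small_le0 a b (phi m : R -> R -> R) : a <= b ->
  (forall x y z, a <= x -> x <= y -> y <= z -> z <= b ->
     phi x z = phi x y + phi y z) ->
  (forall x y z, a <= x -> x <= y -> y <= z -> z <= b ->
     m x z = m x y + m y z) ->
  (forall e, 0 < e -> exists2 d, 0 < d & forall x y, a <= x -> x <= y ->
     y <= b -> y - x < d -> phi x y <= e * m x y) ->
  phi a b <= 0.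
Proof.
move=> ab addphi addm small.
have le_e e : 0 < e -> phi a b <= e * m a b.
  move=> e0; have [d d0 dP] := small e e0.
  have [n n0 nP] : exists2 n : nat, (0 < n)%N & (b - a) / n%:R < d.
    exists (Num.trunc ((b - a) / d)).+1 => //.
    rewrite ltr_pdivrMr ?ltr0n// mulrC -ltr_pdivrMr//.
    exact: truncnS_gt.
  have n0' : (0 : R) < n%:R by rewrite ltr0n.
  (* the points of the subdivision into n intervals of length less than d *)
  pose x i := a + (b - a) / n%:R * i%:R.
  have h0 : 0 <= (b - a) / n%:R by rewrite divr_ge0 ?subr_ge0// ltW.
  have xS i : x i.+1 = x i + (b - a) / n%:R.
    by rewrite /x -addn1 natrD mulrDr mulr1 addrA.
  have xa i : a <= x i by rewrite lerDl mulr_ge0.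
  have xn : x n = b by rewrite /x divfK ?gt_eqF// addrC subrK.
  have xb i : (i <= n)%N -> x i <= b.
    by move=> ni; rewrite -xn lerD2l ler_wpM2l// ler_nat.
  suff H i : (i <= n)%N -> phi a (x i) <= e * m a (x i).
    by have := H n (leqnn _); rewrite xn.
  elim: i => [_|i IH ni].
    have -> : x 0 = a by rewrite /x mulr0 addr0.
    have := addphi a a a (lexx _) (lexx _) (lexx _) ab.
    have := addm a a a (lexx _) (lexx _) (lexx _) ab.
    move=> ? ?; have [-> ->] : m a a = 0 /\ phi a a = 0 by (split; lra).
    by rewrite mulr0.
  have xiS : x i <= x i.+1 by rewrite xS lerDl.
  rewrite (addphi _ (x i))//; [|exact: xb].
  rewrite (addm _ (x i))//; [|exact: xb].
  rewrite mulrDr lerD//; first exact/IH/ltnW.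
  apply: dP => //; first exact: xb.
  by rewrite xS addrAC subrr add0r.
apply/ler_addgt0Pr => e e0; rewrite add0r.
have M0 : 0 < `|m a b| + 1 by rewrite ltr_pwDr.
apply: (le_trans (le_e (e / (`|m a b| + 1)) _)); first exact: divr_gt0.
rewrite mulrAC ler_pdivrMr// ler_pM2l//.
by rewrite (le_trans (ler_norm _))// lerDl.
Qed.

Lemma int_on_sub a b x y F : int_on a b F -> a <= x -> y <= b -> int_on x y F.
Proof.
move=> iF ax yb; apply: integrableS iF => //.
by apply: subset_itv; rewrite bnd_simp.
Qed.

Lemma Rint_split a b c F : int_on a c F -> a <= b -> b <= c ->
  \int[mu]_(r in `[a, c]) F r =
  \int[mu]_(r in `[a, b]) F r + \int[mu]_(r in `[b, c]) F r.
Proof.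
move=> iF ab bc; apply/eqP; rewrite addrC -subr_eq; apply/eqP.
rewrite Rintegral_itvB ?bnd_simp// Rintegral_itv_obnd_cbnd//.
apply: integrableS iF => //; apply: subset_itvr; by rewrite bnd_simp.
Qed.

Lemma uniformly_continuous_itv a b G : {within `[a, b], continuous G} ->
  forall e, 0 < e -> exists2 d, 0 < d & forall x y, a <= x -> x <= b ->
    a <= y -> y <= b -> `|x - y| < d -> `|G x - G y| <= e.
Proof.
move=> cG e e0.
have /compact_near_coveringP/near_covering_withinP := @segment_compact R a b.
move=> /(_ R (0^'+) (fun d x => forall y, a <= y -> y <= b -> `|x - y| < d -> `|G x - G y| <= e)).
move=> /(_ _)[].
  move=> x xab.
  have e2 : 0 < e / 2 by rewrite divr_gt0.
  have /cvgrPdist_le/(_ _ e2) := (subspace_continuousP _ _).1 cG _ xab.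
  rewrite near_withinE => -[d /= d0 dP].
  exists (ball x (d / 2), [set h | h < d / 2]); first split.
  - by rewrite /=; apply/nbhs_ballP; exists (d / 2) => //=; rewrite divr_gt0.
  - by near=> h; rewrite /=; near: h; apply: nbhs_right_lt; rewrite divr_gt0.
  move=> [x' h] /= [xx' hd] x'ab y ay yb x'y.
  have x'x : `|x - x'| < d by rewrite (lt_le_trans xx')// ler_pdivrMr// ler_pMr// ler1n.
  have yx : `|x - y| < d.
    rewrite (_ : x - y = (x - x') + (x' - y)); last by rewrite addrA subrK.
    rewrite (le_lt_trans (ler_normD _ _))// [d]splitr ltrD//.
    exact: lt_trans hd.
  rewrite (_ : _ - _ = - (G x - G x') + (G x - G y)); last by rewrite opprB addrA subrK.
  rewrite (le_trans (ler_normD _ _))// normrN [e]splitr lerD//; apply: dP => //=.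
  by rewrite in_itv/= ay yb.
move=> d0 /= d00 H.
exists (d0 / 2); first by rewrite divr_gt0.
move=> x y ax xb ay yb xy.
apply: (H (d0 / 2)) => //=.
- by rewrite sub0r normrN gtr0_norm ?divr_gt0// ltr_pdivrMr// ltr_pMr// ltr1n.
- by rewrite divr_gt0.
- by rewrite in_itv/= ax xb.
Unshelve. all: by end_near. Qed.

Lemma primitive_continuous a b F X : int_on a b F -> a <= b ->
  (forall x y, a <= x -> x <= y -> y <= b ->
     X y - X x = \int[mu]_(r in `[x, y]) F r) ->
  {within `[a, b], continuous X}.
Proof.
move=> iF ab XF.
have cF := parameterized_integral_continuous ab iF.
have XE y : a <= y -> y <= b -> X y = X a + parameterized_integral mu a y F.
  by move=> ay yb; rewrite /parameterized_integral -(XF a y)// addrC subrK.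
apply/subspace_continuousP => x xab.
rewrite /from_subspace/=.
have := xab; rewrite /= in_itv/= => /andP[ax xb].
rewrite (XE _ ax xb).
apply: (@cvg_trans _ ((fun y => X a + parameterized_integral mu a y F) @ within `[a, b] (nbhs x))).
  apply: near_eq_cvg; rewrite near_withinE; near=> y => /=.
  by rewrite in_itv/= => /andP[ay yb]; rewrite (XE y).
by apply: cvgD; [exact: cvg_cst|exact: (subspace_continuousP _ _).1 cF x xab].
Unshelve. all: by end_near. Qed.

Lemma continuous_itv_bounded a b G : {within `[a, b], continuous G} ->
  exists2 M, 0 <= M & forall x, a <= x -> x <= b -> `|G x| <= M.
Proof.
move=> cG; have := compact_bounded (continuous_compact cG (@segment_compact R a b)).
move=> [M [_ HM]]; exists (`|M| + 1) => [|x ax xb]; first by rewrite addr_ge0.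
apply: (HM (`|M| + 1)); last by exists x => //=; rewrite in_itv/= ax xb.
by rewrite (le_lt_trans (ler_norm _))// ltrDl.
Qed.

Lemma continuous_itv_measurable a b G : {within `[a, b], continuous G} ->
  measurable_fun `[a, b] G.
Proof. by move=> cG; exact: subspace_continuous_measurable_fun. Qed.

Lemma int_on_dominated a b F G : measurable_fun `[a, b] F -> int_on a b G ->
  (forall x, a <= x -> x <= b -> `|F x| <= G x) -> int_on a b F.
Proof.
move=> mF iG FG; apply: (le_integrable _ _ _ iG) => //.
  exact/measurable_EFinP.
move=> x; rewrite /= in_itv/= => /andP[ax xb].
by rewrite lee_fin (le_trans (FG _ ax xb))// ler_norm.
Qed.

Lemma int_onD a b F G : int_on a b F -> int_on a b G -> int_on a b (fun x => F x + G x).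
Proof.
move=> iF iG; apply: eq_integrable (integrableD _ iF iG) => //.
Qed.

Lemma int_onZ a b k F : int_on a b F -> int_on a b (fun x => k * F x).
Proof.
move=> iF; apply: eq_integrable (integrableZl _ k iF) => //.
Qed.

Lemma int_on_norm a b F : int_on a b F -> int_on a b (fun x => `|F x|).
Proof. by move=> iF; apply: eq_integrable (integrable_abse iF). Qed.

Lemma int_on_cst a b k : int_on a b (fun=> k).
Proof.
apply/integrableP; split; first exact: measurable_cst.
under eq_integral do rewrite /=.
rewrite integral_cst//= lebesgue_measure_itv/=.
by case: ifP => _; rewrite ?mule0// -EFinD -EFinM ltry.
Qed.

Lemma int_on_bddM a b F G : int_on a b F -> measurable_fun `[a, b] G ->
  (exists M, forall x, a <= x -> x <= b -> `|G x| <= M) ->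
  int_on a b (fun x => G x * F x).
Proof.
move=> iF mG [M GM]; apply: (@int_on_dominated _ _ _ (fun x => M * `|F x|)).
- apply: measurable_funM => //; apply/measurable_EFinP; exact: (measurable_int mu).
- exact/int_onZ/int_on_norm.
- by move=> x ax xb; rewrite normrM ler_wpM2r// GM.
Qed.

Lemma int_on_contM a b F G : int_on a b F -> {within `[a, b], continuous G} ->
  int_on a b (fun x => G x * F x).
Proof.
move=> iF cG; apply: int_on_bddM => //; first exact: continuous_itv_measurable.
by have [M _ H] := continuous_itv_bounded cG; exists M.
Qed.

Lemma int_on_cont a b G : {within `[a, b], continuous G} -> int_on a b G.
Proof.
move=> cG; have := int_on_contM (int_on_cst a b 1) cG.
by under [in X in X -> _]eq_fun do rewrite mulr1.
Qed.

Lemma Rint_le_norm a b F G e : int_on a b F -> int_on a b (fun r => G r * F r) ->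
  (forall r, a <= r -> r <= b -> `|G r| <= e) ->
  `|\int[mu]_(r in `[a, b]) (G r * F r)| <= e * \int[mu]_(r in `[a, b]) `|F r|.
Proof.
move=> iF iGF Ge; apply: (le_trans (le_normr_Rintegral _ iGF)) => //.
rewrite -RintegralZl//; last exact: int_on_norm.
apply: le_Rintegral => //; first exact: int_on_norm iGF.
  exact/int_onZ/int_on_norm.
by move=> r; rewrite /= in_itv/= => /andP[ar rb]; rewrite normrM ler_wpM2r// Ge.
Qed.

Lemma additive_small_eq0 a b (phi m : R -> R -> R) : a <= b ->
  (forall x y z, a <= x -> x <= y -> y <= z -> z <= b ->
     phi x z = phi x y + phi y z) ->
  (forall x y z, a <= x -> x <= y -> y <= z -> z <= b ->
     m x z = m x y + m y z) ->
  (forall e, 0 < e -> exists2 d, 0 < d & forall x y, a <= x -> x <= y ->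
     y <= b -> y - x < d -> `|phi x y| <= e * m x y) ->
  phi a b = 0.
Proof.
move=> ab addphi addm small; apply/eqP; rewrite eq_le; apply/andP; split.
  apply: (additive_small_le0 ab addphi addm) => e /small[d d0 H]; exists d => //.
  by move=> x y ax xy yb yx; rewrite (le_trans (ler_norm _))// H.
rewrite -oppr_le0.
apply: (@additive_small_le0 _ _ (fun x y => - phi x y) m ab _ addm).
  by move=> x y z ax xy yz zb; rewrite (addphi _ y)// opprD.
move=> e /small[d d0 H]; exists d => //.
by move=> x y ax xy yb yx; rewrite (le_trans (ler_norm _))// normrN H.
Qed.

Lemma Rint_norm_additive a b F : int_on a b F ->
  forall x y z, a <= x -> x <= y -> y <= z -> z <= b ->
  \int[mu]_(r in `[x, z]) `|F r| =
  \int[mu]_(r in `[x, y]) `|F r| + \int[mu]_(r in `[y, z]) `|F r|.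
Proof.
move=> iF x y z ax xy yz zb; apply: Rint_split => //.
exact/int_on_norm/(int_on_sub iF).
Qed.

(** Chain rule for the square of a primitive: on a short interval [x, y] the
    two sides differ by the integral of F against X y + X x - 2 X, which is
    small by uniform continuity. *)
Lemma sqr_primitive a b F X : a <= b -> int_on a b F ->
  (forall x y, a <= x -> x <= y -> y <= b ->
     X y - X x = \int[mu]_(r in `[x, y]) F r) ->
  X b ^+ 2 - X a ^+ 2 = \int[mu]_(r in `[a, b]) (2 * X r * F r).
Proof.
move=> ab iF XF.
have cX := primitive_continuous iF ab XF.
have iXF : int_on a b (fun r => 2 * X r * F r).
  under [X in int_on _ _ X]eq_fun do rewrite -mulrA.
  exact/int_onZ/int_on_contM.
apply/eqP; rewrite -subr_eq0; apply/eqP.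
pose phi x y := X y ^+ 2 - X x ^+ 2 - \int[mu]_(r in `[x, y]) (2 * X r * F r).
apply: (@additive_small_eq0 _ _ phi (fun x y => \int[mu]_(r in `[x, y]) `|F r|)) => //.
- move=> x y z ax xy yz zb; rewrite /phi (@Rint_split x y z)//; first lra.
  exact: int_on_sub iXF _ _.
- exact: Rint_norm_additive.
move=> e e0; have e2 : 0 < e / 2 by rewrite divr_gt0.
have [d d0 dP] := uniformly_continuous_itv cX e2.
exists d => // x y ax xy yb yx.
have iFxy : int_on x y F by exact: int_on_sub iF _ _.
have iXFxy : int_on x y (fun r => 2 * X r * F r) by exact: int_on_sub iXF _ _.
have -> : phi x y = \int[mu]_(r in `[x, y]) ((X y + X x - 2 * X r) * F r).
  rewrite /phi subr_sqr mulrC (XF _ _ ax xy yb).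
  rewrite -RintegralZl// -RintegralB//; last exact: int_onZ.
  by apply: eq_Rintegral => r _; rewrite mulrBl.
apply: Rint_le_norm => //.
  have : int_on x y (fun r => (X y + X x) * F r + (-1) * (2 * X r * F r)).
    by apply: int_onD; [exact: int_onZ|apply: int_onZ].
  by congr int_on; apply/funext => r; ring.
move=> r xr ry.
have -> : X y + X x - 2 * X r = (X y - X r) + (X x - X r) by ring.
rewrite (le_trans (ler_normD _ _))// [e]splitr lerD//; apply: dP => //; try lra.
  by rewrite ger0_norm; lra.
by rewrite ler0_norm; lra.
Qed.

(** Gronwall's inequality in integral form, with an integrable rate of any
    sign.  On a short interval [x, y] the increment of E exp (- G), with G the
    primitive of g, is at most exp (- G y) times the integral of
    g (E - E x), by convexity of the exponential. *)
Lemma gronwall a b (E g : R -> R) : a <= b ->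
  {within `[a, b], continuous E} -> int_on a b g ->
  (forall x, a <= x -> x <= b -> 0 <= E x) ->
  (forall x y, a <= x -> x <= y -> y <= b ->
     E y - E x <= \int[mu]_(r in `[x, y]) (E r * g r)) ->
  E b <= E a * expR (\int[mu]_(r in `[a, b]) g r).
Proof.
move=> ab cE ig E0 Eg.
pose G x := \int[mu]_(r in `[a, x]) g r.
have GE x y : a <= x -> x <= y -> y <= b -> G y - G x = \int[mu]_(r in `[x, y]) g r.
  move=> ax xy yb; rewrite /G (@Rint_split a x y)//; first by rewrite addrC addKr.
  exact: int_on_sub ig _ _.
have cG := primitive_continuous ig ab GE.
have [M M0 GM] := continuous_itv_bounded cG.
have iEg : int_on a b (fun r => E r * g r) by exact: int_on_contM.
suff H : E b * expR (- G b) - E a * expR (- G a) <= 0.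
  have Ga : G a = 0.
    by have := GE _ _ (lexx a) (lexx a) ab; rewrite /G subrr => <-.
  move: H; rewrite Ga oppr0 expR0 mulr1 subr_le0 expRN.
  by rewrite ler_pdivrMr ?expR_gt0.
pose phi x y := E y * expR (- G y) - E x * expR (- G x).
apply: (@additive_small_le0 _ _ phi (fun x y => \int[mu]_(r in `[x, y]) `|g r|)) => //.
- by move=> x y z ax xy yz zb; rewrite /phi [RHS]addrC addrA subrK.
- exact: Rint_norm_additive.
move=> e e0; have e2 : 0 < e / expR M by rewrite divr_gt0 ?expR_gt0.
have [d d0 dP] := uniformly_continuous_itv cE e2.
exists d => // x y ax xy yb yx.
have igxy : int_on x y g by exact: int_on_sub ig _ _.
have iEgxy : int_on x y (fun r => E r * g r) by exact: int_on_sub iEg _ _.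
have iD : int_on x y (fun r => (E r - E x) * g r).
  have : int_on x y (fun r => E r * g r + (- E x) * g r).
    by apply: int_onD => //; exact: int_onZ.
  by congr int_on; apply/funext => r; ring.
have step : phi x y <= expR (- G y) * \int[mu]_(r in `[x, y]) ((E r - E x) * g r).
  have -> : \int[mu]_(r in `[x, y]) ((E r - E x) * g r) =
      \int[mu]_(r in `[x, y]) (E r * g r) - E x * (G y - G x).
    rewrite GE// -RintegralZl// -RintegralB//; last exact: int_onZ.
    by apply: eq_Rintegral => r _; rewrite mulrBl.
  have -> : phi x y = expR (- G y) * (E y - E x * expR (G y - G x)).
    rewrite /phi mulrBr mulrCA -expRD addrA addNr add0r mulrC; congr (_ - _).
  rewrite ler_wpM2l ?expR_ge0//.
  have := Eg _ _ ax xy yb; have := expR_ge1Dx (G y - G x).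
  have := E0 x ax (le_trans xy yb) => Ex0 ex.
  have := ler_wpM2l Ex0 ex; rewrite mulrDr mulr1; lra.
apply: (le_trans step).
have b0 : 0 <= \int[mu]_(r in `[x, y]) `|g r| by apply: Rintegral_ge0.
apply: (@le_trans _ _ (expR M * (e / expR M * \int[mu]_(r in `[x, y]) `|g r|))).
  apply: (le_trans (ler_norm _)); rewrite normrM; apply: ler_pM => //.
    rewrite ger0_norm ?expR_ge0// ler_expR (le_trans (ler_norm _))// normrN.
    by apply: GM => //; exact: le_trans xy.
  apply: Rint_le_norm => // r xr ry; apply: dP => //; try lra.
  by rewrite ger0_norm; lra.
by rewrite mulrA mulrCA divff ?mulr1// gt_eqF ?expR_gt0.
Qed.

End TimeCalculus.

(** * Sums over the lattice of wave vectors *)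

Fixpoint centered_ints (N : nat) : seq int :=
  if N is M.+1 then M.+1%:Z :: - M.+1%:Z :: centered_ints M else [:: 0].

Lemma mem_centered_ints N i : (i \in centered_ints N) = (`|i| <= N)%N.
Proof.
elim: N => [|N IH]; first by rewrite inE; lia.
by rewrite !inE IH; lia.
Qed.

Lemma centered_ints_uniq N : uniq (centered_ints N).
Proof.
elim: N => [//|N IH].
by rewrite /= inE !mem_centered_ints IH; lia.
Qed.

Definition mode_of (i l : int) : mode := \row_j (if j == 0 then i else l).

Definition box (N : nat) : seq mode :=
  [seq mode_of i l | i <- centered_ints N, l <- centered_ints N].

Lemma mode_of0 i l : mode_of i l 0 0 = i. Proof. by rewrite mxE. Qed.
Lemma mode_of1 i l : mode_of i l 0 1 = l. Proof. by rewrite mxE. Qed.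

Lemma sum2E (V : nmodType) (F : 'I_2 -> V) : \sum_(j < 2) F j = F 0 + F 1.
Proof. by rewrite big_ord_recl big_ord1; congr (_ + F _); exact/val_inj. Qed.

Lemma mode_ofK (k : mode) : mode_of (k 0 0) (k 0 1) = k.
Proof.
apply/rowP => j; rewrite mxE; case: ifPn => [/eqP->//|].
by case: j => -[|[|//]] // h _; congr (k 0 _); apply/val_inj.
Qed.

Lemma mem_box N (k : mode) :
  (k \in box N) = (`|k 0%R 0%R| <= N)%N && (`|k 0%R 1%R| <= N)%N.
Proof.
apply/allpairsP/andP => [[[i l] /= [iN lN ->]]|[h0 h1]].
  by rewrite mode_of0 mode_of1 -!mem_centered_ints.
by exists (k 0 0, k 0 1); rewrite /= !mem_centered_ints h0 h1 mode_ofK.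
Qed.

Lemma box_uniq N : uniq (box N).
Proof.
apply: allpairs_uniq; [exact: centered_ints_uniq|exact: centered_ints_uniq|].
move=> [i l] [i' l'] _ _ /= e.
have := congr1 (fun k : mode => k 0 0) e; have := congr1 (fun k : mode => k 0 1) e.
by rewrite !mode_of0 !mode_of1 => -> ->.
Qed.

Lemma box_le M N k : (M <= N)%N -> k \in box M -> k \in box N.
Proof. by rewrite !mem_box => MN /andP[a b]; rewrite !(leq_trans _ MN). Qed.

Lemma seq_sub_box (s : seq mode) : exists N, forall k, k \in s -> k \in box N.
Proof.
elim: s => [|k s [N IH]]; first by exists 0%N.
exists (maxn N (maxn `|k 0%R 0%R| `|k 0%R 1%R|)%N) => q; rewrite inE => /predU1P[->|/IH].
  by rewrite mem_box; lia.
by apply: box_le; rewrite leq_maxl.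
Qed.

Section LatticeSums.
Context {R : realType}.
Implicit Types (a b c d : mode -> R) (s t : seq mode) (A B M : R).

(** A summability certificate for nonnegative families which avoids extended
    reals. *)
Definition sums_le a B := forall s, uniq s -> \sum_(k <- s) a k <= B.

Definition abs_summable a := exists B, sums_le (fun k => `|a k|) B.

Lemma ler_sum_sub a s t : (forall k, 0 <= a k) -> uniq s -> uniq t ->
  {subset s <= t} -> \sum_(k <- s) a k <= \sum_(k <- t) a k.
Proof.
move=> a0 us ut st.
rewrite [leRHS](bigID (mem s))/=.
have -> : \sum_(k <- t | k \in s) a k = \sum_(k <- s) a k; last first.
  by rewrite lerDl sumr_ge0.
rewrite -big_filter; apply: perm_big; rewrite uniq_perm ?filter_uniq// => k; rewrite mem_filter.
by case: (boolP (k \in s)) => //= /st.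
Qed.

Lemma sums_le_ge0 a B : sums_le a B -> 0 <= B.
Proof. by move=> /(_ [::] isT); rewrite big_nil. Qed.

Lemma sums_le_box a B : (forall k, 0 <= a k) ->
  (forall N, \sum_(k <- box N) a k <= B) -> sums_le a B.
Proof.
move=> a0 H s us; have [N sN] := seq_sub_box s.
by apply: le_trans (H N); apply: ler_sum_sub => //; exact: box_uniq.
Qed.

Lemma sums_le_le a b B : (forall k, a k <= b k) -> sums_le b B -> sums_le a B.
Proof. by move=> ab bB s us; apply: le_trans (bB s us); exact: ler_sum. Qed.

Lemma sums_leD a b A B : sums_le a A -> sums_le b B ->
  sums_le (fun k => a k + b k) (A + B).
Proof. by move=> aA bB s us; rewrite big_split lerD ?aA ?bB. Qed.

Lemma sums_leZ a A x : 0 <= x -> sums_le a A -> sums_le (fun k => x * a k) (x * A).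
Proof. by move=> x0 aA s us; rewrite -mulr_sumr ler_wpM2l// aA. Qed.

Lemma sums_le_reindex a A (h : mode -> mode) : injective h -> sums_le a A ->
  sums_le (fun k => a (h k)) A.
Proof.
move=> ih aA s us; rewrite -(big_map h xpredT a); apply: aA.
by rewrite map_inj_uniq.
Qed.

Lemma box_sum_nondecreasing a : (forall k, 0 <= a k) ->
  {homo (fun N => \sum_(k <- box N) a k) : m n / (m <= n)%N >-> m <= n}.
Proof.
move=> a0 m n mn; apply: ler_sum_sub => //; [exact: box_uniq|exact: box_uniq|].
by move=> k; exact: box_le.
Qed.

Lemma esum_box a : (forall k, 0 <= a k) ->
  (\sum_(k <- box N) a k)%:E @[N --> \oo] --> (\esum_(k in setT) (a k)%:E)%E.
Proof.
move=> a0.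
have -> : (\esum_(k in setT) (a k)%:E)%E =
    ereal_sup (range (fun N => (\sum_(k <- box N) a k)%:E)).
  apply/eqP; rewrite eq_le; apply/andP; split.
    apply: ge_ereal_sup => _ [X [finX _] <-].
    rewrite fsbig_finite//= sumEFin.
    have [N XN] := seq_sub_box (finmap.enum_fset (fset_set X)).
    apply: (@le_trans _ _ (\sum_(k <- box N) a k)%:E).
      by rewrite lee_fin; apply: ler_sum_sub => //; [exact: finmap.fset_uniq|exact: box_uniq].
    by apply: ereal_sup_ubound; exists N.
  apply: ge_ereal_sup => _ [N _ <-].
  apply: ereal_sup_ubound; exists [set` box N].
    by split => //; exact: finite_seq.
  by rewrite -fsbig_seq ?box_uniq// sumEFin.
apply: ereal_nondecreasing_cvgn => m n mn.
by rewrite lee_fin; exact: box_sum_nondecreasing.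
Qed.

Lemma sums_le_esum a B : (forall k, 0 <= a k) -> sums_le a B ->
  (\esum_(k in setT) (a k)%:E <= B%:E)%E.
Proof.
move=> a0 aB; apply: ge_ereal_sup => _ [X [finX _] <-].
by rewrite fsbig_finite//= sumEFin lee_fin aB// finmap.fset_uniq.
Qed.

Lemma esum_sums_le a : (forall k, 0 <= a k) ->
  (\esum_(k in setT) (a k)%:E < +oo)%E ->
  sums_le a (fine (\esum_(k in setT) (a k)%:E)).
Proof.
move=> a0 afin; have e0 : (0 <= \esum_(k in setT) (a k)%:E)%E.
  by apply: esum_ge0 => k _; rewrite lee_fin.
move=> s us; rewrite -lee_fin fineK; last by rewrite ge0_fin_numE.
apply: ereal_sup_ubound; exists [set` s]; first by split => //; exact: finite_seq.
by rewrite -fsbig_seq// sumEFin.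
Qed.

Lemma rsum_pos a B : (forall k, 0 <= a k) -> sums_le a B ->
  \sum_(k <- box N) a k @[N --> \oo] --> fine (\esum_(k in setT) (a k)%:E).
Proof.
move=> a0 aB; have := esum_box a0.
rewrite -(@fineK _ (\esum_(k in setT) (a k)%:E)%E); first exact: fine_cvg.
rewrite ge0_fin_numE; last by apply: esum_ge0 => k _; rewrite lee_fin.
by rewrite (le_lt_trans (sums_le_esum a0 aB))// ltry.
Qed.

(** The sum is defined by the positive and negative parts; its linearity comes
    from this description as a limit. *)
Lemma rsum_box a : abs_summable a ->
  \sum_(k <- box N) a k @[N --> \oo] --> rsum a.
Proof.
move=> [B aB].
have pB : sums_le (fun k => Num.max (a k) 0) B.
  apply: sums_le_le aB => k; by rewrite ge_max normr_ge0 ler_norm.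
have nB : sums_le (fun k => Num.max (- a k) 0) B.
  apply: sums_le_le aB => k; by rewrite ge_max normr_ge0 -normrN ler_norm.
have p0 k : 0 <= Num.max (a k) 0 by rewrite le_max lexx orbT.
have n0 k : 0 <= Num.max (- a k) 0 by rewrite le_max lexx orbT.
have -> : (fun N => \sum_(k <- box N) a k) = (fun N =>
    \sum_(k <- box N) Num.max (a k) 0 - \sum_(k <- box N) Num.max (- a k) 0).
  apply/funext => N; rewrite -sumrB; apply: eq_bigr => k _.
  by rewrite /Num.max; case: ltP => ?; case: ltP => ?; lra.
exact: cvgB (rsum_pos p0 pB) (rsum_pos n0 nB).
Qed.

Lemma rsum_unique a l : abs_summable a ->
  \sum_(k <- box N) a k @[N --> \oo] --> l -> rsum a = l.
Proof. by move=> /rsum_box sa al; exact: cvg_unique sa al. Qed.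

Lemma abs_summableD a b : abs_summable a -> abs_summable b ->
  abs_summable (fun k => a k + b k).
Proof.
move=> [A aA] [B bB]; exists (A + B); apply: sums_le_le (sums_leD aA bB) => k.
exact: ler_normD.
Qed.

Lemma abs_summableZ x a : abs_summable a -> abs_summable (fun k => x * a k).
Proof.
move=> [A aA]; exists (`|x| * A); apply: sums_le_le (sums_leZ _ aA) => // k.
by rewrite normrM.
Qed.

Lemma abs_summable_le a b B : (forall k, `|a k| <= b k) -> sums_le b B ->
  abs_summable a.
Proof. by move=> ab bB; exists B; exact: sums_le_le bB. Qed.

Lemma rsumD a b : abs_summable a -> abs_summable b ->
  rsum (fun k => a k + b k) = rsum a + rsum b.
Proof.
move=> sa sb; apply: rsum_unique; first exact: abs_summableD.
under eq_fun do rewrite big_split; apply: cvgD; exact: rsum_box.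
Qed.

Lemma rsumZ x a : abs_summable a -> rsum (fun k => x * a k) = x * rsum a.
Proof.
move=> sa; apply: rsum_unique; first exact: abs_summableZ.
under eq_fun do rewrite -mulr_sumr; apply: cvgMr; exact: rsum_box.
Qed.

Lemma rsumN a : abs_summable a -> rsum (fun k => - a k) = - rsum a.
Proof.
move=> sa; rewrite -mulN1r -rsumZ//; congr rsum.
by apply/funext => k; rewrite mulN1r.
Qed.

Lemma abs_summableN a : abs_summable a -> abs_summable (fun k => - a k).
Proof. by move=> [B H]; exists B; apply: sums_le_le H => k; rewrite normrN. Qed.

Lemma eq_rsum a b : a =1 b -> rsum a = rsum b.
Proof. by move=> /funext ->. Qed.

Lemma rsum_norm_le a B : sums_le (fun k => `|a k|) B -> `|rsum a| <= B.
Proof.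
move=> aB; have sa : abs_summable a by exists B.
have /(cvg_norm) /cvg_lim <- // := rsum_box sa.
apply: limr_le; first by apply: is_cvg_norm; apply/cvg_ex; exists (rsum a); exact: rsum_box.
near=> N; apply: (le_trans (ler_norm_sum _ _ _)); apply: aB; exact: box_uniq.
Unshelve. all: by end_near. Qed.

Lemma rsum_le a B : abs_summable a -> sums_le a B -> rsum a <= B.
Proof.
move=> sa aB; have /cvg_lim <- // := rsum_box sa.
apply: limr_le; first by apply/cvg_ex; exists (rsum a); exact: rsum_box.
by near=> N; apply: aB; exact: box_uniq.
Unshelve. all: by end_near. Qed.

Lemma abs_summable_pos a B : (forall k, 0 <= a k) -> sums_le a B -> abs_summable a.
Proof. by move=> a0 aB; apply: abs_summable_le aB => k; rewrite ger0_norm. Qed.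

Lemma sums_le_rsum a : (forall k, 0 <= a k) -> abs_summable a -> sums_le a (rsum a).
Proof.
move=> a0 sa; apply: sums_le_box => // N.
have /cvg_lim <- // := rsum_box sa.
apply: nondecreasing_cvgn_le; first exact: box_sum_nondecreasing.
by apply/cvg_ex; exists (rsum a); exact: rsum_box.
Qed.

Lemma rsum_supp a N : (forall k, k \notin box N -> a k = 0) ->
  rsum a = \sum_(k <- box N) a k.
Proof.
move=> a0.
have bigE b (M : nat) : (N <= M)%N -> (forall k, k \notin box N -> b k = 0) ->
    \sum_(k <- box M) b k = \sum_(k <- box N) b k.
  move=> NM b0; rewrite (bigID (mem (box N)))/= [X in _ + X]big1// addr0.
  rewrite -big_filter; apply: perm_big.
  rewrite uniq_perm ?filter_uniq ?box_uniq// => k; rewrite mem_filter.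
  by case: (boolP (k \in box N)) => // /(box_le NM) ->.
apply: rsum_unique.
  exists (\sum_(k <- box N) `|a k|); apply: sums_le_box => // M.
  apply: (@le_trans _ _ (\sum_(k <- box (maxn M N)) `|a k|)).
    by apply: box_sum_nondecreasing => //; rewrite leq_maxl.
  rewrite bigE//; first by rewrite leq_maxr.
  by move=> k /a0 ->; rewrite normr0.
apply: cvg_near_cst; near=> M; apply: bigE => //; near: M; exact: nbhs_infty_ge.
Unshelve. all: by end_near. Qed.

Lemma esum_rsum a : (forall k, 0 <= a k) -> abs_summable a ->
  (\esum_(k in setT) (a k)%:E)%E = (rsum a)%:E.
Proof.
move=> a0 sa; apply: (cvg_unique _ (esum_box a0)) => //.
by apply/fine_cvgP; split; [exact: nearW|exact: rsum_box].
Qed.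

Lemma abs_summable_esum a : (forall k, 0 <= a k) ->
  (\esum_(k in setT) (a k)%:E < +oo)%E -> abs_summable a.
Proof. by move=> a0 /(esum_sums_le a0) H; exact: abs_summable_pos H. Qed.

Lemma rsum_sum (I : eqType) (r : seq I) (g : I -> mode -> R) :
  (forall i, abs_summable (g i)) ->
  rsum (fun k => \sum_(i <- r) g i k) = \sum_(i <- r) rsum (g i) /\
  abs_summable (fun k => \sum_(i <- r) g i k).
Proof.
move=> sg; elim: r => [|i r [IH sr]].
  have z0 : (fun k : mode => \sum_(i <- [::]) g i k) = (fun=> 0).
    by apply/funext => k; rewrite big_nil.
  rewrite z0 big_nil; split.
    by rewrite (@rsum_supp _ 0%N)// big1.
  by exists 0 => s _; rewrite big1// => k _; rewrite normr0.
have -> : (fun k => \sum_(j <- i :: r) g j k) = (fun k => g i k + \sum_(j <- r) g j k).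
  by apply/funext => k; rewrite big_cons.
by rewrite big_cons rsumD// IH; split => //; exact: abs_summableD.
Qed.

Lemma sqabs_ge0 (k : mode) : 0 <= sqabs k :> R.
Proof. by apply: sumr_ge0 => j _; rewrite sqr_ge0. Qed.

Lemma sqabs2 (k : mode) : sqabs k = (k 0 0)%:~R ^+ 2 + (k 0 1)%:~R ^+ 2 :> R.
Proof. by rewrite /sqabs sum2E. Qed.

Lemma sqr_intr_ge1 (i : int) : i != 0 -> 1 <= i%:~R ^+ 2 :> R.
Proof.
move=> i0; rewrite -rmorphXn/= -[1]/(1%:~R) ler_int.
by rewrite -gtz0_ge1 exprn_even_gt0.
Qed.

Lemma sqabs_ge1 (k : mode) : k != 0 -> 1 <= sqabs k :> R.
Proof.
move=> k0; rewrite sqabs2; have [k00|k00] := eqVneq (k 0 0) 0; last first.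
  by rewrite (le_trans (sqr_intr_ge1 k00))// lerDl sqr_ge0.
have [k01|k01] := eqVneq (k 0 1) 0; last first.
  by rewrite (le_trans (sqr_intr_ge1 k01))// lerDr sqr_ge0.
by move: k0; rewrite -(mode_ofK k) k00 k01 => /eqP[]; apply/rowP => j; rewrite !mxE; case: ifP.
Qed.

Lemma sqabs0 : sqabs (0 : mode) = 0 :> R.
Proof. by rewrite sqabs2 !mxE expr0n/= addr0. Qed.

(** The bound telescopes: the two terms of absolute value x contribute
    2 / (1 + x^2) <= 4 / x - 4 / (x + 1), and the central term is 1. *)
Lemma sum_int_inv_sqr N :
  \sum_(i <- centered_ints N) (1 + i%:~R ^+ 2)^-1 <= 5 - 4 / N.+1%:R :> R.
Proof.
elim: N => [|N IH] /=; first by rewrite big_seq1 expr0n/= addr0 divr1; lra.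
rewrite !big_cons mulrNz sqrrN addrA.
have -> : N.+1%:Z%:~R = N.+1%:R :> R by [].
set x : R := N.+1%:R in IH *; have x1 : 1 <= x by rewrite /x ler1n.
have -> : N.+2%:R = x + 1 by rewrite /x -[N.+2]addn1 natrD.
suff hh : (1 + x ^+ 2)^-1 + (1 + x ^+ 2)^-1 <= 4 / x - 4 / (x + 1).
  by rewrite (le_trans (lerD hh IH))//; move: (4 / x) (4 / (x + 1)) => u v; lra.
have -> : 4 / x - 4 / (x + 1) = 4 / (x * (x + 1)) by field; apply/andP; split; lra.
have -> : (1 + x ^+ 2)^-1 + (1 + x ^+ 2)^-1 = 2 / (1 + x ^+ 2) by rewrite mulr_natl mulr2n.
have p1 : 0 < 1 + x ^+ 2 by nra.
have p2 : 0 < x * (x + 1) by nra.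
by rewrite ler_pdivlMr// mulrAC ler_pdivrMr//; nra.
Qed.

(** By comparison of |k|^4 with (1 + k_0^2) (1 + k_1^2) / 4, whose inverse is a
    product of two one-dimensional terms. *)
Lemma sums_le_inv_sqabs : sums_le (fun k : mode => (sqabs k)^-1 ^+ 2 : R) 100.
Proof.
apply: sums_le_box => [k|N]; first exact: sqr_ge0.
pose q (i : int) : R := (1 + i%:~R ^+ 2)^-1.
have q0 i : 0 <= q i by rewrite invr_ge0; have := sqr_ge0 (i%:~R : R); lra.
have H k : (sqabs k)^-1 ^+ 2 <= 4 * (q (k 0 0) * q (k 0 1)).
  have [->|k0] := eqVneq k 0.
    by rewrite sqabs0 invr0 expr0n/= !mulr_ge0.
  have := sqabs_ge1 k0; rewrite /q -invfM sqabs2.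
  move: (_ ^+ 2) (sqr_ge0 ((k 0 0)%:~R : R)) => x x0.
  move: (_ ^+ 2) (sqr_ge0 ((k 0 1)%:~R : R)) => y y0 xy.
  have xy0 : 0 < x + y by lra.
  have p1 : 0 < (1 + x) * (1 + y) by nra.
  have p2 : 0 < (x + y) ^+ 2 by nra.
  by rewrite exprVn ler_pdivlMr// mulrC ler_pdivrMr//; nra.
apply: (le_trans (ler_sum _ (fun k _ => H k))).
rewrite -mulr_sumr /box big_allpairs_dep/=.
under eq_bigr => i _ do under eq_bigr => l _ do rewrite mode_of0 mode_of1.
under eq_bigr => i _ do rewrite -mulr_sumr.
rewrite -mulr_suml.
have s5 : \sum_(i <- centered_ints N) q i <= 5.
  apply: (le_trans (sum_int_inv_sqr N)).
  by rewrite gerBl divr_ge0.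
have : 0 <= \sum_(i <- centered_ints N) q i by exact: sumr_ge0.
by move: (\sum_(_ <- _) _) s5 => x; nra.
Qed.

(** The inequality 2 x y <= x^2 + y^2 is used twice, for b k * h k p with p
    fixed, then for a p * w p. *)
Lemma kernel_sum_le (a b w : mode -> R) (h : mode -> mode -> R) A B D Q s t :
  (forall k, 0 <= a k) -> (forall k, 0 <= w k) ->
  sums_le (fun k => a k ^+ 2) A -> sums_le (fun k => b k ^+ 2) B ->
  sums_le (fun k => w k ^+ 2) Q -> (forall p, sums_le (fun k => h k p ^+ 2) D) ->
  uniq s -> uniq t ->
  \sum_(p <- t) \sum_(k <- s) a p * w p * (b k * h k p) <=
  (A + Q) / 2 * ((B + D) / 2).
Proof.
move=> a0 w0 aA bB wQ hD us ut.
have B0 := sums_le_ge0 bB; have D0 := sums_le_ge0 (hD 0).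
apply: (@le_trans _ _ (\sum_(p <- t) a p * w p * ((B + D) / 2))).
  apply: ler_sum => p _; rewrite -mulr_sumr ler_wpM2l ?mulr_ge0//.
  apply: (@le_trans _ _ (\sum_(k <- s) (b k ^+ 2 + h k p ^+ 2) / 2)).
    by apply: ler_sum => k _; have := sqr_ge0 (b k - h k p); nra.
  rewrite -mulr_suml big_split ler_wpM2r ?invr_ge0//= lerD//; [exact: bB|exact: hD].
rewrite -mulr_suml ler_wpM2r ?divr_ge0 ?addr_ge0//.
apply: (@le_trans _ _ (\sum_(p <- t) (a p ^+ 2 + w p ^+ 2) / 2)).
  by apply: ler_sum => k _; have := sqr_ge0 (a k - w k); nra.
by rewrite -mulr_suml big_split ler_wpM2r ?invr_ge0//= lerD//; [exact: aA|exact: wQ].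
Qed.

Definition trilinear_const A B D : R :=
  (A + 100) / 2 * ((B + D) / 2) + (B + 100) / 2 * ((A + D) / 2).

(** The convolution of two families against a third one, two of which are
    square summable with weight |k|^2 and the third square summable.  Writing
    c p = a p / |p| and e k = b k / |k|, the weight 1 / (|p| |k|) is at most
    (|p|^-2 + |k|^-2) / 2, and in each half the sum over the other variable is
    a scalar product of square summable families. *)
Lemma trilinear_bound (c d e : mode -> R) A B D s t :
  (forall k, 0 <= c k) -> (forall k, 0 <= d k) -> (forall k, 0 <= e k) ->
  c 0 = 0 -> e 0 = 0 ->
  sums_le (fun k => sqabs k * c k ^+ 2) A ->
  sums_le (fun k => sqabs k * e k ^+ 2) B ->
  sums_le (fun k => d k ^+ 2) D ->
  uniq s -> uniq t ->
  \sum_(k <- s) \sum_(p <- t) c p * d (k - p) * e k <= trilinear_const A B D.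
Proof.
move=> c0 d0 e0 cz ez cA eB dD us ut.
pose w (k : mode) : R := (sqabs k)^-1.
pose a k := Num.sqrt (sqabs k) * c k; pose b k := Num.sqrt (sqabs k) * e k.
have w0 k : 0 <= w k by rewrite invr_ge0 sqabs_ge0.
have a0 k : 0 <= a k by rewrite mulr_ge0 ?sqrtr_ge0.
have b0 k : 0 <= b k by rewrite mulr_ge0 ?sqrtr_ge0.
have aA : sums_le (fun k => a k ^+ 2) A.
  by apply: sums_le_le cA => k; rewrite exprMn sqr_sqrtr ?sqabs_ge0.
have bB : sums_le (fun k => b k ^+ 2) B.
  by apply: sums_le_le eB => k; rewrite exprMn sqr_sqrtr ?sqabs_ge0.
have wa k : c k = a k * Num.sqrt (w k).
  have [->|k0] := eqVneq k 0; first by rewrite /a cz mulr0 mul0r.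
  rewrite /a /w mulrAC -sqrtrM ?sqabs_ge0// divff ?sqrtr1 ?mul1r//.
  by rewrite gt_eqF// (lt_le_trans _ (sqabs_ge1 k0)).
have wb k : e k = b k * Num.sqrt (w k).
  have [->|k0] := eqVneq k 0; first by rewrite /b ez mulr0 mul0r.
  rewrite /b /w mulrAC -sqrtrM ?sqabs_ge0// divff ?sqrtr1 ?mul1r//.
  by rewrite gt_eqF// (lt_le_trans _ (sqabs_ge1 k0)).
have H k p : c p * d (k - p) * e k <=
    a p * w p * (b k * d (k - p)) + b k * w k * (a p * d (k - p)).
  rewrite (wa p) (wb k).
  have -> : a p * Num.sqrt (w p) * d (k - p) * (b k * Num.sqrt (w k)) =
     (a p * b k * d (k - p)) * (Num.sqrt (w p) * Num.sqrt (w k)) by ring.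
  have -> : a p * w p * (b k * d (k - p)) + b k * w k * (a p * d (k - p)) =
     (a p * b k * d (k - p)) * (w p + w k) by ring.
  apply: ler_wpM2l; first by rewrite !mulr_ge0.
  have := sqr_ge0 (Num.sqrt (w p) - Num.sqrt (w k)).
  rewrite sqrrB !sqr_sqrtr// => h; have := w0 p; have := w0 k; lra.
apply: (@le_trans _ _ (\sum_(k <- s) \sum_(p <- t)
    (a p * w p * (b k * d (k - p)) + b k * w k * (a p * d (k - p))))).
  by apply: ler_sum => k _; apply: ler_sum => p _; exact: H.
under eq_bigr => k _ do rewrite big_split/=.
rewrite big_split /trilinear_const lerD//=.
  rewrite exchange_big/=.
  apply: (kernel_sum_le (h := fun k p => d (k - p))) sums_le_inv_sqabs _ _ _ => // p.
  by apply: (sums_le_reindex (h := fun k => k - p)) dD; exact: addIr.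
apply: (kernel_sum_le (h := fun p k => d (k - p))) sums_le_inv_sqabs _ _ _ => // k.
apply: (sums_le_reindex (h := fun p => k - p)) dD => p p' /addrI.
exact: oppr_inj.
Qed.

Lemma conv_abs_summable (c d : mode -> R) A D k : sums_le (fun p => c p ^+ 2) A ->
  sums_le (fun p => d p ^+ 2) D -> abs_summable (fun p => c p * d (k - p)).
Proof.
move=> cA dD.
apply: (@abs_summable_le _ (fun p => 2^-1 * (c p ^+ 2 + d (k - p) ^+ 2)) (2^-1 * (A + D))).
  move=> p; rewrite ler_norml; apply/andP; split.
    by have := sqr_ge0 (c p + d (k - p)); nra.
  by have := sqr_ge0 (c p - d (k - p)); nra.
apply: sums_leZ; first by rewrite invr_ge0.
apply: sums_leD => //; apply: (sums_le_reindex (h := fun p => k - p)) dD.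
by move=> p p' /addrI; exact: oppr_inj.
Qed.

Lemma conv_trilinear_summable (c d e : mode -> R) A B D :
  (forall k, 0 <= c k) -> (forall k, 0 <= d k) -> (forall k, 0 <= e k) ->
  c 0 = 0 -> e 0 = 0 ->
  sums_le (fun k => sqabs k * c k ^+ 2) A ->
  sums_le (fun k => sqabs k * e k ^+ 2) B ->
  sums_le (fun k => d k ^+ 2) D ->
  sums_le (fun k => rsum (fun p => c p * d (k - p)) * e k) (trilinear_const A B D).
Proof.
move=> c0 d0 e0 cz ez cA eB dD s us.
have cA' : sums_le (fun k => c k ^+ 2) A.
  apply: sums_le_le cA => k; have [->|k0] := eqVneq k 0.
    by rewrite cz expr0n/= mulr0.
  by rewrite ler_peMl ?sqr_ge0// sqabs_ge1.
have sk k : abs_summable (fun p => e k * (c p * d (k - p))).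
  by apply: abs_summableZ; exact: conv_abs_summable cA' dD.
have [E sE] := rsum_sum s sk.
under eq_bigr => k _.
  rewrite mulrC -rsumZ; last exact: conv_abs_summable cA' dD.
  over.
rewrite -E; apply: rsum_le => // t ut.
rewrite exchange_big/=.
apply: le_trans (trilinear_bound c0 d0 e0 cz ez cA eB dD us ut).
by apply: ler_sum => k _; apply: ler_sum => p _; rewrite mulrC.
Qed.

End LatticeSums.

(** * The trilinear form of the equation on Fourier coefficients *)

Local Open Scope complex_scope.

Section ComplexRows.
Context {R : realType}.
Implicit Types (x : R) (z w : R[i]) (a b : 'rV[R[i]]_2).

(** The l^1 norm of C = R^2 is subadditive and submultiplicative like the
    modulus, and dominates both parts. *)
Definition n1 z : R := `|complex.Re z| + `|complex.Im z|.
Definition nn a : R := n1 (a 0 0) + n1 (a 0 1).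

Lemma n1_ge0 z : 0 <= n1 z. Proof. by rewrite addr_ge0. Qed.
Lemma n1_0 : n1 0 = 0. Proof. by rewrite /n1 /= normr0 addr0. Qed.
Lemma n1N z : n1 (- z) = n1 z.
Proof. by case: z => u v; rewrite /n1 /= !normrN. Qed.
Lemma n1D z w : n1 (z + w) <= n1 z + n1 w.
Proof.
case: z w => [u v] [u' v']; rewrite /n1 /=.
have := ler_normD u u'; have := ler_normD v v'; lra.
Qed.

Lemma n1M z w : n1 (z * w) <= n1 z * n1 w.
Proof.
case: z w => [u v] [u' v']; rewrite /n1 /=.
apply: (@le_trans _ _ ((`|u| * `|u'| + `|v| * `|v'|) + (`|u| * `|v'| + `|v| * `|u'|))).
  rewrite -!normrM lerD//; last exact: ler_normD.
  by rewrite (le_trans (ler_normD _ _))// normrN.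
by rewrite mulrDl !mulrDr; lra.
Qed.

Lemma n1Z x z : n1 (x%:C * z) = `|x| * n1 z.
Proof. by case: z => u v; rewrite /n1 /= !mul0r subr0 addr0 !normrM mulrDr. Qed.

Lemma n1_conj z : n1 z^* = n1 z.
Proof. by case: z => u v; rewrite /n1 /= normrN. Qed.

Lemma Re_le_n1 z : `|complex.Re z| <= n1 z. Proof. by rewrite lerDl. Qed.
Lemma Im_le_n1 z : `|complex.Im z| <= n1 z. Proof. by rewrite lerDr. Qed.

Lemma ReD z w : complex.Re (z + w) = complex.Re z + complex.Re w.
Proof. by case: z w => [? ?] [? ?]. Qed.
Lemma ImD z w : complex.Im (z + w) = complex.Im z + complex.Im w.
Proof. by case: z w => [? ?] [? ?]. Qed.
Lemma ReN z : complex.Re (- z) = - complex.Re z. Proof. by case: z. Qed.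
Lemma ImN z : complex.Im (- z) = - complex.Im z. Proof. by case: z. Qed.
Lemma ReZ x z : complex.Re (x%:C * z) = x * complex.Re z.
Proof. by case: z => ? ? /=; rewrite mul0r subr0. Qed.
Lemma ImZ x z : complex.Im (x%:C * z) = x * complex.Im z.
Proof. by case: z => ? ? /=; rewrite mul0r addr0. Qed.

Lemma complex_eq z w : complex.Re z = complex.Re w ->
  complex.Im z = complex.Im w -> z = w.
Proof. by case: z w => [? ?] [? ?] /= -> ->. Qed.

Lemma half_complex : (2^-1 : R[i]) = (2^-1 : R)%:C.
Proof. by rewrite -[2 in LHS](rmorph_nat (@real_complex R)) -fmorphV. Qed.

Lemma intr_complex (i : int) : (i%:~R : R[i]) = (i%:~R : R)%:C.
Proof. by rewrite rmorph_int. Qed.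

Lemma nn_ge0 a : 0 <= nn a. Proof. by rewrite addr_ge0 ?n1_ge0. Qed.
Lemma nn0 : nn 0 = 0. Proof. by rewrite /nn !mxE n1_0 addr0. Qed.
Lemma nnD a b : nn (a + b) <= nn a + nn b.
Proof.
rewrite /nn !mxE; have := n1D (a 0 0) (b 0 0); have := n1D (a 0 1) (b 0 1); lra.
Qed.
Lemma nnZ x a : nn (x%:C *: a) = `|x| * nn a.
Proof. by rewrite /nn !mxE !n1Z -mulrDr. Qed.

Lemma nn_half_sum a b :
  nn ((2^-1 : R[i]) *: a + (2^-1 : R[i]) *: b) <= (nn a + nn b) / 2.
Proof.
rewrite half_complex (le_trans (nnD _ _))// !nnZ ger0_norm ?invr_ge0//; lra.
Qed.

Lemma n1_le_nn a j : n1 (a 0 j) <= nn a.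
Proof.
have -> : nn a = \sum_(l < 2) n1 (a 0 l) by rewrite sum2E.
by rewrite (bigD1 j)//= lerDl sumr_ge0// => l _; exact: n1_ge0.
Qed.

Lemma sqabs_row_ge0 a : 0 <= sqabs_row a.
Proof. by apply: sumr_ge0 => j _; rewrite addr_ge0 ?sqr_ge0. Qed.

Lemma sqabs_row0 : sqabs_row (0 : 'rV[R[i]]_2) = 0.
Proof. by rewrite /sqabs_row big1// => j _; rewrite mxE /= expr0n/= addr0. Qed.

Lemma sqabs_rowN a : sqabs_row (- a) = sqabs_row a.
Proof. by apply: eq_bigr => j _; rewrite mxE ReN ImN !sqrrN. Qed.

Lemma nn_sqr a : nn a ^+ 2 <= 4 * sqabs_row a.
Proof.
rewrite /sqabs_row sum2E /nn /n1.
move: (complex.Re (a 0 0)) (complex.Im (a 0 0)) (complex.Re (a 0 1)) (complex.Im (a 0 1)).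
move=> u v u' v'; rewrite -(real_normK (num_real u)) -(real_normK (num_real v)).
rewrite -(real_normK (num_real u')) -(real_normK (num_real v')).
move: `|u| `|v| `|u'| `|v'| => {u v u' v'} u v u' v'.
have := sqr_ge0 (u - v); have := sqr_ge0 (u - u'); have := sqr_ge0 (u - v').
have := sqr_ge0 (v - u'); have := sqr_ge0 (v - v'); have := sqr_ge0 (u' - v').
lra.
Qed.

Lemma sqabs_rowD a b : sqabs_row (a + b) <= 2 * (sqabs_row a + sqabs_row b).
Proof.
rewrite /sqabs_row -big_split mulr_sumr; apply: ler_sum => j _.
rewrite mxE ReD ImD /=.
move: (complex.Re _) (complex.Im _) (complex.Re _) (complex.Im _) => u v u' v'.
have := sqr_ge0 (u - u'); have := sqr_ge0 (v - v'); lra.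
Qed.

Definition re_dot a b : R := complex.Re (\sum_(j < 2) a 0 j * (b 0 j)^*).

Lemma re_dotE a b : re_dot a b = \sum_(j < 2)
  (complex.Re (a 0 j) * complex.Re (b 0 j) + complex.Im (a 0 j) * complex.Im (b 0 j)).
Proof.
rewrite /re_dot !sum2E; case: (a 0 0) (a 0 1) (b 0 0) (b 0 1).
move=> ? ? [? ?] [? ?] [? ?] /=; ring.
Qed.

Lemma re_dot_le a b : `|re_dot a b| <= nn a * nn b.
Proof.
apply: (le_trans (Re_le_n1 _)); rewrite sum2E (le_trans (n1D _ _))//.
have n1Mc z w : n1 (z * w^*) <= n1 z * n1 w by rewrite (le_trans (n1M _ _))// n1_conj.
apply: (le_trans (lerD (n1Mc _ _) (n1Mc _ _))).
rewrite /nn; have := mulr_ge0 (n1_ge0 (a 0 0)) (n1_ge0 (b 0 1)).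
have := mulr_ge0 (n1_ge0 (a 0 1)) (n1_ge0 (b 0 0)); lra.
Qed.

Lemma re_dotDl a a' b : re_dot (a + a') b = re_dot a b + re_dot a' b.
Proof. rewrite !re_dotE !sum2E !mxE !ReD !ImD; ring. Qed.
Lemma re_dotDr a b b' : re_dot a (b + b') = re_dot a b + re_dot a b'.
Proof. rewrite !re_dotE !sum2E !mxE !ReD !ImD; ring. Qed.
Lemma re_dotNl a b : re_dot (- a) b = - re_dot a b.
Proof. rewrite !re_dotE !sum2E !mxE !ReN !ImN; ring. Qed.
Lemma re_dotNr a b : re_dot a (- b) = - re_dot a b.
Proof. rewrite !re_dotE !sum2E !mxE !ReN !ImN; ring. Qed.
Lemma re_dotZl x a b : re_dot (x%:C *: a) b = x * re_dot a b.
Proof. rewrite !re_dotE !sum2E !mxE !ReZ !ImZ; ring. Qed.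
Lemma re_dot0r a : re_dot a 0 = 0.
Proof. by rewrite re_dotE !sum2E !mxE /=; ring. Qed.
Lemma re_dot_self a : re_dot a a = sqabs_row a.
Proof. by rewrite re_dotE /sqabs_row !sum2E; ring. Qed.

End ComplexRows.

(** Polarization of the cubic identity T c c c = 0, on m + z and m - z. *)
Lemma cubic_polarization (R : realFieldType) (U : zmodType) (P : U -> Prop)
    (T : U -> U -> U -> R) :
  (forall c d e, T c d e = T d c e) ->
  (forall c c' d e, P c -> P c' -> P d -> P e -> T (c + c') d e = T c d e + T c' d e) ->
  (forall c d e, P c -> P d -> P e -> T (- c) d e = - T c d e) ->
  (forall c d e e', P c -> P d -> P e -> P e' -> T c d (e + e') = T c d e + T c d e') ->
  (forall c d e, P c -> P d -> P e -> T c d (- e) = - T c d e) ->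
  (forall c d, P c -> P d -> P (c + d)) -> (forall c, P c -> P (- c)) ->
  forall m z, P m -> P z ->
  (forall c, c = m + z \/ c = m - z \/ c = z -> T c c c = 0) ->
  T m m z = - 2 * T z m m.
Proof.
move=> TC TDl TNl TDr TNr PD PN m z Pm Pz T0; have PNz := PN _ Pz.
have Ep := T0 _ (or_introl erefl); have Em := T0 _ (or_intror (or_introl erefl)).
have Tz := T0 _ (or_intror (or_intror erefl)).
have VD := PD _ _ Pm Pz; have VB := PD _ _ Pm PNz.
have tDm c e : P c -> P e -> T c (m + z) e = T c m e + T c z e.
  by move=> *; rewrite (TC c) TDl// (TC m c) (TC z c).
have tBm c e : P c -> P e -> T c (m - z) e = T c m e - T c z e.
  by move=> *; rewrite (TC c) TDl// TNl// (TC m c) (TC z c).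
move: Ep; rewrite TDl// !tDm// !TDr// => Ep.
move: Em; rewrite TDl// TNl// !tBm// !TDr// !TNr//; move: Ep Tz.
rewrite (TC m z m) (TC m z z); lra.
Qed.

Section Bilinear.
Context {R : realType}.
Context (L : R) (L0 : 0 < L).
Implicit Types (c d e : coefs R) (f g : mode -> R[i]).

Definition csummable f := abs_summable (fun k => n1 (f k)).

Lemma csummable_Re f : csummable f -> abs_summable (fun k => complex.Re (f k)).
Proof.
move=> [B H]; exists B; apply: sums_le_le H => k.
by rewrite (ger0_norm (n1_ge0 _)) Re_le_n1.
Qed.

Lemma csummable_Im f : csummable f -> abs_summable (fun k => complex.Im (f k)).
Proof.
move=> [B H]; exists B; apply: sums_le_le H => k.
by rewrite (ger0_norm (n1_ge0 _)) Im_le_n1.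
Qed.

Lemma csumD f g : csummable f -> csummable g ->
  csum (fun k => f k + g k) = csum f + csum g.
Proof.
move=> sf sg; rewrite /csum; apply: complex_eq => /=.
  rewrite -rsumD; [|exact: csummable_Re..].
  by apply: eq_rsum => k; rewrite ReD.
rewrite -rsumD; [|exact: csummable_Im..].
by apply: eq_rsum => k; rewrite ImD.
Qed.

Lemma csumN f : csummable f -> csum (fun k => - f k) = - csum f.
Proof.
move=> sf; rewrite /csum; apply: complex_eq => /=.
  rewrite -rsumN; last exact: csummable_Re.
  by apply: eq_rsum => k; rewrite ReN.
rewrite -rsumN; last exact: csummable_Im.
by apply: eq_rsum => k; rewrite ImN.
Qed.

Lemma n1_csum f (h : mode -> R) : abs_summable h -> (forall k, n1 (f k) <= h k) ->
  n1 (csum f) <= 2 * rsum h.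
Proof.
move=> sh fh.
have h0 k : 0 <= h k by exact: le_trans (n1_ge0 _) (fh k).
have hH := sums_le_rsum h0 sh.
rewrite /n1 /csum /= mulr_natl mulr2n lerD//; apply: rsum_norm_le; apply: sums_le_le hH => k.
  exact: le_trans (Re_le_n1 _) (fh k).
exact: le_trans (Im_le_n1 _) (fh k).
Qed.

(** Coefficients with zero mean and square summable with weight |k|^2: the
    Fourier side of V, where every sum of the trilinear form converges
    absolutely. *)
Definition coef_V c := c 0 = 0 /\ abs_summable (fun k => sqabs k * sqabs_row (c k)).

Definition Vsq c : R := rsum (fun k => sqabs k * sqabs_row (c k)).

Lemma coef_V_D c d : coef_V c -> coef_V d -> coef_V (c + d).
Proof.
move=> [c0 [A cA]] [d0 [B dB]]; split; first by rewrite /= fctE c0 d0 addr0.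
exists (2 * (A + B)); apply: sums_le_le (sums_leZ _ (sums_leD cA dB)) => // k.
rewrite !ger0_norm ?mulr_ge0 ?sqabs_ge0 ?sqabs_row_ge0//.
by have := ler_wpM2l (@sqabs_ge0 R k) (sqabs_rowD (c k) (d k)); rewrite !mulrDr mulrCA; lra.
Qed.

Lemma coef_V_N c : coef_V c -> coef_V (- c).
Proof.
move=> [c0 [A cA]]; split; first by rewrite /= fctE c0 oppr0.
by exists A; apply: sums_le_le cA => k; rewrite fctE sqabs_rowN.
Qed.

Definition grad_nn d (k : mode) : R := Num.sqrt (sqabs k) * nn (d k).

Lemma grad_nn_ge0 d k : 0 <= grad_nn d k.
Proof. by rewrite mulr_ge0 ?sqrtr_ge0 ?nn_ge0. Qed.

Lemma Vsq_term_ge0 c k : 0 <= sqabs k * sqabs_row (c k).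
Proof. by rewrite mulr_ge0 ?sqabs_ge0 ?sqabs_row_ge0. Qed.

Lemma Vsq_ge0 c : coef_V c -> 0 <= Vsq c.
Proof.
by move=> [_ sc]; have := sums_le_rsum (Vsq_term_ge0 c) sc; exact: sums_le_ge0.
Qed.

Lemma grad_nn_sums c : coef_V c -> sums_le (fun k => grad_nn c k ^+ 2) (4 * Vsq c).
Proof.
move=> [_ sc]; apply: sums_le_le (sums_leZ _ (sums_le_rsum (Vsq_term_ge0 c) sc)) => // k.
rewrite /grad_nn exprMn sqr_sqrtr ?sqabs_ge0// [leRHS]mulrCA ler_wpM2l ?sqabs_ge0//.
exact: nn_sqr.
Qed.

Lemma grad_nn_sums' c : coef_V c -> sums_le (fun k => sqabs k * nn (c k) ^+ 2) (4 * Vsq c).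
Proof.
move=> /grad_nn_sums; apply: sums_le_le => k.
by rewrite /grad_nn exprMn sqr_sqrtr ?sqabs_ge0.
Qed.

Lemma nn_sums c : coef_V c -> sums_le (fun k => nn (c k) ^+ 2) (4 * Vsq c).
Proof.
move=> Vc; apply: sums_le_le (grad_nn_sums' Vc) => k.
have [->|k0] := eqVneq k 0; first by rewrite Vc.1 nn0 expr0n/= mulr0.
by rewrite ler_peMl ?sqr_ge0// sqabs_ge1.
Qed.

Definition conv c d (k : mode) : R := rsum (fun p => nn (c p) * grad_nn d (k - p)).

Lemma conv_summable c d k : coef_V c -> coef_V d ->
  abs_summable (fun p => nn (c p) * grad_nn d (k - p)).
Proof. by move=> Vc Vd; exact: conv_abs_summable (nn_sums Vc) (grad_nn_sums Vd). Qed.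

(** By 2 x y <= x^2 + y^2; the weight |k|^2 is at least 1 on nonzero modes. *)
Lemma conv_le c k : coef_V c -> conv c c k <= 4 * Vsq c.
Proof.
move=> Vc; apply: rsum_le; first exact: conv_summable.
have -> : 4 * Vsq c = 2^-1 * (4 * Vsq c + 4 * Vsq c) by field.
apply: (@sums_le_le _ _ (fun p => 2^-1 * (nn (c p) ^+ 2 + grad_nn c (k - p) ^+ 2))).
  by move=> p; have := sqr_ge0 (nn (c p) - grad_nn c (k - p)); nra.
apply: sums_leZ; first by rewrite invr_ge0.
apply: sums_leD; first exact: nn_sums.
apply: (sums_le_reindex (h := fun p => k - p)) (grad_nn_sums Vc) => p p' /addrI.
exact: oppr_inj.
Qed.

Lemma n1_advection_term c d k p j l :
  n1 (c p 0 j * deriv_coefs L j d (k - p) 0 l) <=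
  2 * pi / L * (nn (c p) * grad_nn d (k - p)).
Proof.
have kap : 0 <= 2 * pi / L :> R by rewrite divr_ge0 ?mulr_ge0 ?pi_ge0// ltW.
apply: (le_trans (n1M _ _)); rewrite mulrCA.
apply: ler_pM; rewrite ?n1_ge0 ?n1_le_nn// /deriv_coefs mxE.
apply: (le_trans (n1M _ _)); rewrite /grad_nn mulrA.
apply: ler_pM; rewrite ?n1_ge0 ?n1_le_nn//.
rewrite /n1 /= normr0 add0r normrM (ger0_norm kap) ler_wpM2l//.
rewrite -sqrtr_sqr ler_sqrt ?sqabs_ge0//.
by rewrite /sqabs (bigD1 j)//= lerDl sumr_ge0// => i _; rewrite sqr_ge0.
Qed.

Lemma advection_csummable c d k j l : coef_V c -> coef_V d ->
  csummable (fun p => c p 0 j * deriv_coefs L j d (k - p) 0 l).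
Proof.
move=> Vc Vd; have [B H] := abs_summableZ (2 * pi / L) (conv_summable k Vc Vd).
exists B; apply: sums_le_le H => p; rewrite (ger0_norm (n1_ge0 _)).
by apply: (le_trans (n1_advection_term _ _ _ _ _ _)); rewrite ler_norm.
Qed.

Lemma nn_advection c d k : coef_V c -> coef_V d ->
  nn (advection L c d k) <= 16 * pi / L * conv c d k.
Proof.
move=> Vc Vd.
have H l : n1 (advection L c d k 0 l) <= 8 * pi / L * conv c d k.
  rewrite mxE sum2E (le_trans (n1D _ _))//.
  have E j := n1_csum (abs_summableZ (2 * pi / L) (conv_summable k Vc Vd))
     (fun p => n1_advection_term c d k p j l).
  apply: (le_trans (lerD (E 0) (E 1))).
  rewrite rsumZ; last exact: conv_summable.
  rewrite -/(conv c d k); move: (conv _ _ _) => x; rewrite le_eqVlt; apply/orP; left.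
  by apply/eqP; field; rewrite gt_eqF.
by rewrite /nn; have := H 0; have := H 1; lra.
Qed.

Lemma advectionDl c c' d k : coef_V c -> coef_V c' -> coef_V d ->
  advection L (c + c') d k = advection L c d k + advection L c' d k.
Proof.
move=> Vc Vc' Vd; apply/rowP => l; rewrite !mxE -big_split; apply: eq_bigr => j _ /=.
rewrite -csumD; [|exact: advection_csummable..].
by congr csum; apply/funext => p; rewrite fctE mxE mulrDl.
Qed.

Lemma advectionDr c d d' k : coef_V c -> coef_V d -> coef_V d' ->
  advection L c (d + d') k = advection L c d k + advection L c d' k.
Proof.
move=> Vc Vd Vd'; apply/rowP => l; rewrite !mxE -big_split; apply: eq_bigr => j _ /=.
rewrite -csumD; [|exact: advection_csummable..].
by congr csum; apply/funext => p; rewrite /deriv_coefs fctE !mxE !mulrDr.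
Qed.

Lemma advectionNl c d k : coef_V c -> coef_V d ->
  advection L (- c) d k = - advection L c d k.
Proof.
move=> Vc Vd; apply/rowP => l; rewrite !mxE -sumrN; apply: eq_bigr => j _ /=.
rewrite -csumN; last exact: advection_csummable.
by congr csum; apply/funext => p; rewrite fctE mxE mulNr.
Qed.

Lemma advectionNr c d k : coef_V c -> coef_V d ->
  advection L c (- d) k = - advection L c d k.
Proof.
move=> Vc Vd; apply/rowP => l; rewrite !mxE -sumrN; apply: eq_bigr => j _ /=.
rewrite -csumN; last exact: advection_csummable.
by congr csum; apply/funext => p; rewrite /deriv_coefs fctE !mxE !mulrN.
Qed.

Lemma lerayE c k j : leray c k 0 j = if k == 0 then 0 else
  c k 0 j - ((sqabs k)^-1 * (k 0 j)%:~R)%:C *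
    \sum_(l < 2) ((k 0 l)%:~R)%:C * c k 0 l.
Proof.
rewrite /leray; case: eqP => _; rewrite !mxE//.
under eq_bigr => l _ do rewrite intr_complex.
by rewrite rmorphM/= intr_complex [in LHS](mulrC (\sum_(l < 2) _)) mulrA.
Qed.

Lemma project_add (T : comPzRingType) (w k k' a a' b b' z z' : T) :
  z + z' - w * (k * (a + b) + k' * (a' + b')) =
  z - w * (k * a + k' * a') + (z' - w * (k * b + k' * b')).
Proof. ring. Qed.

Lemma project_opp (T : comPzRingType) (w k k' a a' z : T) :
  - z - w * (k * - a + k' * - a') = - (z - w * (k * a + k' * a')).
Proof. ring. Qed.

Lemma scale_add_add (T : pzRingType) (V : lmodType T) (h : T) (a b a' b' : V) :
  h *: (a + b) + h *: (a' + b') = (h *: a + h *: a') + (h *: b + h *: b').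
Proof. by rewrite !scalerDr addrACA. Qed.

Lemma scale_opp_opp (T : pzRingType) (V : lmodType T) (h : T) (a b : V) :
  h *: (- a) + h *: (- b) = - (h *: a + h *: b).
Proof. by rewrite !scalerN opprD. Qed.

Lemma leray_additive c d c' k : c k = d k + c' k -> leray c k = leray d k + leray c' k.
Proof.
move=> E; apply/rowP => j; rewrite mxE; apply: (etrans (lerayE c k j)).
apply/esym/(etrans (congr2 +%R (lerayE d k j) (lerayE c' k j)))/esym.
case: eqP => _; first by rewrite addr0.
by rewrite E !sum2E !mxE; exact: project_add.
Qed.

Lemma leray_opp c d k : c k = - d k -> leray c k = - leray d k.
Proof.
move=> E; apply/rowP => j; rewrite mxE; apply: (etrans (lerayE c k j)).
apply/esym/(etrans (congr1 -%R (lerayE d k j)))/esym.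
case: eqP => _; first by rewrite oppr0.
by rewrite E !sum2E !mxE; exact: project_opp.
Qed.

Lemma nn_leray c k : nn (leray c k) <= 3 * nn (c k).
Proof.
have [k0|k0] := eqVneq k 0.
  by rewrite /leray k0 eqxx nn0 mulr_ge0 ?nn_ge0.
have sk : 0 < sqabs k :> R by rewrite (lt_le_trans _ (sqabs_ge1 k0)).
have kk j l : `|(sqabs k)^-1 * (k 0 j)%:~R| * `|(k 0 l)%:~R| <= 1 :> R.
  rewrite normrM -mulrA -normrM (ger0_norm (ltW _)) ?invr_gt0// ler_pdivrMl// mulr1.
  rewrite normrM.
  have hj i : `|(k 0 i)%:~R| ^+ 2 <= sqabs k :> R.
    rewrite real_normK ?num_real// /sqabs (bigD1 i)//= lerDl sumr_ge0// => m _.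
    by rewrite sqr_ge0.
  have := hj j; have := hj l.
  by have := sqr_ge0 (`|(k 0 j)%:~R : R| - `|(k 0 l)%:~R|); nra.
have H j : n1 (leray c k 0 j) <= n1 (c k 0 j) + nn (c k).
  rewrite lerayE (negbTE k0) (le_trans (n1D _ _))// n1N lerD2l sum2E mulrDr.
  apply: (le_trans (n1D _ _)); rewrite !n1Z !mulrA /nn.
  by apply: lerD; rewrite ler_piMl ?n1_ge0.
by have := H 0; have := H 1; rewrite /nn; lra.
Qed.

Definition bilin_const : R := 24 * pi / L.

Lemma bilin_arith (p q q' p' b x y : R) : p <= 3 * q -> p' <= 3 * q' ->
  q <= 2 / 3 * b * x -> q' <= 2 / 3 * b * y -> (p + p') / 2 <= b * (x + y).
Proof. by rewrite mulrDr; lra. Qed.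

Lemma bilin_const_ge0 : 0 <= bilin_const.
Proof. by rewrite divr_ge0 ?mulr_ge0 ?pi_ge0// ltW. Qed.

Lemma nn_Bilin c d k : coef_V c -> coef_V d ->
  nn (Bilin L c d k) <= bilin_const * (conv c d k + conv d c k).
Proof.
move=> Vc Vd; apply: (le_trans (nn_half_sum _ _)).
apply: (@bilin_arith _ (nn (advection L c d k)) (nn (advection L d c k)) _ _ _ _
  (nn_leray _ _) (nn_leray _ _)).
  by rewrite (le_trans (nn_advection k Vc Vd))// /bilin_const; lra.
by rewrite (le_trans (nn_advection k Vd Vc))// /bilin_const; lra.
Qed.

Lemma BilinC c d : Bilin L c d = Bilin L d c.
Proof. by apply/funext => k; exact: addrC. Qed.

Lemma BilinDl c c' d : coef_V c -> coef_V c' -> coef_V d ->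
  Bilin L (c + c') d = Bilin L c d + Bilin L c' d.
Proof.
move=> Vc Vc' Vd; apply/funext => k; rewrite fctE /Bilin.
rewrite (leray_additive (advectionDl k Vc Vc' Vd)).
rewrite (leray_additive (advectionDr k Vd Vc Vc')).
exact: scale_add_add.
Qed.

Lemma BilinNl c d : coef_V c -> coef_V d -> Bilin L (- c) d = - Bilin L c d.
Proof.
move=> Vc Vd; apply/funext => k; rewrite fctE /Bilin.
rewrite (leray_opp (advectionNl k Vc Vd)) (leray_opp (advectionNr k Vd Vc)).
exact: scale_opp_opp.
Qed.

Lemma Bilin_dot_sums c d e : coef_V c -> coef_V d -> coef_V e ->
  abs_summable (fun k => re_dot (Bilin L c d k) (e k)).
Proof.
move=> Vc Vd Ve.
have T c1 c2 : coef_V c1 -> coef_V c2 -> sums_le (fun k => conv c1 c2 k * nn (e k))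
    (trilinear_const (4 * Vsq c1) (4 * Vsq e) (4 * Vsq c2)).
  move=> V1 V2; apply: conv_trilinear_summable; [| | | | |exact: grad_nn_sums'..|].
  - by move=> k; exact: nn_ge0.
  - by move=> k; exact: grad_nn_ge0.
  - by move=> k; exact: nn_ge0.
  - by rewrite V1.1 nn0.
  - by rewrite Ve.1 nn0.
  - exact: grad_nn_sums.
apply: abs_summable_le (sums_leZ bilin_const_ge0 (sums_leD (T _ _ Vc Vd) (T _ _ Vd Vc))) => k.
rewrite (le_trans (re_dot_le _ _))// -mulrDl mulrA ler_wpM2r ?nn_ge0//.
exact: nn_Bilin.
Qed.

Definition tri c d e := pairing L (Bilin L c d) e.

Lemma triE c d e : tri c d e = L ^+ 2 * rsum (fun k => re_dot (Bilin L c d k) (e k)).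
Proof. by []. Qed.

Lemma triC c d e : tri c d e = tri d c e.
Proof. by rewrite /tri BilinC. Qed.

Lemma triDl c c' d e : coef_V c -> coef_V c' -> coef_V d -> coef_V e ->
  tri (c + c') d e = tri c d e + tri c' d e.
Proof.
move=> Vc Vc' Vd Ve; rewrite !triE -mulrDr; congr (_ * _).
rewrite -rsumD; [|exact: Bilin_dot_sums..].
by apply: eq_rsum => k; rewrite BilinDl// fctE re_dotDl.
Qed.

Lemma triDr c d e e' : coef_V c -> coef_V d -> coef_V e -> coef_V e' ->
  tri c d (e + e') = tri c d e + tri c d e'.
Proof.
move=> Vc Vc' Vd Ve; rewrite !triE -mulrDr; congr (_ * _).
rewrite -rsumD; [|exact: Bilin_dot_sums..].
by apply: eq_rsum => k; rewrite fctE re_dotDr.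
Qed.

Lemma triNl c d e : coef_V c -> coef_V d -> coef_V e ->
  tri (- c) d e = - tri c d e.
Proof.
move=> Vc Vd Ve; rewrite !triE -mulrN; congr (_ * _).
rewrite -rsumN; last exact: Bilin_dot_sums.
by apply: eq_rsum => k; rewrite BilinNl// fctE re_dotNl.
Qed.

Lemma triNr c d e : coef_V c -> coef_V d -> coef_V e ->
  tri c d (- e) = - tri c d e.
Proof.
move=> Vc Vd Ve; rewrite !triE -mulrN; congr (_ * _).
rewrite -rsumN; last exact: Bilin_dot_sums.
by apply: eq_rsum => k; rewrite fctE re_dotNr.
Qed.

Lemma pairing_BilinB c d e : coef_V c -> coef_V d -> coef_V e ->
  pairing L (Bilin L c c - Bilin L d d) e = tri c c e - tri d d e.
Proof.
move=> Vc Vd Ve; rewrite !triE -mulrBr; congr (_ * _).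
rewrite -rsumN; last exact: Bilin_dot_sums.
rewrite -rsumD; [|exact: Bilin_dot_sums|exact/abs_summableN/Bilin_dot_sums]. apply: eq_rsum => k.
by rewrite -[LHS]/(re_dot _ _) fctE re_dotDl re_dotNl.
Qed.

Lemma tri_swap m z : coef_V m -> coef_V z ->
  (forall c, c = m + z \/ c = m - z \/ c = z -> tri c c c = 0) ->
  tri m m z = - 2 * tri z m m.
Proof.
exact: (cubic_polarization triC triDl triNl triDr triNr coef_V_D coef_V_N).
Qed.

End Bilinear.

(** * Square integrable functions *)

Section SquareIntegrable.
Context {d : measure_display} {T : measurableType d} {R : realType}.
Context (mu : {measure set T -> \bar R}) (D : set T) (mD : measurable D).
Implicit Types f g h : T -> R.

Definition sqint f := measurable_fun D f /\
  (\int[mu]_(x in D) ((f x) ^+ 2)%:E < +oo)%E.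

Definition ip f g : R := \int[mu]_(x in D) (f x * g x).

Lemma sqint_integrable f : sqint f -> mu.-integrable D (EFin \o (fun x => f x ^+ 2)).
Proof.
move=> [mf fi]; apply/integrableP; split.
  by apply/measurable_EFinP; exact: measurable_funX.
rewrite (le_lt_trans _ fi)// le_eqVlt; apply/orP; left; apply/eqP.
by apply: eq_integral => x _ /=; rewrite ger0_norm ?sqr_ge0.
Qed.

Lemma integrable_sqint f : measurable_fun D f ->
  mu.-integrable D (EFin \o (fun x => f x ^+ 2)) -> sqint f.
Proof.
move=> mf /integrableP[_ fi]; split=> //.
rewrite (le_lt_trans _ fi)// le_eqVlt; apply/orP; left; apply/eqP.
by apply: eq_integral => x _ /=; rewrite ger0_norm ?sqr_ge0.
Qed.

Lemma sqint_mul f g : sqint f -> sqint g ->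
  mu.-integrable D (EFin \o (fun x => f x * g x)).
Proof.
move=> sf sg.
apply: (le_integrable mD _ _ (integrableD mD (sqint_integrable sf) (sqint_integrable sg))).
  by apply/measurable_EFinP; apply: measurable_funM; [exact: sf.1|exact: sg.1].
move=> x _ /=; rewrite lee_fin [leRHS]ger0_norm ?addr_ge0 ?sqr_ge0//.
rewrite ler_norml; apply/andP; split.
  have := sqr_ge0 (f x + g x); have := sqr_ge0 (f x); have := sqr_ge0 (g x); nra.
have := sqr_ge0 (f x - g x); have := sqr_ge0 (f x); have := sqr_ge0 (g x); nra.
Qed.

Lemma sqintD f g : sqint f -> sqint g -> sqint (fun x => f x + g x).
Proof.
move=> sf sg; apply: integrable_sqint.
  by apply: measurable_funD; [exact: sf.1|exact: sg.1].
have H := integrableD mD (integrableD mD (sqint_integrable sf) (sqint_integrable sg))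
  (integrableZl mD 2 (sqint_mul sf sg)).
by apply: eq_integrable H => // x _ /=; congr EFin; ring.
Qed.

Lemma sqintZ k f : sqint f -> sqint (fun x => k * f x).
Proof.
move=> sf; apply: integrable_sqint; first by apply: measurable_funM => //; exact: sf.1.
have H := integrableZl mD (k ^+ 2) (sqint_integrable sf).
by apply: eq_integrable H => // x _ /=; rewrite exprMn.
Qed.

Lemma sqint_bounded f M : (mu D < +oo)%E -> measurable_fun D f ->
  (forall x, `|f x| <= M) -> sqint f.
Proof.
move=> muD mf fM; apply: integrable_sqint => //.
apply: measurable_bounded_integrable => //; first exact: measurable_funX.
exists (M ^+ 2); split; first exact: num_real.
move=> y My x _ /=; rewrite (le_trans _ (ltW My))//.
by rewrite normrX ler_pXn2r ?nnegrE// (le_trans _ (fM x)).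
Qed.

Lemma sqint0 : sqint (fun=> 0).
Proof.
split; first exact: measurable_cst.
by under eq_integral do rewrite expr0n/=; rewrite integral0 ltry.
Qed.

Lemma sqint_sum (I : Type) (r : seq I) (g : I -> T -> R) :
  (forall i, sqint (g i)) -> sqint (fun x => \sum_(i <- r) g i x).
Proof.
move=> sg; elim: r => [|i r IH].
  by apply: eq_rect sqint0 _ _; apply/funext => x; rewrite big_nil.
have := sqintD (sg i) IH.
by congr sqint; apply/funext => x; rewrite big_cons.
Qed.

Lemma ipC f g : ip f g = ip g f.
Proof. by apply: eq_Rintegral => x _; rewrite mulrC. Qed.

Lemma ipDl f g h : sqint f -> sqint g -> sqint h ->
  ip (fun x => f x + g x) h = ip f h + ip g h.
Proof.
move=> sf sg sh; rewrite /ip -RintegralD//; [|exact: sqint_mul..].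
by apply: eq_Rintegral => x _; rewrite mulrDl.
Qed.

Lemma ipZl k f h : sqint f -> sqint h -> ip (fun x => k * f x) h = k * ip f h.
Proof.
move=> sf sh; rewrite /ip -RintegralZl//; last exact: sqint_mul.
by apply: eq_Rintegral => x _; rewrite mulrA.
Qed.

Lemma ip_ge0 f : 0 <= ip f f.
Proof. by apply: Rintegral_ge0 => x _; rewrite -expr2 sqr_ge0. Qed.

Lemma ip_suml (I : Type) (r : seq I) (g : I -> T -> R) h :
  (forall i, sqint (g i)) -> sqint h ->
  ip (fun x => \sum_(i <- r) g i x) h = \sum_(i <- r) ip (g i) h.
Proof.
move=> sg sh; elim: r => [|i r IH].
  rewrite big_nil /ip (@eq_Rintegral _ _ _ _ _ (fun=> 0)).
    by rewrite Rintegral_cst// mul0r.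
  by move=> x _; rewrite big_nil mul0r.
rewrite big_cons -IH -ipDl//; last exact: sqint_sum sg.
by congr ip; apply/funext => x; rewrite big_cons.
Qed.

End SquareIntegrable.

(** * Fourier analysis on the torus *)

Section TorusTrig.
Context {R : realType} (L : R) (L0 : 0 < L).
Notation lmu := (@lebesgue_measure R).
Notation mu2 := (lmu \x lmu)%E.
Implicit Types (k m : mode).

Notation line := (g_sigma_algebraType (R.-ocitv.-measurable)).

(* The sigma-algebra is spelled out because the plane carries another, equal
   one, which would be inferred from the type. *)
Lemma measurable_torus : @measurable _ (line * line)%type (torus L).
Proof. exact: (@measurableX _ _ line line). Qed.
Hint Resolve measurable_torus : core.

Lemma measure_torus : mu2 (torus L) = (L ^+ 2)%:E.
Proof.
rewrite /torus product_measure1E//=.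
by rewrite !lebesgue_measure_itv/= lte_fin L0 -EFinB -EFinM subr0 expr2.
Qed.

Lemma measure_torus_lty : (mu2 (torus L) < +oo)%E.
Proof. by rewrite measure_torus ltry. Qed.

Lemma measurable_phase k : measurable_fun [set: line * line] (phase L k : line * line -> R).
Proof.
apply: measurable_funM => //; apply: measurable_funM => //.
by apply: measurable_funD; apply: measurable_funM.
Qed.

Lemma measurable_cos_shift k t :
  measurable_fun [set: line * line] (fun x : line * line => cos (phase L k x + t)).
Proof.
apply: (@measurableT_comp _ _ _ _ _ _ (@cos R)).
  by apply: continuous_measurable_fun; exact: continuous_cos.
by apply: measurable_funD => //; exact: measurable_phase.
Qed.

Lemma sin_2pi_int (n : int) (t : R) : sin (2 * pi * n%:~R + t) = sin t.
Proof.
have P (m : nat) (a : R) : sin (a + 2 * pi * m%:R) = sin a.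
  rewrite -(periodicn (@sinD2pi R) m a); congr sin.
  by rewrite -[pi *+ 2]mulr_natl -[(_ * _) *+ m]mulr_natr.
case: n => n; first by rewrite addrC P.
by rewrite NegzE -[LHS](P n.+1) mulrNz mulrN addrAC addNr add0r.
Qed.

Lemma integral_cos_itv (n : int) (t : R) : n != 0 ->
  (\int[lmu]_(x in `[0%R, L[) (cos (2 * pi * n%:~R * x / L + t))%:E = 0)%E.
Proof.
move=> n0; pose w : R := 2 * pi * n%:~R / L.
have w0 : w != 0.
  rewrite !mulf_neq0 ?invr_eq0 ?intr_eq0// gt_eqF//; exact: pi_gt0.
have wE x : 2 * pi * n%:~R * x / L = w * x by rewrite /w mulrAC.
have dF (x : R) : is_derive x (1 : R) (fun x : R => w^-1 * sin (w * x + t)) (cos (w * x + t)).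
  apply: is_derive_eq; rewrite /GRing.scale/=.
  by rewrite mulr1 addr0 mulrCA mulVf// mulr1.
have cF : continuous (fun x : R => w^-1 * sin (w * x + t)).
  by move=> x; apply/differentiable_continuous/derivable1_diffP; apply: ex_derive.
have cf : continuous (fun x : R => cos (w * x + t)).
  move=> x; apply: (@continuous_comp _ _ _ (fun x => w * x + t) (@cos R)); last exact: continuous_cos.
  by apply: cvgD; [apply: cvgMr|exact: cvg_cst].
rewrite integral_itv_bndo_bndc; last first.
  by apply/measurable_EFinP; apply: measurable_funTS; under eq_fun do rewrite wE;
    exact: continuous_measurable_fun.
under eq_integral do rewrite wE.
rewrite (@continuous_FTC2 _ _ (fun x => w^-1 * sin (w * x + t)))//.
- rewrite mulr0 add0r -EFinB; congr EFin.
  by rewrite -wE mulfK ?gt_eqF// sin_2pi_int subrr.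
- exact: continuous_subspaceT.
- split => [x _||]; first exact: ex_derive.
  + exact/cvg_at_right_filter/cF.
  + exact/cvg_at_left_filter/cF.
- by move=> x _; rewrite derive1E; exact: derive_val.
Qed.

(** Fubini's theorem, integrating first in a coordinate along which the wave
    oscillates. *)
Lemma integral_cos_torus k t : k != 0 ->
  \int[mu2]_(x in torus L) cos (phase L k x + t) = 0.
Proof.
move=> k0; rewrite /Rintegral integral_mkcond.
set f : R * R -> \bar R := _ \_ _.
have fE a b : f (a, b) =
  ((fun a => (fun b => (cos (phase L k (a, b) + t))%:E) \_ `[0%R, L[ b) \_ `[0%R, L[) a.
  rewrite /f !patchE.
  have -> : ((a, b) \in torus L) = (a \in `[0, L[%classic) && (b \in `[0, L[%classic).
    by apply/idP/andP; rewrite !inE.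
  by case: (a \in _) => //; case: (b \in _).
have intf : mu2.-integrable setT f.
  apply: (iffLR (integrable_mkcond _ _)); first exact: measurable_torus.
  apply: measurable_bounded_integrable => //.
  - exact: measure_torus_lty.
  - apply: measurable_funTS; exact: measurable_cos_shift.
  - exists 1; split; first exact: num_real.
    by move=> y y1 x _ /=; rewrite (le_trans (cos_max _))// ltW.
have [k00|k00] := eqVneq (k 0 0) 0; last first.
  rewrite -integral21_prod_meas1// /fubini_G.
  rewrite integral0_eq// => b _.
  under eq_integral => a _ do rewrite fE.
  rewrite -integral_mkcond.
  have [bI|bI] := boolP (b \in `[0, L[%classic); last first.
    by under eq_integral => a _ do rewrite patchE (negbTE bI); rewrite integral0.
  under eq_integral => a _ do rewrite patchE bI.
  rewrite -[RHS](@integral_cos_itv _ (2 * pi * (k 0 1)%:~R * b / L + t) k00).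
  apply: eq_integral => a _; congr (EFin (cos _)); rewrite /phase/=.
  by rewrite addrA; congr (_ + _); field; rewrite gt_eqF.
rewrite -integral12_prod_meas1// /fubini_F.
rewrite integral0_eq// => a _.
have k01 : k 0 1 != 0.
  apply: contraNneq k0 => k01; rewrite -(mode_ofK k) k00 k01; apply/eqP.
  by apply/rowP => j; rewrite !mxE; case: ifP.
under eq_integral => b _ do rewrite fE.
have [aI|aI] := boolP (a \in `[0, L[%classic); last first.
  by under eq_integral => b _ do rewrite patchE (negbTE aI); rewrite integral0.
under eq_integral => b _ do rewrite patchE aI.
rewrite -integral_mkcond.
rewrite -[RHS](@integral_cos_itv _ t k01).
apply: eq_integral => b _; congr (EFin (cos _)); rewrite /phase/= k00.
by rewrite mul0r add0r !mulrA.
Qed.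

Definition cosk k x := cos (phase L k x).
Definition sink k x := sin (phase L k x).
Implicit Types f g h : R * R -> R.

Definition tsq f : Prop := sqint mu2 (torus L) f.
Definition tip f g : R := ip mu2 (torus L) f g.

Lemma tsqD f g : tsq f -> tsq g -> tsq (fun x => f x + g x).
Proof. exact: (@sqintD _ _ _ _ _ measurable_torus). Qed.

Lemma tsqZ a f : tsq f -> tsq (fun x => a * f x).
Proof. exact: (@sqintZ _ _ _ _ _ measurable_torus). Qed.

Lemma tipC f g : tip f g = tip g f.
Proof. exact: ipC. Qed.

Lemma tipDl f g h : tsq f -> tsq g -> tsq h ->
  tip (fun x => f x + g x) h = tip f h + tip g h.
Proof. exact: (@ipDl _ _ _ _ _ measurable_torus). Qed.

Lemma tipZl a f h : tsq f -> tsq h -> tip (fun x => a * f x) h = a * tip f h.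
Proof. exact: (@ipZl _ _ _ _ _ measurable_torus). Qed.

Lemma tip_ge0 f : 0 <= tip f f.
Proof. exact: ip_ge0. Qed.

Lemma phaseD k m x : phase L (k + m) x = phase L k x + phase L m x.
Proof. rewrite /phase !mxE !rmorphD/=; field; exact: lt0r_neq0. Qed.

Lemma phaseN k x : phase L (- k) x = - phase L k x.
Proof. rewrite /phase !mxE !rmorphN/=; field; exact: lt0r_neq0. Qed.

Lemma phase0 x : phase L 0 x = 0.
Proof. rewrite /phase !mxE; field; exact: lt0r_neq0. Qed.

Lemma sinkE k : sink k = (fun x => cos (phase L k x + - (pi / 2))).
Proof. by apply/funext => x; rewrite cosBpihalf. Qed.

Lemma coskE k : cosk k = (fun x => cos (phase L k x + 0)).
Proof. by apply/funext => x; rewrite addr0. Qed.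

Lemma tsq_cos k t : tsq (fun x => cos (phase L k x + t)).
Proof.
apply: (sqint_bounded measurable_torus measure_torus_lty (M := 1)).
  by apply: measurable_funTS; exact: measurable_cos_shift.
by move=> x; exact: cos_max.
Qed.

Lemma tsq_cosk k : tsq (cosk k). Proof. rewrite coskE; exact: tsq_cos. Qed.
Lemma tsq_sink k : tsq (sink k). Proof. rewrite sinkE; exact: tsq_cos. Qed.

Lemma tsq_integrable f : tsq f -> mu2.-integrable (torus L) (EFin \o f).
Proof.
move=> sf; have := sqint_mul measurable_torus sf (tsq_cosk 0).
congr (_.-integrable); apply/funext => x.
by rewrite /cosk /= phase0 cos0 mulr1.
Qed.

Lemma tint_cosk k : \int[mu2]_(x in torus L) cosk k x = L ^+ 2 * (k == 0)%:R.
Proof.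
have [->|k0] := eqVneq k 0; last by rewrite coskE integral_cos_torus// mulr0.
rewrite (@eq_Rintegral _ _ _ _ _ (fun=> 1)); last first.
  by move=> x; rewrite /cosk phase0 cos0.
rewrite Rintegral_cst; last exact: measurable_torus.
by rewrite mul1r mulr1; exact: (congr1 fine measure_torus).
Qed.

Lemma tint_sink k : \int[mu2]_(x in torus L) sink k x = 0.
Proof.
have [->|k0] := eqVneq k 0; last by rewrite sinkE integral_cos_torus.
rewrite (@eq_Rintegral _ _ _ _ _ (fun=> 0)); last first.
  by move=> x _; rewrite /sink phase0 sin0.
by rewrite Rintegral_cst ?mul0r//; exact: measurable_torus.
Qed.

Lemma tint_comb a b f g : tsq f -> tsq g ->
  \int[mu2]_(x in torus L) (a * f x + b * g x) =
  a * (\int[mu2]_(x in torus L) f x) + b * (\int[mu2]_(x in torus L) g x).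
Proof.
have mt := measurable_torus; move=> sf sg.
rewrite RintegralD//; [|apply: tsq_integrable; exact: tsqZ..].
by rewrite !RintegralZl//; exact: tsq_integrable.
Qed.

Lemma ip_comb a b f g h h' : tsq h -> tsq h' ->
  (forall x, f x * g x = a * h x + b * h' x) -> tip f g =
  a * (\int[mu2]_(x in torus L) h x) + b * (\int[mu2]_(x in torus L) h' x).
Proof.
by move=> sh sh' E; rewrite -tint_comb//; apply: eq_Rintegral => x _; exact: E.
Qed.

Definition pm k m : R := (k == m)%:R + (k == - m)%:R.
Definition mm k m : R := (k == m)%:R - (k == - m)%:R.

Lemma ip_cosk k m : tip (cosk k) (cosk m) = L ^+ 2 / 2 * pm k m.
Proof.
have E x : cosk k x * cosk m x = 2^-1 * cosk (k - m) x + 2^-1 * cosk (k + m) x.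
  rewrite /cosk !phaseD phaseN cosD cosN sinN cosD mulrN opprK.
  by set a := cos _ * cos _; set b := sin _ * sin _; lra.
rewrite (ip_comb (tsq_cosk _) (tsq_cosk _) E) !tint_cosk /pm subr_eq0 addr_eq0.
by lra.
Qed.

Lemma ip_sink k m : tip (sink k) (sink m) = L ^+ 2 / 2 * mm k m.
Proof.
have E x : sink k x * sink m x = 2^-1 * cosk (k - m) x + (- 2^-1) * cosk (k + m) x.
  rewrite /cosk /sink !phaseD phaseN cosD cosN sinN cosD mulrN opprK.
  by set a := cos _ * cos _; set b := sin _ * sin _; lra.
rewrite (ip_comb (tsq_cosk _) (tsq_cosk _) E) !tint_cosk /mm subr_eq0 addr_eq0.
by lra.
Qed.

Lemma ip_sin_cos k m : tip (sink k) (cosk m) = 0.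
Proof.
have E x : sink k x * cosk m x = 2^-1 * sink (k - m) x + 2^-1 * sink (k + m) x.
  rewrite /cosk /sink !phaseD phaseN sinD cosN sinN sinD mulrN.
  by set a := sin _ * cos _; set b := cos _ * sin _; lra.
by rewrite (ip_comb (tsq_sink _) (tsq_sink _) E) !tint_sink; lra.
Qed.

Lemma coskN k : cosk (- k) = cosk k.
Proof. by apply/funext => x; rewrite /cosk phaseN cosN. Qed.

Lemma ip_sinkN f k : tsq f -> tip f (sink (- k)) = - tip f (sink k).
Proof.
move=> sf; rewrite tipC -mulN1r (tipC f) -tipZl//; last exact: tsq_sink.
by congr tip; apply/funext => x; rewrite /sink phaseN sinN mulN1r.
Qed.

Lemma mem_boxN N k : (- k \in box N) = (k \in box N).
Proof. by rewrite !mem_box !mxE !abszN. Qed.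

Lemma box_delta N k (F : mode -> R) :
  \sum_(m <- box N) F m * (m == k)%:R = if k \in box N then F k else 0.
Proof.
case: ifPn => kN; last first.
  rewrite big1_seq// => m /andP[_ mN].
  by have [mk|] := eqVneq m k; [move: kN; rewrite -mk mN|rewrite mulr0].
rewrite (bigD1_seq k)//= ?box_uniq// eqxx mulr1 big1 ?addr0//.
by move=> m /negbTE ->; rewrite mulr0.
Qed.

Definition trigsum N (a b : mode -> R) (x : R * R) : R :=
  \sum_(m <- box N) (a m * cosk m x + b m * sink m x).

Lemma tsq_term a b m : tsq (fun x => a * cosk m x + b * sink m x).
Proof.
apply: tsqD; apply: tsqZ; [exact: tsq_cosk|exact: tsq_sink].
Qed.

Lemma tsq_trigsum N a b : tsq (trigsum N a b).
Proof.
apply: (sqint_sum measurable_torus).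
by move=> m; exact: tsq_term.
Qed.

Lemma ip_trigsum N a b f : tsq f ->
  tip (trigsum N a b) f = \sum_(m <- box N) (a m * tip f (cosk m) + b m * tip f (sink m)).
Proof.
move=> sf.
rewrite [LHS](ip_suml measurable_torus _ _ sf); last by move=> m; exact: tsq_term.
apply: eq_bigr => m _.
rewrite -[LHS]/(tip (fun x => a m * cosk m x + b m * sink m x) f).
have sc := tsq_cosk m; have ss := tsq_sink m.
rewrite tipDl//; [|exact: tsqZ..].
by rewrite !tipZl// (tipC (cosk m)) (tipC (sink m)).
Qed.

Lemma ip_trigsum_cos N a b k : tip (trigsum N a b) (cosk k) =
  if k \in box N then L ^+ 2 / 2 * (a k + a (- k)) else 0.
Proof.
rewrite ip_trigsum; last exact: tsq_cosk.
transitivity (L ^+ 2 / 2 * (\sum_(m <- box N) a m * (m == k)%:R +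
                            \sum_(m <- box N) a m * (m == - k)%:R)).
  rewrite -big_split mulr_sumr; apply: eq_bigr => m _ /=.
  rewrite (tipC _ (sink m)) ip_sin_cos ip_cosk /pm (eq_sym k) -(eqr_oppLR m) (eq_sym (- m)); lra.
by rewrite !box_delta mem_boxN; case: ifP => // _; rewrite addr0 mulr0.
Qed.

Lemma ip_trigsum_sin N a b k : tip (trigsum N a b) (sink k) =
  if k \in box N then L ^+ 2 / 2 * (b k - b (- k)) else 0.
Proof.
rewrite ip_trigsum; last exact: tsq_sink.
transitivity (L ^+ 2 / 2 * (\sum_(m <- box N) b m * (m == k)%:R -
                            \sum_(m <- box N) b m * (m == - k)%:R)).
  rewrite -sumrB mulr_sumr; apply: eq_bigr => m _ /=.
  rewrite ip_sin_cos ip_sink /mm (eq_sym k) -(eqr_oppLR m) (eq_sym (- m)); lra.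
by rewrite !box_delta mem_boxN; case: ifP => // _; rewrite subr0 mulr0.
Qed.

(** The defect in Bessel's inequality.  A box contains k as well as - k, hence
    L^2 where a half-plane of modes would give L^2 / 2. *)
Definition bessel_defect N f : R := tip f f -
  (\sum_(k <- box N) (tip f (cosk k) ^+ 2 + tip f (sink k) ^+ 2)) / L ^+ 2.

Definition proj N f := trigsum N
  (fun k => tip f (cosk k) / L ^+ 2) (fun k => tip f (sink k) / L ^+ 2).

(** Pythagoras' theorem, from which the defect is nonnegative. *)
Lemma bessel_defect_proj N f : tsq f -> bessel_defect N f =
  tip (fun x => f x + -1 * proj N f x) (fun x => f x + -1 * proj N f x).
Proof.
move=> sf.
have L2 : L ^+ 2 != 0 by rewrite expf_neq0// gt_eqF.
set g := proj N f.
have sg : tsq g by exact: tsq_trigsum.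
pose S := (\sum_(k <- box N) (tip f (cosk k) ^+ 2 + tip f (sink k) ^+ 2)) / L ^+ 2.
have gf : tip g f = S.
  rewrite ip_trigsum// /S mulr_suml; apply: eq_bigr => k _.
  by rewrite mulrDl !expr2 mulrAC [in X in _ + X]mulrAC.
have gg : tip g g = S.
  rewrite ip_trigsum// /S mulr_suml big_seq [RHS]big_seq; apply: eq_bigr => k kN.
  rewrite ip_trigsum_cos ip_trigsum_sin kN coskN ip_sinkN//; field.
  by rewrite gt_eqF.
have sg' : tsq (fun x => -1 * g x) by exact: tsqZ.
have sd := tsqD sf sg'.
rewrite tipDl// tipZl// !(tipC _ (fun x => f x + -1 * g x)) !tipDl// !tipZl//.
rewrite gg (tipC f g) gf /bessel_defect -/S; lra.
Qed.

Lemma bessel_defect_ge0 N f : tsq f -> 0 <= bessel_defect N f.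
Proof. by move=> sf; rewrite bessel_defect_proj// tip_ge0. Qed.

Lemma tip_sqr_le f k : tsq f ->
  tip f (cosk k) ^+ 2 <= L ^+ 2 * tip f f /\ tip f (sink k) ^+ 2 <= L ^+ 2 * tip f f.
Proof.
move=> sf; have [N kN] := seq_sub_box [:: k].
have /= := bessel_defect_ge0 N sf; rewrite subr_ge0 ler_pdivrMr ?exprn_gt0// mulrC.
rewrite (bigD1_seq k) ?box_uniq ?kN ?inE//=.
set S := \sum_(_ <- _ | _) _ => H.
have S0 : 0 <= S by apply: sumr_ge0 => m _; rewrite addr_ge0 ?sqr_ge0.
have := sqr_ge0 (tip f (cosk k)); have := sqr_ge0 (tip f (sink k)).
by split; lra.
Qed.

(** The parallelogram identity for a nonnegative quadratic form. *)
Lemma bessel_defect_add N f g : tsq f -> tsq g ->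
  bessel_defect N (fun x => f x + g x) <= 2 * bessel_defect N f + 2 * bessel_defect N g.
Proof.
move=> sf sg.
have sg' : tsq (fun x => -1 * g x) by exact: tsqZ.
have sd := tsqD sf sg; have sd' := tsqD sf sg'.
suff E : bessel_defect N (fun x => f x + g x) + bessel_defect N (fun x => f x + -1 * g x) =
    2 * bessel_defect N f + 2 * bessel_defect N g.
  by rewrite -E lerDl bessel_defect_ge0.
rewrite /bessel_defect.
have E1 : tip (fun x => f x + g x) (fun x => f x + g x) = tip f f + 2 * tip f g + tip g g.
  rewrite tipDl// !(tipC _ (fun x => f x + g x)) !tipDl// (tipC g f); lra.
have E2 : tip (fun x => f x + -1 * g x) (fun x => f x + -1 * g x) = tip f f - 2 * tip f g + tip g g.
  rewrite tipDl// tipZl// !(tipC _ (fun x => f x + -1 * g x)) !tipDl// !tipZl// (tipC g f); lra.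
pose S h := \sum_(k <- box N) (tip h (cosk k) ^+ 2 + tip h (sink k) ^+ 2).
have E3 : S (fun x => f x + g x) + S (fun x => f x + -1 * g x) = 2 * S f + 2 * S g.
  rewrite !mulr_sumr -!big_split; apply: eq_bigr => k _ /=.
  have sc := tsq_cosk k; have ss := tsq_sink k.
  rewrite !tipDl// !tipZl//; ring.
rewrite E1 E2 -/(S _) -/(S _) -/(S f) -/(S g).
have -> : S (fun x => f x + g x) = 2 * S f + 2 * S g - S (fun x => f x + -1 * g x).
  by rewrite -E3 addrK.
move: (S _) (S f) (S g) => x1 x2 x3; ring.
Qed.

Lemma bessel_defectZ N c f : tsq f -> bessel_defect N (fun x => c * f x) = c ^+ 2 * bessel_defect N f.
Proof.
move=> sf; have sf' := tsqZ c sf.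
rewrite /bessel_defect tipZl// (tipC f) tipZl// mulrBr; congr (_ - _); first by rewrite mulrA expr2.
rewrite mulrA mulr_sumr; congr (_ / _); apply: eq_bigr => k _.
have sc := tsq_cosk k; have ss := tsq_sink k.
by rewrite !tipZl// mulrDr !exprMn.
Qed.

Lemma neq_opp_mode k : k != 0 -> (k == - k) = false.
Proof.
move=> k0; apply/negbTE; apply: contraNneq k0 => kk; apply/eqP/rowP => j.
have := congr1 (fun k : mode => k 0 j) kk; rewrite !mxE.
by move: (k 0 j) => i; lia.
Qed.

Lemma box_sum_sqr_delta N k (s : R) : k != 0 -> k \in box N -> s ^+ 2 = 1 ->
  \sum_(m <- box N) ((k == m)%:R + s * (k == - m)%:R) ^+ 2 = 2.
Proof.
move=> k0 kN s2.
transitivity (\sum_(m <- box N) 1 * (m == k)%:R + \sum_(m <- box N) 1 * (m == - k)%:R : R).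
  rewrite -big_split; apply: eq_bigr => m _ /=.
  have [km|km] := eqVneq m k.
    by rewrite km neq_opp_mode//= mulr0 addr0 expr1n mulr1 mulr0 addr0.
  have [km'|km'] := eqVneq m (- k).
    by rewrite km' opprK eqxx/= add0r mulr1 s2 mulr0 add0r mulr1.
  by rewrite -eqr_oppLR (eq_sym (- k)) (negbTE km')/= mulr0 addr0 expr0n/= mulr0 addr0.
by rewrite !box_delta mem_boxN kN.
Qed.

Lemma bessel_defect_cosk N k : k != 0 -> k \in box N -> bessel_defect N (cosk k) = 0.
Proof.
move=> k0 kN; rewrite /bessel_defect ip_cosk /pm eqxx neq_opp_mode//.
have -> : \sum_(m <- box N) (tip (cosk k) (cosk m) ^+ 2 + tip (cosk k) (sink m) ^+ 2) =
    (L ^+ 2 / 2) ^+ 2 * \sum_(m <- box N) ((k == m)%:R + 1 * (k == - m)%:R) ^+ 2.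
  rewrite mulr_sumr; apply: eq_bigr => m _.
  by rewrite ip_cosk (tipC (cosk k)) ip_sin_cos expr0n addr0 exprMn mul1r.
rewrite box_sum_sqr_delta ?expr1n//=; field.
by rewrite gt_eqF.
Qed.

Lemma bessel_defect_sink N k : k != 0 -> k \in box N -> bessel_defect N (sink k) = 0.
Proof.
move=> k0 kN; rewrite /bessel_defect ip_sink /mm eqxx neq_opp_mode//.
have -> : \sum_(m <- box N) (tip (sink k) (cosk m) ^+ 2 + tip (sink k) (sink m) ^+ 2) =
    (L ^+ 2 / 2) ^+ 2 * \sum_(m <- box N) ((k == m)%:R + -1 * (k == - m)%:R) ^+ 2.
  rewrite mulr_sumr; apply: eq_bigr => m _.
  by rewrite ip_sink ip_sin_cos expr0n add0r exprMn mulN1r.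
rewrite box_sum_sqr_delta ?sqrrN ?expr1n//=; field.
by rewrite gt_eqF.
Qed.

(** ** Fields in H and V through their coefficients *)

Implicit Types u v p : field R.
Notation cmp u j := (fun x => u x 0 j).

Lemma in_L2_tsq u : in_L2 L u <-> forall j, tsq (cmp u j).
Proof. by split=> H j; exact: H j. Qed.

Lemma fourier_Re u k j : complex.Re (fourier L u k 0 j) = tip (cmp u j) (cosk k) / L ^+ 2.
Proof. by rewrite mxE. Qed.

Lemma fourier_Im u k j : complex.Im (fourier L u k 0 j) = - (tip (cmp u j) (sink k) / L ^+ 2).
Proof. by rewrite mxE. Qed.

Lemma innerE u v : in_L2 L u -> in_L2 L v ->
  inner L u v = \sum_(j < 2) tip (cmp u j) (cmp v j).
Proof.
move=> /in_L2_tsq su /in_L2_tsq sv; rewrite sum2E.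
have H j := sqint_mul measurable_torus (su j) (sv j).
apply: etrans (RintegralD measurable_torus (H 0) (H 1)).
by apply: eq_Rintegral => x _; rewrite sum2E.
Qed.

Lemma normH_sqr u : in_L2 L u -> normH L u ^+ 2 = \sum_(j < 2) tip (cmp u j) (cmp u j).
Proof.
move=> su; rewrite sqr_sqrtr innerE//.
by apply: sumr_ge0 => j _; exact: tip_ge0.
Qed.

Lemma normH_ge0 u : 0 <= normH L u. Proof. exact: sqrtr_ge0. Qed.

Lemma in_L2D u v : in_L2 L u -> in_L2 L v -> in_L2 L (u + v).
Proof.
move=> /in_L2_tsq su /in_L2_tsq sv; apply/in_L2_tsq => j.
have := tsqD (su j) (sv j); congr tsq.
by apply/funext => x; rewrite fctE mxE.
Qed.

Lemma in_L2N u : in_L2 L u -> in_L2 L (- u).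
Proof.
move=> /in_L2_tsq su; apply/in_L2_tsq => j.
have := tsqZ (-1) (su j); congr tsq.
by apply/funext => x; rewrite fctE mxE mulN1r.
Qed.

Lemma fourierD u v : in_L2 L u -> in_L2 L v ->
  fourier L (u + v) = fourier L u + fourier L v.
Proof.
move=> /in_L2_tsq su /in_L2_tsq sv; apply/funext => k; apply/rowP => j.
have E : cmp (u + v) j = (fun x => u x 0 j + v x 0 j).
  by apply/funext => x; rewrite fctE mxE.
apply: complex_eq; rewrite fctE [in RHS]mxE ?ReD ?ImD.
  by rewrite !fourier_Re E tipDl ?mulrDl//; exact: tsq_cosk.
by rewrite !fourier_Im E tipDl ?mulrDl ?opprD//; exact: tsq_sink.
Qed.

Lemma fourierN u : in_L2 L u -> fourier L (- u) = - fourier L u.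
Proof.
move=> /in_L2_tsq su; apply/funext => k; apply/rowP => j.
have E : cmp (- u) j = (fun x => -1 * u x 0 j).
  by apply/funext => x; rewrite fctE mxE mulN1r.
apply: complex_eq; rewrite fctE [in RHS]mxE ?ReN ?ImN.
  by rewrite !fourier_Re E tipZl ?mulN1r ?mulNr//; exact: tsq_cosk.
by rewrite !fourier_Im E tipZl ?mulN1r ?mulNr//; exact: tsq_sink.
Qed.

Definition defect N u := \sum_(j < 2) bessel_defect N (cmp u j).

Lemma defectE N u : in_L2 L u ->
  defect N u = normH L u ^+ 2 - L ^+ 2 * \sum_(k <- box N) sqabs_row (fourier L u k).
Proof.
move=> su; rewrite normH_sqr// /defect /bessel_defect sumrB; congr (_ - _).
rewrite -mulr_suml exchange_big/= mulr_suml mulr_sumr; apply: eq_bigr => k _.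
rewrite /sqabs_row mulr_suml mulr_sumr; apply: eq_bigr => j _.
rewrite fourier_Re fourier_Im; field; by rewrite gt_eqF.
Qed.

Lemma defect_ge0 N u : in_L2 L u -> 0 <= defect N u.
Proof.
by move=> /in_L2_tsq su; apply: sumr_ge0 => j _; exact: bessel_defect_ge0.
Qed.

Lemma defectD N u v : in_L2 L u -> in_L2 L v ->
  defect N (u + v) <= 2 * defect N u + 2 * defect N v.
Proof.
move=> /in_L2_tsq su /in_L2_tsq sv; rewrite /defect !mulr_sumr -big_split.
apply: ler_sum => j _ /=.
apply: le_trans (bessel_defect_add N (su j) (sv j)); rewrite le_eqVlt; apply/orP; left.
by apply/eqP; congr bessel_defect; apply/funext => x; rewrite fctE mxE.
Qed.

Lemma defectN N u : in_L2 L u -> defect N (- u) = defect N u.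
Proof.
move=> /in_L2_tsq su; apply: eq_bigr => j _.
have := bessel_defectZ N (-1) (su j); rewrite sqrrN expr1n mul1r => <-.
by congr bessel_defect; apply/funext => x; rewrite fctE mxE mulN1r.
Qed.

Definition transverse k (c : 'rV[R[i]]_2) :=
  \sum_(j < 2) (k 0 j)%:~R * complex.Re (c 0 j) = 0 :> R /\
  \sum_(j < 2) (k 0 j)%:~R * complex.Im (c 0 j) = 0 :> R.

(** H in terms of coefficients.  The last condition is the completeness of the
    trigonometric system at u; it passes to sums because the defect is a
    nonnegative quadratic form. *)
Definition H_coefs u := [/\ in_L2 L u, forall k, transverse k (fourier L u k),
  fourier L u 0 = 0 &
  forall e : R, 0 < e -> exists N0 : nat, forall N, (N0 <= N)%N -> defect N u < e].

Definition poly_of (s : seq mode) (a b : mode -> 'rV[R]_2) : field R :=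
  fun x => \sum_(k <- s) (cos (phase L k x) *: a k + sin (phase L k x) *: b k).

Lemma poly_of_cmp s a b j : cmp (poly_of s a b) j =
  (fun x => \sum_(k <- s) (a k 0 j * cosk k x + b k 0 j * sink k x)).
Proof.
apply/funext => x; rewrite /poly_of summxE; apply: eq_bigr => k _.
by rewrite !mxE mulrC [X in _ + X]mulrC.
Qed.

Lemma poly_of_L2 s a b : in_L2 L (poly_of s a b).
Proof.
apply/in_L2_tsq => j; rewrite poly_of_cmp.
apply: (sqint_sum measurable_torus).
by move=> k; exact: tsq_term.
Qed.

Lemma poly_of_defect s a b : (forall k, k \in s -> k != 0) ->
  exists N0 : nat, forall N, (N0 <= N)%N -> defect N (poly_of s a b) = 0.
Proof.
move=> s0; have [N0 sN0] := seq_sub_box s; exists N0 => N N0N.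
rewrite /defect big1// => j _; rewrite poly_of_cmp.
have {}sN0 k : k \in s -> k \in box N by move=> /sN0; exact: box_le.
elim: s s0 sN0 => [_ _|k s IH s0 sN].
  have -> : (fun x : R * R => \sum_(k <- [::]) (a k 0 j * cosk k x + b k 0 j * sink k x))
      = (fun x => 0 * cosk 0 x).
    by apply/funext => x; rewrite big_nil mul0r.
  by rewrite bessel_defectZ; [rewrite expr0n mul0r|exact: tsq_cosk].
have sc := tsq_cosk k; have ss := tsq_sink k.
have st : tsq (fun x => \sum_(k <- s) (a k 0 j * cosk k x + b k 0 j * sink k x)).
  by apply: (sqint_sum measurable_torus) => m; exact: tsq_term.
apply/eqP; rewrite eq_le; apply/andP; split; last first.
  apply: bessel_defect_ge0; apply: (sqint_sum measurable_torus).
  by move=> m; exact: tsq_term.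
have -> : (fun x : R * R => \sum_(k <- k :: s) (a k 0 j * cosk k x + b k 0 j * sink k x))
    = (fun x => (a k 0 j * cosk k x + b k 0 j * sink k x) +
         \sum_(k <- s) (a k 0 j * cosk k x + b k 0 j * sink k x)).
  by apply/funext => x; rewrite big_cons.
apply: (le_trans (bessel_defect_add _ _ _)) => //; first exact: tsq_term.
rewrite IH; first last.
- by move=> m ms; apply: sN; rewrite inE ms orbT.
- by move=> m ms; apply: s0; rewrite inE ms orbT.
rewrite mulr0 addr0.
have := bessel_defect_add N (tsqZ (a k 0 j) sc) (tsqZ (b k 0 j) ss).
rewrite !bessel_defectZ// bessel_defect_cosk ?bessel_defect_sink ?s0 ?sN ?inE ?eqxx//.
rewrite !mulr0 addr0; lra.
Qed.

Lemma weighted_sqr_le (a b x y p q M : R) : 0 <= M -> 0 <= p -> 0 <= q ->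
  x ^+ 2 <= M * p -> y ^+ 2 <= M * q ->
  (a * x + b * y) ^+ 2 <= 2 * (a ^+ 2 + b ^+ 2) * M * (p + q).
Proof.
move=> M0 p0 q0 xp yq.
have := ler_wpM2l (sqr_ge0 a) xp; have := ler_wpM2l (sqr_ge0 b) yq.
have := mulr_ge0 (sqr_ge0 a) (mulr_ge0 M0 q0).
have := mulr_ge0 (sqr_ge0 b) (mulr_ge0 M0 p0).
have := sqr_ge0 (a * x - b * y).
by rewrite !sqrrD !exprMn; lra.
Qed.

(** A linear functional which is continuous in L^2 and vanishes on the
    trigonometric polynomials vanishes on their closure. *)
Lemma normH_approx_zero u (w : 'I_2 -> R) g : in_H L u -> tsq g ->
  (forall f, tsq f -> tip f g ^+ 2 <= L ^+ 2 * tip f f) ->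
  (forall p, divfree_trig_poly L p -> \sum_(j < 2) w j * tip (cmp p j) g = 0) ->
  \sum_(j < 2) w j * tip (cmp u j) g = 0.
Proof.
move=> [su Hu] sg Hg Hp; set l := \sum_(j < 2) _.
pose C := 2 * (w 0 ^+ 2 + w 1 ^+ 2) * L ^+ 2.
have C0 : 0 <= C by rewrite mulr_ge0 ?sqr_ge0// mulr_ge0// addr_ge0 ?sqr_ge0.
suff H e : 0 < e -> l ^+ 2 <= C * e ^+ 2.
  apply/eqP; rewrite -sqrf_eq0 eq_le sqr_ge0 andbT; apply/ler_addgt0Pr => e e0.
  rewrite add0r; pose e' := Num.sqrt (e / (C + 1)).
  have C1 : 0 < C + 1 by rewrite ltr_wpDl.
  have e'0 : 0 < e' by rewrite sqrtr_gt0 divr_gt0.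
  apply: (le_trans (H _ e'0)); rewrite sqr_sqrtr; last by rewrite ltW// divr_gt0.
  by rewrite mulrA ler_pdivrMr// mulrDr mulr1 [C * e]mulrC lerDl ltW.
move=> e0; have [p pp up] := Hu e e0.
have sp : in_L2 L p by case: pp => s [a [b [_ ->]]]; exact: poly_of_L2.
have sd : in_L2 L (u - p) by apply: in_L2D => //; exact: in_L2N.
have E : l = \sum_(j < 2) w j * tip (cmp (u - p) j) g.
  transitivity (l - \sum_(j < 2) w j * tip (cmp p j) g); first by rewrite (Hp _ pp) subr0.
  rewrite /l -sumrB; apply: eq_bigr => j _.
  have -> : cmp (u - p) j = (fun x => u x 0 j + -1 * p x 0 j).
    by apply/funext => x; rewrite fctE !mxE mulN1r.
  move: su sp => /in_L2_tsq su /in_L2_tsq sp.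
  rewrite tipDl//; last exact: tsqZ.
  by rewrite tipZl// mulN1r mulrBr.
rewrite E sum2E.
have N2 : normH L (u - p) ^+ 2 <= e ^+ 2.
  by rewrite ler_pXn2r ?nnegrE ?normH_ge0// ltW.
move: sd => /[dup] sd /in_L2_tsq sdj.
move: N2; rewrite normH_sqr// sum2E => N2.
apply: le_trans (ler_wpM2l C0 N2); rewrite /C.
by apply: weighted_sqr_le; rewrite ?sqr_ge0 ?tip_ge0//; exact: Hg.
Qed.

Lemma tip_poly_cos s a b j m : tip (cmp (poly_of s a b) j) (cosk m) =
  \sum_(k <- s) a k 0 j * (L ^+ 2 / 2 * pm k m).
Proof.
rewrite poly_of_cmp [LHS](ip_suml measurable_torus _ _ (tsq_cosk m)); last first.
  by move=> k; exact: tsq_term.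
apply: eq_bigr => k _.
rewrite -[LHS]/(tip (fun x => a k 0 j * cosk k x + b k 0 j * sink k x) (cosk m)).
have sc := tsq_cosk k; have ss := tsq_sink k; have sm := tsq_cosk m.
rewrite tipDl//; [|exact: tsqZ..].
by rewrite !tipZl// ip_cosk ip_sin_cos mulr0 addr0.
Qed.

Lemma tip_poly_sin s a b j m : tip (cmp (poly_of s a b) j) (sink m) =
  \sum_(k <- s) b k 0 j * (L ^+ 2 / 2 * mm k m).
Proof.
rewrite poly_of_cmp [LHS](ip_suml measurable_torus _ _ (tsq_sink m)); last first.
  by move=> k; exact: tsq_term.
apply: eq_bigr => k _.
rewrite -[LHS]/(tip (fun x => a k 0 j * cosk k x + b k 0 j * sink k x) (sink m)).
have sc := tsq_cosk k; have ss := tsq_sink k; have sm := tsq_sink m.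
rewrite tipDl//; [|exact: tsqZ..].
by rewrite !tipZl// ip_sink (tipC (cosk k)) ip_sin_cos mulr0 add0r.
Qed.

Lemma wave_dot_delta k m (a : 'rV[R]_2) (s : R) :
  \sum_(j < 2) (k 0 j)%:~R * a 0 j = 0 ->
  ((k == m)%:R + s * (k == - m)%:R) * (\sum_(j < 2) (m 0 j)%:~R * a 0 j) = 0.
Proof.
move=> ka; have [<-|km] := eqVneq k m; first by rewrite ka mulr0.
have [E|_] := eqVneq k (- m); last by rewrite mulr0 addr0 mul0r.
have -> : m = - k by rewrite E opprK.
rewrite (_ : \sum_(j < 2) _ = - \sum_(j < 2) (k 0 j)%:~R * a 0 j).
  by rewrite ka oppr0 mulr0.
by rewrite -sumrN; apply: eq_bigr => j _; rewrite mxE rmorphN mulNr.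
Qed.

Lemma in_H_transverse u : in_H L u -> forall k, transverse k (fourier L u k).
Proof.
move=> Hu m; split.
- under eq_bigr => j _ do rewrite fourier_Re mulrA.
  rewrite -mulr_suml (normH_approx_zero (w := fun j => (m 0 j)%:~R) Hu (tsq_cosk m)) ?mul0r//.
    by move=> f sf; have [] := tip_sqr_le m sf.
  move=> _ [s [a [b [ab ->]]]].
  under eq_bigr => j _ do rewrite [tip _ _](@tip_poly_cos s a b) mulr_sumr.
  rewrite exchange_big big1_seq//= => k /ab[_ ka _].
  have := wave_dot_delta m 1 ka; rewrite mul1r -/(pm k m) => E.
  transitivity (L ^+ 2 / 2 * (pm k m * \sum_(j < 2) (m 0 j)%:~R * a k 0 j)).
    by rewrite !sum2E; ring.
  by rewrite E mulr0.
- under eq_bigr => j _ do rewrite fourier_Im mulrN mulrA.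
  rewrite sumrN -mulr_suml (normH_approx_zero (w := fun j => (m 0 j)%:~R) Hu (tsq_sink m)) ?mul0r ?oppr0//.
    by move=> f sf; have [] := tip_sqr_le m sf.
  move=> _ [s [a [b [ab ->]]]].
  under eq_bigr => j _ do rewrite [tip _ _](@tip_poly_sin s a b) mulr_sumr.
  rewrite exchange_big big1_seq//= => k /ab[_ _ kb].
  have := wave_dot_delta m (-1) kb; rewrite mulN1r -/(mm k m) => E.
  transitivity (L ^+ 2 / 2 * (mm k m * \sum_(j < 2) (m 0 j)%:~R * b k 0 j)).
    by rewrite !sum2E; ring.
  by rewrite E mulr0.
Qed.

Lemma in_H_mean0 u : in_H L u -> fourier L u 0 = 0.
Proof.
move=> Hu; have su := Hu.1; move/in_L2_tsq: (su) => sj.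
apply/rowP => j; rewrite [in RHS]mxE; apply: complex_eq; rewrite ?fourier_Re ?fourier_Im /=.
  have H : \sum_(i < 2) (i == j)%:R * tip (cmp u i) (cosk 0) = 0.
    apply: (normH_approx_zero Hu (tsq_cosk 0)).
      by move=> f sf; have [] := tip_sqr_le 0 sf.
    move=> _ [s [a [b [ab ->]]]].
    rewrite big1// => i _; rewrite [tip _ _](@tip_poly_cos s a b) big1_seq ?mulr0//.
    by move=> k /ab[k0 _ _]; rewrite /pm oppr0 (negbTE k0) addr0 !mulr0.
  move: H; rewrite (bigD1 j)//= eqxx mul1r big1 ?addr0; first by move=> ->; rewrite mul0r.
  by move=> i /negbTE ->; rewrite mul0r.
have := ip_sinkN 0 (sj j); rewrite oppr0 => /eqP; rewrite -addr_eq0 -mulr2n mulrn_eq0/=.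
by move=> /eqP ->; rewrite mul0r oppr0.
Qed.

Lemma in_H_coefs u : in_H L u -> H_coefs u.
Proof.
move=> Hu; have su := Hu.1; split=> //; [exact: in_H_transverse|exact: in_H_mean0|].
move=> e e0; have e2 : 0 < Num.sqrt (e / 4) by rewrite sqrtr_gt0 divr_gt0.
have [_ [s [a [b [ab ->]]]] up] := Hu.2 _ e2.
have [N0 N0P] := @poly_of_defect s a b (fun k ks => let: And3 k0 _ _ := ab k ks in k0).
exists N0 => N NN.
have sp : in_L2 L (poly_of s a b) by exact: poly_of_L2.
have sd : in_L2 L (u - poly_of s a b) by apply: in_L2D => //; exact: in_L2N.
have := defectD N sd sp; rewrite subrK N0P// mulr0 addr0 => /le_lt_trans; apply.
have : defect N (u - poly_of s a b) <= normH L (u - poly_of s a b) ^+ 2.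
  rewrite defectE// gerBl mulr_ge0 ?sqr_ge0// sumr_ge0// => k _; exact: sqabs_row_ge0.
have : normH L (u - poly_of s a b) ^+ 2 < e / 4.
  rewrite -(@sqr_sqrtr _ (e / 4)); last by rewrite ltW// divr_gt0.
  by rewrite ltr_pXn2r ?nnegrE ?normH_ge0 ?sqrtr_ge0.
lra.
Qed.

(** The orthogonal projection to the nonzero modes of a box: a trigonometric
    polynomial that approximates u in H, and a test field in V. *)
Definition trunc N u : field R := poly_of [seq k <- box N | k != 0]
  (fun k => \row_j complex.Re (fourier L u k 0 j))
  (fun k => \row_j - complex.Im (fourier L u k 0 j)).

Lemma trunc_divfree N u : (forall k, transverse k (fourier L u k)) ->
  divfree_trig_poly L (trunc N u).
Proof.
move=> tu; eexists; eexists; eexists; split; last reflexivity.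
move=> k; rewrite mem_filter => /andP[k0 _]; have [r i] := tu k; split=> //.
  by apply: etrans r; apply: eq_bigr => j _; rewrite mxE.
transitivity (- (\sum_(j < 2) (k 0 j)%:~R * complex.Im (fourier L u k 0 j))).
  by rewrite -sumrN; apply: eq_bigr => j _; rewrite mxE mulrN.
by rewrite i oppr0.
Qed.
Lemma trunc_cmp N u j : fourier L u 0 = 0 -> cmp (trunc N u) j = proj N (cmp u j).
Proof.
move=> u0; rewrite poly_of_cmp /proj /trigsum; apply/funext => x.
rewrite big_filter [RHS](bigID (fun k => k != 0))/= [X in _ = _ + X]big1 ?addr0.
  by apply: eq_bigr => k _; rewrite !mxE /= opprK.
move=> k /negPn/eqP ->.
have := fourier_Re u 0 j; have := fourier_Im u 0 j; rewrite u0 mxE /=.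
by move=> /eqP; rewrite eq_sym oppr_eq0 => /eqP -> <-; rewrite !mul0r addr0.
Qed.

Lemma trunc_defect N u : in_L2 L u -> fourier L u 0 = 0 ->
  normH L (u - trunc N u) ^+ 2 = defect N u.
Proof.
move=> su u0; rewrite normH_sqr; last first.
  by apply: in_L2D => //; apply: in_L2N; exact: poly_of_L2.
apply: eq_bigr => j _; move/in_L2_tsq: su => su; rewrite bessel_defect_proj//.
have -> // : cmp (u - trunc N u) j = (fun x => u x 0 j + -1 * proj N (cmp u j) x).
rewrite -trunc_cmp//.
by apply/funext => x; rewrite fctE !mxE mulN1r.
Qed.

Lemma H_coefs_in_H u : H_coefs u -> in_H L u.
Proof.
move=> [su tu u0 du]; split=> // e e0.
have [N0 /(_ _ (leqnn _)) N0P] := du _ (exprn_gt0 2 e0).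
exists (trunc N0 u); first exact: trunc_divfree.
by move: N0P; rewrite -trunc_defect// ltr_pXn2r ?nnegrE ?normH_ge0 ?ltW.
Qed.

Lemma transverseD k (c d : 'rV[R[i]]_2) : transverse k c -> transverse k d ->
  transverse k (c + d).
Proof.
move=> [c1 c2] [d1 d2]; split.
  transitivity (\sum_(j < 2) (k 0 j)%:~R * complex.Re (c 0 j) +
      \sum_(j < 2) (k 0 j)%:~R * complex.Re (d 0 j)); last by rewrite c1 d1 addr0.
  by rewrite -big_split; apply: eq_bigr => j _; rewrite mxE ReD mulrDr.
transitivity (\sum_(j < 2) (k 0 j)%:~R * complex.Im (c 0 j) +
    \sum_(j < 2) (k 0 j)%:~R * complex.Im (d 0 j)); last by rewrite c2 d2 addr0.
by rewrite -big_split; apply: eq_bigr => j _; rewrite mxE ImD mulrDr.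
Qed.

Lemma transverseN k (c : 'rV[R[i]]_2) : transverse k c -> transverse k (- c).
Proof.
move=> [c1 c2]; split.
  transitivity (- (\sum_(j < 2) (k 0 j)%:~R * complex.Re (c 0 j))).
    by rewrite -sumrN; apply: eq_bigr => j _; rewrite mxE ReN mulrN.
  by rewrite c1 oppr0.
transitivity (- (\sum_(j < 2) (k 0 j)%:~R * complex.Im (c 0 j))).
  by rewrite -sumrN; apply: eq_bigr => j _; rewrite mxE ImN mulrN.
by rewrite c2 oppr0.
Qed.

(** H is defined by density of trigonometric polynomials; it is a vector space
    since membership is a closed linear condition on the coefficients. *)
Lemma in_HD u v : in_H L u -> in_H L v -> in_H L (u + v).
Proof.
move=> /in_H_coefs[su tu u0 du] /in_H_coefs[sv tv v0 dv].
apply: H_coefs_in_H; split; first exact: in_L2D.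
- by move=> k; rewrite fourierD// fctE; exact: transverseD.
- by rewrite fourierD// fctE u0 v0 addr0.
move=> e e0; have e4 : 0 < e / 4 by rewrite divr_gt0.
have [N1 H1] := du _ e4; have [N2 H2] := dv _ e4.
exists (maxn N1 N2) => N; rewrite geq_max => /andP[/H1 {}H1 /H2 {}H2].
by apply: (le_lt_trans (defectD N su sv)); lra.
Qed.

Lemma in_HN u : in_H L u -> in_H L (- u).
Proof.
move=> /in_H_coefs[su tu u0 du].
apply: H_coefs_in_H; split; first exact: in_L2N.
- by move=> k; rewrite fourierN// fctE; exact: transverseN.
- by rewrite fourierN// fctE u0 oppr0.
by move=> e /du[N0 H]; exists N0 => N /H; rewrite defectN.
Qed.

Lemma in_HB u v : in_H L u -> in_H L v -> in_H L (u - v).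
Proof. by move=> Hu Hv; exact: (in_HD Hu (in_HN Hv)). Qed.

Lemma fourierB u v : in_L2 L u -> in_L2 L v ->
  fourier L (u - v) = fourier L u - fourier L v.
Proof. by move=> su sv; rewrite fourierD ?fourierN//; exact: in_L2N. Qed.

Lemma normHN u : in_L2 L u -> normH L (- u) = normH L u.
Proof.
move=> su; apply/eqP; rewrite -(@eqrXn2 _ 2) ?normH_ge0//.
rewrite !normH_sqr//; last exact: in_L2N.
move/in_L2_tsq: su => su; apply/eqP; apply: eq_bigr => j _.
have -> : cmp (- u) j = (fun x => -1 * u x 0 j).
  by apply/funext => x; rewrite fctE mxE mulN1r.
by rewrite tipZl// ?(tipC (cmp u j)) ?tipZl ?mulN1r ?opprK//; exact: tsqZ.
Qed.

Lemma fourier_sums u : in_L2 L u ->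
  sums_le (fun k => sqabs_row (fourier L u k)) (normH L u ^+ 2 / L ^+ 2).
Proof.
move=> su; apply: sums_le_box => [k|N]; first exact: sqabs_row_ge0.
have := defect_ge0 N su; rewrite defectE// subr_ge0.
by rewrite ler_pdivlMr ?exprn_gt0// mulrC.
Qed.

Lemma fourier_summable u : in_L2 L u ->
  abs_summable (fun k => sqabs_row (fourier L u k)).
Proof.
by move=> su; apply: abs_summable_pos (fourier_sums su) => k; exact: sqabs_row_ge0.
Qed.

Lemma parseval u : in_H L u ->
  normH L u ^+ 2 = L ^+ 2 * rsum (fun k => sqabs_row (fourier L u k)).
Proof.
move=> Hu; have [su _ _ du] := in_H_coefs Hu.
have L2 : 0 < L ^+ 2 by rewrite exprn_gt0.
suff -> : rsum (fun k => sqabs_row (fourier L u k)) = (L ^+ 2)^-1 * normH L u ^+ 2.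
  by rewrite mulVKf// gt_eqF.
apply: rsum_unique; first exact: fourier_summable.
apply/cvgrPdist_lt => e e0; have [N0 H] := du _ (mulr_gt0 L2 e0).
exists N0 => // N /= /H; have := defect_ge0 N su; rewrite defectE// => d0 de.
have E : (L ^+ 2)^-1 * normH L u ^+ 2 - \sum_(k <- box N) sqabs_row (fourier L u k) =
   (L ^+ 2)^-1 * (normH L u ^+ 2 - L ^+ 2 * \sum_(k <- box N) sqabs_row (fourier L u k)).
  by rewrite mulrBr mulKf ?gt_eqF.
rewrite E ger0_norm; last by rewrite mulr_ge0// invr_ge0 ltW.
by rewrite ltr_pdivrMl.
Qed.

Lemma fourier_trunc N u k : in_L2 L u -> fourier L u 0 = 0 ->
  fourier L (trunc N u) k = if k \in box N then fourier L u k else 0.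
Proof.
move=> /in_L2_tsq su u0; apply/rowP => j.
have L2 : L != 0 by rewrite gt_eqF.
apply: complex_eq.
  rewrite fourier_Re trunc_cmp// ip_trigsum_cos coskN; case: ifP => _; last by rewrite mul0r mxE.
  rewrite fourier_Re; field; exact: L2.
rewrite fourier_Im trunc_cmp// ip_trigsum_sin ip_sinkN//; case: ifP => _; last by rewrite mul0r oppr0 mxE.
rewrite fourier_Im; field; exact: L2.
Qed.

Lemma trunc_in_H N u : in_H L u -> in_H L (trunc N u).
Proof.
move=> Hu; split; first exact: poly_of_L2.
move=> e e0; exists (trunc N u); first by apply: trunc_divfree; exact: in_H_transverse.
rewrite subrr; suff -> : normH L 0 = 0 by [].
apply/eqP; rewrite -sqrf_eq0 normH_sqr; last first.
  by apply/in_L2_tsq => j; have := tsqZ 0 (tsq_cosk 0); congr tsq; apply/funext => x; rewrite mxE mul0r.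
rewrite big1// => j _; have -> : cmp (0 : field R) j = (fun x => 0 * cosk 0 x).
  by apply/funext => x; rewrite mxE mul0r.
by rewrite tipZl ?mul0r//; [exact: tsq_cosk|exact/tsqZ/tsq_cosk].
Qed.

Lemma sqnormHs1E u : sqnormHs L 1 u =
  ((L ^+ 2)%:E * \esum_(k in setT) (sqabs k * sqabs_row (fourier L u k))%:E)%E.
Proof.
rewrite /sqnormHs; congr (_ * _)%E; apply: eq_esum => k _.
by rewrite powRr1// sqabs_ge0.
Qed.

Lemma sqnormHs1_fin u : coef_V (fourier L u) ->
  sqnormHs L 1 u = (L ^+ 2 * Vsq (fourier L u))%:E.
Proof.
by move=> [_ su]; rewrite sqnormHs1E esum_rsum// => k; exact: Vsq_term_ge0.
Qed.

Lemma sqnormHs1_coef_V u : in_H L u -> (sqnormHs L 1 u < +oo)%E ->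
  coef_V (fourier L u).
Proof.
move=> Hu; rewrite sqnormHs1E => fin; split; first exact: in_H_mean0.
apply: abs_summable_esum; first by move=> k; exact: Vsq_term_ge0.
rewrite ltey; apply: contraTneq fin => ->.
by rewrite gt0_muley ?ltxx// lte_fin exprn_gt0.
Qed.

Lemma in_V_coef u : in_V L u <-> in_H L u /\ coef_V (fourier L u).
Proof.
split=> [[Hu fin]|[Hu Vu]]; first by split=> //; exact: sqnormHs1_coef_V.
by split=> //; rewrite sqnormHs1_fin// ltry.
Qed.

Lemma normV_sqr u : coef_V (fourier L u) -> normV L u ^+ 2 = L ^+ 2 * Vsq (fourier L u).
Proof.
move=> Vu; rewrite sqr_sqrtr sqnormHs1_fin//=.
by rewrite mulr_ge0 ?sqr_ge0 ?Vsq_ge0.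
Qed.

Lemma normV_ge0 u : 0 <= normV L u. Proof. exact: sqrtr_ge0. Qed.

Lemma in_VD u v : in_V L u -> in_V L v -> in_V L (u + v).
Proof.
move=> /in_V_coef[Hu Vu] /in_V_coef[Hv Vv]; apply/in_V_coef; split; first exact: in_HD.
by rewrite fourierD; [exact: coef_V_D|exact: Hu.1|exact: Hv.1].
Qed.

Lemma in_VN u : in_V L u -> in_V L (- u).
Proof.
move=> /in_V_coef[Hu Vu]; apply/in_V_coef; split; first exact: in_HN.
by rewrite fourierN; [exact: coef_V_N|exact: Hu.1].
Qed.

Lemma in_VB u v : in_V L u -> in_V L v -> in_V L (u - v).
Proof. by move=> Vu Vv; exact: (in_VD Vu (in_VN Vv)). Qed.

Lemma normVN u : in_V L u -> normV L (- u) = normV L u.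
Proof.
move=> Vu; have Vu' := in_VN Vu; move: (Vu) (Vu') => /in_V_coef[Hu cu] /in_V_coef[_ cu'].
have E : normV L (- u) ^+ 2 = normV L u ^+ 2.
  apply: (etrans (normV_sqr cu')); apply: (etrans _ (esym (normV_sqr cu))).
  apply: (congr1 ( *%R (L ^+ 2))).
  apply: (etrans (congr1 (@Vsq R) (fourierN Hu.1))).
  by apply: eq_rsum => k; rewrite fctE sqabs_rowN.
apply/eqP; rewrite -(eqrXn2 (ltn0Sn 1) (normV_ge0 (- u)) (normV_ge0 u)).
exact/eqP.
Qed.

Lemma trunc_in_V N u : in_H L u -> in_V L (trunc N u).
Proof.
move=> Hu; apply/in_V_coef; split; first exact: trunc_in_H.
have [su _ u0 _] := in_H_coefs Hu.
split; first by rewrite fourier_trunc// u0; case: ifP.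
have supp k : k \notin box N -> sqabs k * sqabs_row (fourier L (trunc N u) k) = 0.
  by move=> kN; rewrite fourier_trunc// (negbTE kN) sqabs_row0 mulr0.
exists (\sum_(k <- box N) sqabs k * sqabs_row (fourier L (trunc N u) k)).
apply: sums_le_box => // M.
apply: (@le_trans _ _ (\sum_(k <- box (maxn M N)) `|sqabs k * sqabs_row (fourier L (trunc N u) k)|)).
  by apply: box_sum_nondecreasing => //; rewrite leq_maxl.
rewrite le_eqVlt; apply/orP; left; apply/eqP.
rewrite (bigID (mem (box N)))/= [X in _ + X]big1// ?addr0; last first.
  by move=> k /supp ->; rewrite normr0.
rewrite -big_filter (perm_big (box N)).
  by apply: eq_bigr => k _; rewrite ger0_norm// Vsq_term_ge0.
rewrite uniq_perm ?filter_uniq ?box_uniq// => k; rewrite mem_filter.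
by case: (boolP (k \in box N)) => // kN; rewrite (box_le (leq_maxr _ _) kN).
Qed.

End TorusTrig.

(** * Static energy estimates *)

Lemma sqr_le_le (R : realDomainType) (a b : R) : 0 <= a -> 0 <= b ->
  a ^+ 2 <= b ^+ 2 -> a <= b.
Proof. by move=> a0 b0; rewrite ler_pXn2r. Qed.

Lemma ler_eqs (R : realDomainType) (a b c d : R) : a = c -> b = d -> c <= d -> a <= b.
Proof. by move=> -> ->. Qed.

Section StaticEstimates.
Context {R : realType} (L : R) (L0 : 0 < L).
Implicit Types (u v w e m z : field R) (c d : coefs R).
Notation F := (fourier L).

Lemma coef_V0 : coef_V (0 : coefs R).
Proof.
split=> //; exists 0 => s _; rewrite big1// => k _.
by rewrite sqabs_row0 mulr0 normr0.
Qed.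

Lemma tri0 d c : coef_V d -> coef_V c -> tri L 0 d c = 0.
Proof.
move=> Vd Vc; have := triDl L0 coef_V0 coef_V0 Vd Vc.
by rewrite addr0 => /eqP; rewrite addrC -subr_eq subrr eq_sym => /eqP.
Qed.

Lemma fourier0 : F 0 = 0.
Proof.
have s0 : in_L2 L (0 : field R).
  by apply/in_L2_tsq => j; have := sqint0 (lebesgue_measure \x lebesgue_measure)%E (torus L); congr sqint; apply/funext => x; rewrite mxE.
by rewrite -(subrr (0 : field R)) (fourierB L0 s0 s0) subrr.
Qed.

Lemma in_V0 v : in_V L v -> in_V L 0.
Proof. by move=> Vv; have := in_VB L0 Vv Vv; rewrite subrr. Qed.

Lemma normV0 : normV L 0 = 0.
Proof.
apply/eqP; rewrite -sqrf_eq0 normV_sqr fourier0; last exact: coef_V0.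
rewrite /Vsq (@rsum_supp _ _ 0%N) => [|k _]; last by rewrite sqabs_row0 mulr0.
by rewrite big1 ?mulr0// => k _; rewrite sqabs_row0 mulr0.
Qed.

Lemma coefV v : in_V L v -> coef_V (F v).
Proof. by move=> /(in_V_coef L0)[]. Qed.

Context (K' : R) (bounds : bilinear_bounds L K').

Lemma tri_diag_le0 v : in_V L v -> tri L (F v) (F v) (F v) <= 0.
Proof.
move=> Vv; have V0 := in_V0 Vv; have [b _ _] := bounds.2 v 0 v Vv V0 Vv.
move: b; rewrite subr0 normV0 mulr0 !mul0r /B fourier0.
by rewrite (pairing_BilinB L0 (coefV Vv) coef_V0 (coefV Vv)) tri0 ?subr0//; [exact: coef_V0|exact: coefV].
Qed.

(** Energy is conserved by the nonlinearity: the first bound with w = 0 gives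
    one sign for v, and the other one for - v. *)
Lemma tri_diag0 v : in_V L v -> tri L (F v) (F v) (F v) = 0.
Proof.
move=> Vv; apply/eqP; rewrite eq_le tri_diag_le0//=.
have cv := coefV Vv; have cNv := coef_V_N cv.
have := tri_diag_le0 (in_VN L0 Vv).
rewrite (fourierN L0 Vv.1.1) (triNl L0 cv cNv cNv) (triNr L0 cv cNv cv).
by rewrite triC (triNl L0 cv cv cv) opprK oppr_le0.
Qed.

(** This bound is linear in the V-norm of m, hence integrable in time against
    the V-norm of z; the polarized form of energy conservation moves the test
    field z to the place where the second bound applies. *)
Lemma tri_bound m z : in_V L m -> in_V L z ->
  `|tri L (F m) (F m) (F z)| <= 2 * K' * normV L z * normV L m * normH L m.
Proof.
move=> Vm Vz; have cm := coefV Vm; have cz := coefV Vz.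
have T0 c : c = F m + F z \/ c = F m - F z \/ c = F z -> tri L c c c = 0.
  move=> [->|[->|->]]; last exact: tri_diag0.
    by rewrite -(fourierD L0 Vm.1.1 Vz.1.1); apply: tri_diag0; exact: in_VD.
  by rewrite -(fourierB L0 Vm.1.1 Vz.1.1); apply: tri_diag0; exact: in_VB.
rewrite (tri_swap L0 cm cz T0) normrM normrN (ger0_norm (ler0n _ 2)) -!mulrA ler_wpM2l// !mulrA.
by have [_ b _] := bounds.2 m z m Vm Vz Vm.
Qed.

(** The first bound at - w and - m: compared with m and w, it has the V-norm of
    m instead of that of w, and bounds the form from below. *)
Lemma tri_lower m w : in_V L m -> in_V L w ->
  - (tri L (F m) (F m) (F (m - w)) - tri L (F w) (F w) (F (m - w))) <=
  K' * normV L m * normV L (m - w) * normH L (m - w).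
Proof.
move=> Vm Vw; have VNm := in_VN L0 Vm; have VNw := in_VN L0 Vw.
have Ve := in_VB L0 Vm Vw.
have cm := coefV Vm; have cw := coefV Vw; have ce := coefV Ve.
have [b _ _] := bounds.2 _ _ m VNw VNm Vm.
have E : - w - - m = m - w by rewrite opprK addrC.
move: b; rewrite E (normVN L0 Vm); apply: le_trans.
rewrite /B (pairing_BilinB L0 (coefV VNw) (coefV VNm) ce).
have sq c d : coef_V c -> coef_V d -> tri L (- c) (- c) d = tri L c c d.
  move=> Vc Vd; rewrite (triNl L0 Vc (coef_V_N Vc) Vd) triC (triNl L0 Vc Vc Vd).
  by rewrite opprK.
by rewrite (fourierN L0 Vm.1.1) (fourierN L0 Vw.1.1) (sq _ _ cm ce) (sq _ _ cw ce) opprB.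
Qed.

(** ** Linear terms *)

Lemma intr_sum0 (k : mode) (c : 'rV[R[i]]_2) : transverse k c ->
  \sum_(l < 2) ((k 0 l)%:~R : R)%:C * c 0 l = 0.
Proof.
move=> [re im]; rewrite sum2E; apply: complex_eq.
  by rewrite ReD !ReZ; move: re; rewrite sum2E.
by rewrite ImD !ImZ; move: im; rewrite sum2E.
Qed.

Lemma imag_sqr (x : R) (z : R[i]) : (x *i) * ((x *i) * z) = - (x ^+ 2)%:C * z.
Proof.
case: z => a b; apply: complex_eq => /=; ring.
Qed.

(** The Leray projection is the identity on transverse coefficients. *)
Lemma stokesE c k : (forall k, transverse k (c k)) -> c 0 = 0 ->
  stokes L c k = (sqabs k)%:C *: c k.
Proof.
move=> tc c0; apply/rowP => j; rewrite /stokes mxE [RHS]mxE.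
have lapE l : laplacian L c k 0 l = - (4 * pi ^+ 2 / L ^+ 2 * sqabs k)%:C * c k 0 l.
  rewrite /laplacian summxE sum2E /deriv_coefs !mxE !imag_sqr -mulrDl; congr (_ * _).
  rewrite -opprD -rmorphD; congr (- _%:C); rewrite sqabs2; field; by rewrite gt_eqF.
rewrite (lerayE (laplacian L c) k j).
have [->|k0] := eqVneq k 0; first by rewrite mulr0 c0 mxE mulr0.
have -> : \sum_(l < 2) (k 0 l)%:~R%:C * laplacian L c k 0 l = 0 :> R[i].
  transitivity (- (4 * pi ^+ 2 / L ^+ 2 * sqabs k)%:C * \sum_(l < 2) ((k 0 l)%:~R : R)%:C * c k 0 l).
    by rewrite mulr_sumr; apply: eq_bigr => l _; rewrite lapE mulrCA.
  by rewrite (intr_sum0 (tc k)) mulr0.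
rewrite mulr0 subr0 lapE mulrA rmorphN mulrNN -rmorphM; congr (_%:C * _).
have p0 : (pi : R) != 0 by rewrite gt_eqF ?pi_gt0.
by move: (pi : R) p0 => p p0; field; rewrite p0 gt_eqF.
Qed.

Definition nudge_rate alpha (lambda : option nat) (k : mode) : R :=
  if observed L lambda k then sqabs k `^ (- (2 * alpha)) else 0.

Lemma nudgingE (om alpha : R) lambda c k :
  om%:C *: nudging L alpha lambda c k = (om * nudge_rate alpha lambda k)%:C *: c k.
Proof.
rewrite /nudging /Apow /Plam /nudge_rate; case: ifP => _.
  by rewrite scalerA -rmorphM.
by rewrite scaler0 scaler0 mulr0 scale0r.
Qed.

Lemma box_parseval N v : in_H L v ->
  normH L (trunc L N v) ^+ 2 = L ^+ 2 * \sum_(k <- box N) sqabs_row (F v k).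
Proof.
move=> Hv; rewrite (parseval L0 (trunc_in_H L0 N Hv)); congr (_ * _).
rewrite (@rsum_supp _ _ N) => [|k kN].
  rewrite big_seq [RHS]big_seq; apply: eq_bigr => k kN.
  by rewrite (fourier_trunc L0 _ _ Hv.1 (in_H_mean0 L0 Hv)) kN.
by rewrite (fourier_trunc L0 _ _ Hv.1 (in_H_mean0 L0 Hv)) (negbTE kN) sqabs_row0.
Qed.

Lemma box_normV N v : in_H L v ->
  normV L (trunc L N v) ^+ 2 = L ^+ 2 * \sum_(k <- box N) sqabs k * sqabs_row (F v k).
Proof.
move=> Hv; rewrite (normV_sqr (coefV (trunc_in_V L0 N Hv))); congr (_ * _).
rewrite /Vsq (@rsum_supp _ _ N) => [|k kN].
  rewrite big_seq [RHS]big_seq; apply: eq_bigr => k kN.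
  by rewrite (fourier_trunc L0 _ _ Hv.1 (in_H_mean0 L0 Hv)) kN.
by rewrite (fourier_trunc L0 _ _ Hv.1 (in_H_mean0 L0 Hv)) (negbTE kN) sqabs_row0 mulr0.
Qed.

Lemma pairing_trunc N c v : in_H L v ->
  pairing L c (F (trunc L N v)) = L ^+ 2 * \sum_(k <- box N) re_dot (c k) (F v k).
Proof.
move=> Hv; rewrite -[LHS]/(L ^+ 2 * rsum (fun k => re_dot (c k) (F (trunc L N v) k))).
congr (_ * _); rewrite (@rsum_supp _ _ N) => [|k kN].
  rewrite big_seq [RHS]big_seq; apply: eq_bigr => k kN.
  by rewrite (fourier_trunc L0 _ _ Hv.1 (in_H_mean0 L0 Hv)) kN.
by rewrite (fourier_trunc L0 _ _ Hv.1 (in_H_mean0 L0 Hv)) (negbTE kN) re_dot0r.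
Qed.

(** Coercivity is an assumption on fields of V, to which the truncations of a
    field of H belong. *)
Lemma coercive_box (delta om alpha gamma : R) lambda N v :
  coercive L delta om alpha lambda gamma -> in_H L v ->
  2^-1 * gamma * (L ^+ 2 * \sum_(k <- box N) sqabs_row (F v k)) <=
  L ^+ 2 * (\sum_(k <- box N) om * nudge_rate alpha lambda k * sqabs_row (F v k)) +
  2^-1 * delta * (L ^+ 2 * \sum_(k <- box N) sqabs k * sqabs_row (F v k)).
Proof.
move=> coer Hv; have := coer _ (trunc_in_V L0 N Hv).
rewrite (box_parseval N Hv) (box_normV N Hv).
move=> h; apply: (le_trans h); rewrite lerD2r (pairing_trunc N _ Hv).
rewrite le_eqVlt; apply/orP; left; apply/eqP; congr (_ * _).
rewrite big_seq [RHS]big_seq; apply: eq_bigr => k kN.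
rewrite nudgingE (fourier_trunc L0 _ _ Hv.1 (in_H_mean0 L0 Hv)) kN.
by rewrite re_dotZl re_dot_self.
Qed.

Lemma normV_trunc_le N v : in_V L v -> normV L (trunc L N v) <= normV L v.
Proof.
move=> Vv; have cv := coefV Vv; have Hv := Vv.1.
have h : L ^+ 2 * \sum_(k <- box N) sqabs k * sqabs_row (F v k) <= L ^+ 2 * Vsq (F v).
  rewrite ler_wpM2l ?sqr_ge0//.
  by apply: (sums_le_rsum (Vsq_term_ge0 (F v)) cv.2); exact: box_uniq.
apply: (sqr_le_le (normV_ge0 L _) (normV_ge0 L _)).
exact: (ler_eqs (box_normV N Hv) (normV_sqr cv) h).
Qed.

End StaticEstimates.

(** * Measurability and integrability in time *)

Section MeasurableSums.
Context {d : measure_display} {T : measurableType d} {R : realType}.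
Context (D : set T) (mD : measurable D).

Lemma measurable_esum (a : mode -> T -> R) : (forall k x, 0 <= a k x) ->
  (forall k, measurable_fun D (a k)) ->
  measurable_fun D (fun x => \esum_(k in setT) (a k x)%:E)%E.
Proof.
move=> a0 ma.
apply: (emeasurable_fun_cvg (fun N x => (\sum_(k <- box N) a k x)%:E)).
  by move=> N; apply/measurable_EFinP; apply: measurable_sum.
by move=> x _; apply: esum_box.
Qed.

Lemma measurable_fine_comp (f : T -> \bar R) : measurable_fun D f ->
  measurable_fun D (fun x => fine (f x)).
Proof.
by move=> mf; apply: (measurableT_comp (f := @fine R)) => //; exact: fine_measurable.
Qed.

Lemma measurable_rsum (a : mode -> T -> R) :
  (forall k, measurable_fun D (a k)) -> measurable_fun D (fun x => rsum (a ^~ x)).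
Proof.
move=> ma; apply: measurable_funB; apply: measurable_fine_comp; apply: measurable_esum.
- by move=> k x; rewrite le_max lexx orbT.
- by move=> k; apply: measurable_maxr.
- by move=> k x; rewrite le_max lexx orbT.
- by move=> k; apply: measurable_maxr => //; exact: measurable_funN.
Qed.

Definition cmeas (f : T -> R[i]) :=
  measurable_fun D (fun x => complex.Re (f x)) /\
  measurable_fun D (fun x => complex.Im (f x)).

Lemma cmeas_cst z : cmeas (fun=> z). Proof. by split. Qed.

Lemma cmeasD f g : cmeas f -> cmeas g -> cmeas (fun x => f x + g x).
Proof.
move=> [f1 f2] [g1 g2]; split.
  by under eq_fun do rewrite ReD; exact: measurable_funD.
by under eq_fun do rewrite ImD; exact: measurable_funD.
Qed.

Lemma cmeasN f : cmeas f -> cmeas (fun x => - f x).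
Proof.
move=> [f1 f2]; split.
  by under eq_fun do rewrite ReN; exact: measurable_funN.
by under eq_fun do rewrite ImN; exact: measurable_funN.
Qed.

Lemma ReM (z w : R[i]) : complex.Re (z * w) =
  complex.Re z * complex.Re w - complex.Im z * complex.Im w.
Proof. by case: z w => [? ?] [? ?]. Qed.

Lemma ImM (z w : R[i]) : complex.Im (z * w) =
  complex.Re z * complex.Im w + complex.Im z * complex.Re w.
Proof. by case: z w => [? ?] [? ?]. Qed.

Lemma cmeasM f g : cmeas f -> cmeas g -> cmeas (fun x => f x * g x).
Proof.
move=> [f1 f2] [g1 g2]; split.
  by under eq_fun do rewrite ReM; apply: measurable_funB; exact: measurable_funM.
by under eq_fun do rewrite ImM; apply: measurable_funD; exact: measurable_funM.
Qed.

Lemma cmeas_csum (f : mode -> T -> R[i]) : (forall p, cmeas (f p)) ->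
  cmeas (fun x => csum (f ^~ x)).
Proof.
by move=> mf; split; apply: measurable_rsum => p; have [] := mf p.
Qed.

Lemma cmeas_sum2 (f : 'I_2 -> T -> R[i]) : (forall p, cmeas (f p)) ->
  cmeas (fun x => \sum_(j < 2) f j x).
Proof.
by move=> mf; under eq_fun do rewrite sum2E; apply: cmeasD.
Qed.

Definition coef_meas (c : T -> coefs R) := forall k j, cmeas (fun x => c x k 0 j).

Lemma coef_meas_advection L (c e : T -> coefs R) : coef_meas c -> coef_meas e ->
  coef_meas (fun x => advection L (c x) (e x)).
Proof.
move=> mc me k l; under eq_fun do rewrite mxE.
apply: cmeas_sum2 => j; apply: cmeas_csum => p; apply: cmeasM => //.
by under eq_fun do rewrite mxE; apply: cmeasM => //; exact: cmeas_cst.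
Qed.

Lemma coef_meas_leray (c : T -> coefs R) : coef_meas c ->
  coef_meas (fun x => leray (c x)).
Proof.
move=> mc k j.
rewrite (_ : (fun x => leray (c x) k 0 j) = (fun x => if k == 0 then 0 else
  c x k 0 j - ((sqabs k)^-1 * (k 0 j)%:~R)%:C * \sum_(l < 2) ((k 0 l)%:~R)%:C * c x k 0 l)).
  case: eqP => _; first exact: cmeas_cst.
  apply: cmeasD => //; apply: cmeasN; apply: cmeasM; first exact: cmeas_cst.
  by apply: cmeas_sum2 => l; apply: cmeasM => //; exact: cmeas_cst.
by apply/funext => x; exact: lerayE.
Qed.

Lemma coef_meas_Bilin L (c : T -> coefs R) : coef_meas c ->
  coef_meas (fun x => Bilin L (c x) (c x)).
Proof.
move=> mc k j; under eq_fun do rewrite /Bilin mxE.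
have H : cmeas (fun x => (2^-1 *: leray (advection L (c x) (c x)) k) 0 j).
  under eq_fun do rewrite mxE; apply: cmeasM; first exact: cmeas_cst.
  exact: (coef_meas_leray (coef_meas_advection L mc mc)).
exact: cmeasD.
Qed.

End MeasurableSums.

Section Time.
Context {R : realType} (L : R) (L0 : 0 < L).
Notation mu := (@lebesgue_measure R).
Notation F := (fourier L).
Implicit Types (u v w : field R) (X Y : R -> field R).

(** ** The norm of H along a curve *)

Lemma inner_comb (x y : field R) (t : R) : in_L2 L x -> in_L2 L y ->
  0 <= normH L x ^+ 2 + 2 * t * inner L x y + t ^+ 2 * normH L y ^+ 2.
Proof.
move=> sx sy; rewrite (normH_sqr sx) (normH_sqr sy) (innerE sx sy).
rewrite !mulr_sumr -!big_split; apply: sumr_ge0 => j _ /=.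
move/in_L2_tsq: sx => /(_ j) sx; move/in_L2_tsq: sy => /(_ j) sy.
have sty := tsqZ t sy.
have := tip_ge0 L (fun z => x z 0 j + t * y z 0 j).
have sd := tsqD sx sty.
rewrite tipDl// tipZl// !(tipC L _ (fun z => x z 0 j + t * y z 0 j)) !tipDl// !tipZl//.
rewrite (tipC L (fun z => y z 0 j) (fun z => x z 0 j)); lra.
Qed.

(** Applied to the squared norm of x + t y as a polynomial in t. *)
Lemma cauchy_schwarz_sqr (p q r : R) : 0 <= p -> 0 <= r ->
  (forall t, 0 <= p + 2 * t * q + t ^+ 2 * r) -> q ^+ 2 <= p * r.
Proof.
move=> p0 r0 H; have [r1|r1] := eqVneq r 0.
  have [->|q0] := eqVneq q 0; first by rewrite expr0n/= mulr_ge0.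
  have := H (- (p + 1) / (2 * q)); rewrite r1 mulr0 addr0.
  have -> : 2 * (- (p + 1) / (2 * q)) * q = - (p + 1) by field.
  lra.
have rp : 0 < r by rewrite lt_neqAle eq_sym r1.
have := H (- q / r).
have -> : p + 2 * (- q / r) * q + (- q / r) ^+ 2 * r = p - q ^+ 2 / r by field.
by rewrite subr_ge0 ler_pdivrMr.
Qed.

Lemma normH_triangle x y : in_L2 L x -> in_L2 L y ->
  normH L (x + y) <= normH L x + normH L y.
Proof.
move=> sx sy.
have CS := cauchy_schwarz_sqr (sqr_ge0 (normH L x)) (sqr_ge0 (normH L y))
  (fun t => inner_comb t sx sy).
have E : normH L (x + y) ^+ 2 = normH L x ^+ 2 + 2 * inner L x y + normH L y ^+ 2.
  rewrite (normH_sqr (in_L2D sx sy)) (normH_sqr sx) (normH_sqr sy) (innerE sx sy).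
  rewrite mulr_sumr -!big_split; apply: eq_bigr => j _ /=.
  move/in_L2_tsq: sx => /(_ j) sx; move/in_L2_tsq: sy => /(_ j) sy.
  have -> : (fun z => (x + y) z 0 j) = (fun z => x z 0 j + y z 0 j).
    by apply/funext => z; rewrite fctE mxE.
  have sd := tsqD sx sy.
  rewrite tipDl// !(tipC L _ (fun z => x z 0 j + y z 0 j)) !tipDl//.
  rewrite (tipC L (fun z => y z 0 j) (fun z => x z 0 j)); lra.
have nx := normH_ge0 L x; have ny := normH_ge0 L y.
apply: sqr_le_le; [exact: normH_ge0|exact: addr_ge0|].
rewrite E sqrrD lerD2r lerD2l -[leRHS]mulr_natl ler_wpM2l//.
apply: (le_trans (ler_norm _)); apply: sqr_le_le; [by []|exact: mulr_ge0|].
by rewrite real_normK ?num_real// exprMn.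
Qed.

Lemma normH_dist x y : in_L2 L x -> in_L2 L y ->
  `|normH L x - normH L y| <= normH L (x - y).
Proof.
move=> sx sy; have sNy := in_L2N sy; have sxy := in_L2D sx sNy.
rewrite ler_norml lerBlDr lerNl opprB lerBlDr; apply/andP; split; last first.
  by have := normH_triangle sxy sy; rewrite subrK.
have := normH_triangle (in_L2N sxy) sx; rewrite (normHN sxy) opprB subrK.
by [].
Qed.

Lemma continuous_forP (N : field R -> R) (I : set R) X : (forall u, 0 <= N u) ->
  continuous_for N I X <-> forall t, I t -> forall e : R, 0 < e ->
    \forall s \near nbhs t, I s -> N (X s - X t) < e.
Proof.
move=> N0; split=> cX t It.
  move=> e e0; have /cvgrPdist_lt/(_ _ e0) := cX _ It.
  by rewrite near_withinE; apply: filterS => s H /H; rewrite sub0r normrN ger0_norm.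
apply/cvgrPdist_lt => e e0; rewrite near_withinE; apply: filterS (cX _ It _ e0) => s H /H.
by rewrite sub0r normrN ger0_norm.
Qed.

Lemma normH_continuous (I : set R) X : continuous_for (normH L) I X ->
  (forall t, I t -> in_L2 L (X t)) -> {within I, continuous (fun t => normH L (X t))}.
Proof.
move=> /(continuous_forP _ _ (normH_ge0 L)) cX sX; apply/subspace_continuousP => t It.
apply/cvgrPdist_lt => e e0; rewrite /from_subspace near_withinE.
apply: filterS (cX _ It _ e0) => s H Is.
by apply: le_lt_trans (H Is); rewrite distrC; exact: normH_dist (sX _ Is) (sX _ It).
Qed.

Lemma continuous_forD (I : set R) X Y : continuous_for (normH L) I X ->
  continuous_for (normH L) I Y -> (forall t, I t -> in_L2 L (X t)) ->
  (forall t, I t -> in_L2 L (Y t)) -> continuous_for (normH L) I (fun t => X t + Y t).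
Proof.
move=> /(continuous_forP _ _ (normH_ge0 L)) cX /(continuous_forP _ _ (normH_ge0 L)) cY sX sY.
apply/(continuous_forP _ _ (normH_ge0 L)) => t It e e0.
have e2 : 0 < e / 2 by rewrite divr_gt0.
apply: filterS2 (cX _ It _ e2) (cY _ It _ e2) => s HX HY Is.
have sx := in_L2D (sX _ Is) (in_L2N (sX _ It)).
have sy := in_L2D (sY _ Is) (in_L2N (sY _ It)).
have -> : X s + Y s - (X t + Y t) = (X s - X t) + (Y s - Y t) by rewrite opprD addrACA.
apply: (le_lt_trans (normH_triangle sx sy)).
by move: (HX Is) (HY Is); move: (normH _ _) (normH _ _) => x y; lra.
Qed.

Lemma continuous_forN (I : set R) X : continuous_for (normH L) I X ->
  (forall t, I t -> in_L2 L (X t)) -> continuous_for (normH L) I (fun t => - X t).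
Proof.
move=> /(continuous_forP _ _ (normH_ge0 L)) cX sX.
apply/(continuous_forP _ _ (normH_ge0 L)) => t It e e0.
apply: filterS (cX _ It _ e0) => s H Is.
have sd := in_L2D (sX _ Is) (in_L2N (sX _ It)).
have -> : - X s - - X t = - (X s - X t) by rewrite -opprD.
by rewrite (normHN sd); exact: H.
Qed.

Lemma normH_le_normV u : in_V L u -> normH L u <= normV L u.
Proof.
move=> Vu; have cu := coefV L0 Vu.
have h : L ^+ 2 * rsum (fun k => sqabs_row (F u k)) <= L ^+ 2 * Vsq (F u).
  rewrite ler_wpM2l ?sqr_ge0//.
  have /= := sums_le_rsum (Vsq_term_ge0 (F u)) cu.2 => H.
  apply: rsum_le; first exact: fourier_summable Vu.1.1.
  apply: sums_le_le H => k; have [->|k0] := eqVneq k 0.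
    by rewrite cu.1 sqabs_row0 mulr0.
  by rewrite ler_peMl ?sqabs_row_ge0// sqabs_ge1.
apply: (sqr_le_le (normH_ge0 L _) (normV_ge0 L _)).
exact: (ler_eqs (parseval L0 Vu.1) (normV_sqr cu) h).
Qed.

Lemma continuous_for_VH (I : set R) X : continuous_for (normV L) I X ->
  (forall t, I t -> in_V L (X t)) -> continuous_for (normH L) I X.
Proof.
move=> /(continuous_forP _ _ (normV_ge0 L)) cX sX.
apply/(continuous_forP _ _ (normH_ge0 L)) => t It e e0.
apply: filterS (cX _ It _ e0) => s H Is.
apply: le_lt_trans (H Is); apply: normH_le_normV; exact: (in_VB L0 (sX _ Is) (sX _ It)).
Qed.

Lemma coef_le_normH u k : in_L2 L u -> sqabs_row (F u k) <= normH L u ^+ 2 / L ^+ 2.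
Proof.
by move=> su; have := fourier_sums L0 su (s := [:: k]) isT; rewrite big_seq1.
Qed.

Lemma comp_sqr_le (a : 'rV[R[i]]_2) j :
  complex.Re (a 0 j) ^+ 2 <= sqabs_row a /\ complex.Im (a 0 j) ^+ 2 <= sqabs_row a.
Proof.
rewrite /sqabs_row (bigD1 j)//=; set S := \sum_(_ < _ | _) _.
have S0 : 0 <= S by apply: sumr_ge0 => i _; rewrite addr_ge0 ?sqr_ge0.
have := sqr_ge0 (complex.Re (a 0 j)); have := sqr_ge0 (complex.Im (a 0 j)).
by split; lra.
Qed.

Definition coef_cont (I : set R) (c : R -> coefs R) := forall k j,
  {within I, continuous (fun t => complex.Re (c t k 0 j))} /\
  {within I, continuous (fun t => complex.Im (c t k 0 j))}.

Lemma fourier_cont (I : set R) X : continuous_for (normH L) I X ->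
  (forall t, I t -> in_L2 L (X t)) -> coef_cont I (fun t => F (X t)).
Proof.
move=> /(continuous_forP _ _ (normH_ge0 L)) cX sX k j.
have H (P : R[i] -> R) : (forall z w : R[i], P (z - w) = P z - P w) ->
    (forall a : 'rV_2, P (a 0 j) ^+ 2 <= sqabs_row a) ->
    {within I, continuous (fun t => P (F (X t) k 0 j))}.
  move=> PB Ple; apply/subspace_continuousP => t It.
  apply/cvgrPdist_lt => e e0; have eL : 0 < e * L by rewrite mulr_gt0.
  rewrite /from_subspace near_withinE; apply: filterS (cX _ It _ eL) => s Hs Is.
  have := Hs Is; rewrite -ltr_pdivrMr//; apply: le_lt_trans; rewrite distrC.
  have sd := in_L2D (sX _ Is) (in_L2N (sX _ It)).
  have -> : P (F (X s) k 0 j) - P (F (X t) k 0 j) = P (F (X s - X t) k 0 j).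
    by rewrite (fourierB L0 (sX _ Is) (sX _ It)) fctE !mxE PB.
  apply: sqr_le_le => //; first by rewrite divr_ge0 ?normH_ge0// ltW.
  rewrite real_normK ?num_real// expr_div_n.
  exact: (le_trans (Ple _) (coef_le_normH k sd)).
split; apply: H.
- by move=> z w; rewrite ReD ReN.
- by move=> a; have [] := comp_sqr_le a j.
- by move=> z w; rewrite ImD ImN.
- by move=> a; have [] := comp_sqr_le a j.
Qed.

(** Compactness of the interval. *)
Lemma bounded_of_local (a b : R) (phi : R -> R) :
  (forall x, `[a, b]%classic x -> exists M, \forall y \near within `[a, b] (nbhs x), phi y <= M) ->
  exists M, forall x, a <= x -> x <= b -> phi x <= M.
Proof.
move=> loc.
have /compact_near_coveringP/near_covering_withinP := @segment_compact R a b.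
move=> /(_ R (pinfty_nbhs R) (fun M x => phi x <= M)) [].
  move=> x xab; have [M] := loc x xab; rewrite near_withinE => HM.
  exists ([set y | `[a, b]%classic y -> phi y <= M], [set h | M <= h]).
    by split; [exact: HM|exact: nbhs_pinfty_ge (num_real M)].
  by move=> [y h] /= [Hy Mh] yab; exact: le_trans (Hy yab) Mh.
move=> M [_ HM]; exists (M + 1) => x ax xb.
by apply: (HM (M + 1)); [rewrite ltrDl|rewrite /= in_itv/= ax xb].
Qed.

End Time.

(** * The energy inequality *)

Section AlmostEverywhere.
Context {d : measure_display} {T : measurableType d} {R : realType}.
Context (mu : {measure set T -> \bar R}).

Lemma ae_imp (P Q : T -> Prop) : (forall x, P x -> Q x) ->
  {ae mu, forall x, P x} -> {ae mu, forall x, Q x}.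
Proof. by move=> PQ; apply: (@filterS _ _ (ae_filter_ringOfSetsType mu)). Qed.

Lemma ae_and (P Q : T -> Prop) : {ae mu, forall x, P x} ->
  {ae mu, forall x, Q x} -> {ae mu, forall x, P x /\ Q x}.
Proof. exact: (@filterI _ _ (ae_filter_ringOfSetsType mu)). Qed.

End AlmostEverywhere.

Section LimitInequality.
Context {R : realType}.
Notation mu := (@lebesgue_measure R).

(** Passage to the limit in an integral inequality.  Replacing h N by its
    maximum with the bound r of its limit makes dominated convergence
    applicable with the limit r itself. *)
Lemma Rint_limit_le (x y : R) (h : nat -> R -> R) (r G : R -> R) (c : nat -> R) (l : R) :
  (forall N, int_on x y (h N)) -> int_on x y r -> int_on x y G ->
  {ae mu, forall t, `[x, y]%classic t -> (forall N, `|h N t| <= G t) /\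
     exists2 z, h N t @[N --> \oo] --> z & z <= r t} ->
  (forall N, c N <= \int[mu]_(t in `[x, y]) h N t) ->
  c N @[N --> \oo] --> l -> l <= \int[mu]_(t in `[x, y]) r t.
Proof.
move=> ih ir iG good cle cl.
pose g N t := Num.max (h N t) (r t).
have mr : measurable_fun `[x, y] r by apply/measurable_EFinP; exact: measurable_int ir.
have mh N : measurable_fun `[x, y] (h N) by apply/measurable_EFinP; exact: measurable_int (ih N).
have mg N : measurable_fun `[x, y] (g N) by exact: measurable_maxr.
have gle N t : `|g N t| <= `|h N t| + `|r t|.
  by rewrite /g /Num.max; case: ifP => _; rewrite ?lerDl ?lerDr.
have ig N : int_on x y (g N).
  apply: (int_on_dominated (G := fun t => `|h N t| + `|r t|)) => //.
  exact: int_onD (int_on_norm (ih N)) (int_on_norm ir).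
have [|||||| _ _ H] := @dominated_convergence _ _ _ mu `[x, y] _ (fun N => EFin \o g N)
    (EFin \o r) (EFin \o (fun t => G t + `|r t|)).
- by [].
- by move=> N; apply/measurable_EFinP; exact: mg.
- by apply/measurable_EFinP; exact: mr.
- apply: ae_imp good => t Ht It; have [_ [z hz zr]] := Ht It.
  apply/fine_cvgP; split; first exact: nearW.
  apply/cvgrPdist_lt => e e0; move/cvgrPdist_lt/(_ e e0): hz; apply: filterS => N.
  apply: le_lt_trans; rewrite /g /= /Num.max; case: ltP => hr.
    by rewrite subrr normr0.
  by rewrite distrC [leRHS]distrC !ger0_norm ?subr_ge0 ?lerD2l ?lerN2// (le_trans zr).
- exact: int_onD iG (int_on_norm ir).
- apply: ae_imp good => t Ht N It; have [HG _] := Ht It.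
  by rewrite /= lee_fin (le_trans (gle _ _))// lerD2r.
have fr : (\int[mu]_(t in `[x, y]) (EFin \o r) t)%E \is a fin_num by exact: integrable_fin_num.
have lim : \int[mu]_(t in `[x, y]) g N t @[N --> \oo] --> \int[mu]_(t in `[x, y]) r t.
  move: H; rewrite -(fineK fr); exact: fine_cvg.
apply: (ler_cvg_to cl lim); apply: nearW => N; apply: (le_trans (cle N)).
apply: le_Rintegral => //; [exact: ih|exact: ig|].
by move=> t _; rewrite /g le_max lexx.
Qed.

Lemma int_on_sum (x y : R) (I : Type) (s : seq I) (g : I -> R -> R) :
  (forall i, int_on x y (g i)) -> int_on x y (fun t => \sum_(i <- s) g i t) /\
  \int[mu]_(t in `[x, y]) (\sum_(i <- s) g i t) = \sum_(i <- s) \int[mu]_(t in `[x, y]) g i t.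
Proof.
move=> ig; elim: s => [|i s [IH1 IH2]].
  have E : (fun t : R => \sum_(i <- [::]) g i t) = (fun=> 0).
    by apply/funext => t; rewrite big_nil.
  rewrite E big_nil Rintegral_cst//= mul0r; split=> //; exact: int_on_cst.
have E : (fun t : R => \sum_(i <- i :: s) g i t) = (fun t => g i t + \sum_(i <- s) g i t).
  by apply/funext => t; rewrite big_cons.
rewrite E big_cons RintegralD//; last exact: (ig i).
by rewrite IH2; split=> //; exact: int_onD.
Qed.

End LimitInequality.

Lemma esum_le_double (R : realType) (a b c : mode -> R) :
  (forall k, 0 <= a k) -> (forall k, 0 <= b k) ->
  (forall k, c k <= 2 * (a k + b k)) ->
  (\esum_(k in setT) (c k)%:E <=
   (\esum_(k in setT) (a k)%:E + \esum_(k in setT) (a k)%:E) +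
   (\esum_(k in setT) (b k)%:E + \esum_(k in setT) (b k)%:E))%E.
Proof.
move=> a0 b0 H.
have a0' k : (0 <= (a k)%:E)%E by rewrite lee_fin.
have b0' k : (0 <= (b k)%:E)%E by rewrite lee_fin.
rewrite -!esumD//; try by move=> k _; rewrite ?adde_ge0.
by apply: le_esum => k _; rewrite -!EFinD lee_fin; have := H k; lra.
Qed.

Lemma lee_scale_double (R : realType) (k : R) (x p q : \bar R) : 0 < k ->
  (0 <= p -> 0 <= q -> x <= (p + p) + (q + q) ->
  k%:E * x <= (k%:E * p + k%:E * p) + (k%:E * q + k%:E * q))%E.
Proof.
by move=> k0 p0 q0 H; rewrite -!ge0_muleDr ?adde_ge0// lee_pmul2l ?lte_fin.
Qed.

Lemma lee_double_fin (R : realType) (x y z : \bar R) (p q r : R) :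
  x = p%:E -> y = q%:E -> z = r%:E -> (x <= (y + y) + (z + z))%E ->
  p <= 2 * q + 2 * r.
Proof. by move=> -> -> ->; rewrite -!EFinD lee_fin; lra. Qed.

Lemma int_on_ae_dominated (R : realType) (a b : R) (g G : R -> R) :
  measurable_fun `[a, b] g -> int_on a b G ->
  {ae @lebesgue_measure R, forall x, `[a, b]%classic x -> `|g x| <= G x} -> int_on a b g.
Proof.
move=> mg iG [N [mN N0 sN]].
have mI : @measurable _ (g_sigma_algebraType R.-ocitv.-measurable) `[a, b]%classic.
  exact: measurable_itv.
apply/(negligible_integrable mN mI _ N0); first exact/measurable_EFinP.
have mD := measurableD mI mN.
have iG' := integrableS mI mD (@subDsetl _ _ N) iG.
apply: (le_integrable mD _ _ iG').
  by apply/measurable_EFinP; apply: measurable_funS mg => //; exact: subDsetl.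
move=> x [Ix Nx]; rewrite /= lee_fin; apply: le_trans (ler_norm _).
by apply: contrapT => H; apply: Nx; apply: sN => /= /(_ Ix).
Qed.

(** The choice between the real part and the imaginary part is an argument, so
    that the four real coordinates of a coefficient are treated at once. *)
Definition part (R : realType) (b : bool) (z : R[i]) : R :=
  if b then complex.Re z else complex.Im z.

Section Parts.
Context {R : realType}.
Implicit Types (b : bool) (z w : R[i]).

Lemma partD b z w : part b (z + w) = part b z + part b w.
Proof. by case: b; rewrite /part ?ReD ?ImD. Qed.

Lemma partN b z : part b (- z) = - part b z.
Proof. by case: b; rewrite /part ?ReN ?ImN. Qed.

Lemma partZ b (x : R) z : part b (x%:C * z) = x * part b z.
Proof. by case: b; rewrite /part ?ReZ ?ImZ. Qed.

Lemma part_rowB b (a c : 'rV[R[i]]_2) j : part b ((a - c) 0 j) = part b (a 0 j) - part b (c 0 j).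
Proof. by rewrite !mxE partD partN. Qed.

Lemma part_le_nn b (a : 'rV[R[i]]_2) j : `|part b (a 0 j)| <= nn a.
Proof.
apply: le_trans (n1_le_nn a j).
by case: b; [exact: Re_le_n1|exact: Im_le_n1].
Qed.

Lemma part_rate b (a0 a1 a2 a3 a4 : 'rV[R[i]]_2) (x1 x2 x4 : R) j :
  part b ((a0 + x1%:C *: a1 - x2%:C *: a2 - a3 - x4%:C *: a4) 0 j) =
  part b (a0 0 j) + x1 * part b (a1 0 j) + - x2 * part b (a2 0 j) +
  -1 * part b (a3 0 j) + - x4 * part b (a4 0 j).
Proof. by rewrite !mxE !(partD, partN, partZ) !mulNr mul1r. Qed.

Lemma coef_cont_part (I : set R) (c : R -> coefs R) : coef_cont I c ->
  forall b k j, {within I, continuous (fun t => part b (c t k 0 j))}.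
Proof. by move=> cc b k j; have [cr ci] := cc k j; case: b. Qed.

Lemma bilin_const_bound (L c x V : R) : 0 < L -> 0 <= c -> x <= 4 * V ->
  c * (x + x) <= c * 8 / L ^+ 2 * (L ^+ 2 * V).
Proof.
move=> L0 c0 xV; have -> : c * 8 / L ^+ 2 * (L ^+ 2 * V) = c * (8 * V).
  by field; rewrite gt_eqF.
by rewrite ler_wpM2l//; lra.
Qed.

Lemma increment_split (x y c p q r : R) :
  y = c + q -> x = c + p -> q = p + r -> y - x = r.
Proof. move=> -> -> ->; ring. Qed.

Lemma rate_part_diff (f p v v' b b' w w' x y r r' g d : R) :
  r = f + p + - x * v + -1 * b + - y * w ->
  r' = f + p + - x * v' + -1 * b' + - y * w' ->
  g = v - v' -> g = w - w' -> d = b - b' -> r - r' = - (x + y) * g - d.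
Proof.
move=> -> -> gv gw ->; have -> : - (x + y) * g = - (x * g) - y * g by ring.
rewrite {1}gv gw; ring.
Qed.

Lemma increment_diff (g g' p p' q q' I1 I2 J : R) :
  g = p - q -> g' = p' - q' -> p - p' = I1 -> q - q' = I2 -> J = I1 - I2 -> g - g' = J.
Proof. move=> -> -> <- <- ->; ring. Qed.

Lemma energy_arith (n g b : R) : 2 * g * (- n * g - b) = -2 * n * g ^+ 2 + -2 * (b * g).
Proof. ring. Qed.

Lemma damping_split (d q o a b : R) :
  -2 * (d * q + o) * a + -2 * b = -2 * d * (q * a) + -2 * (o * a) + -2 * b.
Proof. ring. Qed.

Lemma box_rate_arith (g d M V W H D : R) :
  2^-1 * g * (M * H) <= M * W + 2^-1 * d * (M * V) ->
  M * (-2 * d * V + -2 * W + -2 * D) <= - d * (M * V) + - g * (M * H) + -2 * (M * D).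
Proof. by lra. Qed.

Definition part_index : seq (bool * 'I_2) :=
  [:: (true, 0); (false, 0); (true, 1); (false, 1)].

Lemma sqabs_row_parts (a : 'rV[R[i]]_2) :
  sqabs_row a = \sum_(i <- part_index) part i.1 (a 0 i.2) ^+ 2.
Proof. by rewrite /sqabs_row sum2E !big_cons big_nil /= addr0 -!addrA. Qed.

Lemma re_dot_parts (a b : 'rV[R[i]]_2) :
  re_dot a b = \sum_(i <- part_index) part i.1 (a 0 i.2) * part i.1 (b 0 i.2).
Proof. by rewrite re_dotE sum2E !big_cons big_nil /= addr0 -!addrA. Qed.

End Parts.

Arguments coef_cont_part {R I c} _ b k j.

Section Solutions.
Context {R : realType} (L : R) (L0 : 0 < L).
Notation mu := (@lebesgue_measure R).
Notation F := (fourier L).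
Implicit Types (u v w f : field R) (X Y : R -> field R).

Lemma sqnormHs1_ge0 v : (0 <= sqnormHs L 1 v)%E.
Proof.
rewrite sqnormHs1E mule_ge0 ?lee_fin ?sqr_ge0//.
by apply: esum_ge0 => k _; rewrite lee_fin; exact: (Vsq_term_ge0 (F v)).
Qed.

Lemma sqnormHs1D u v : in_L2 L u -> in_L2 L v ->
  (sqnormHs L 1 (u + v)%R <= (sqnormHs L 1 u + sqnormHs L 1 u) +
     (sqnormHs L 1 v + sqnormHs L 1 v))%E.
Proof.
move=> su sv; rewrite (sqnormHs1E L (u + v)) (sqnormHs1E L u) (sqnormHs1E L v).
apply: lee_scale_double; first by rewrite exprn_gt0.
- by apply: esum_ge0 => k _; rewrite lee_fin; exact: (Vsq_term_ge0 (F u)).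
- by apply: esum_ge0 => k _; rewrite lee_fin; exact: (Vsq_term_ge0 (F v)).
apply: esum_le_double; [exact: (Vsq_term_ge0 (F u))|exact: (Vsq_term_ge0 (F v))|].
move=> k; rewrite (fourierD L0 su sv).
have := ler_wpM2l (@sqabs_ge0 R k) (sqabs_rowD (F u k) (F v k)).
by rewrite mulrCA mulrDr.
Qed.

Lemma normV_sqrD u v : in_V L u -> in_V L v ->
  normV L (u + v) ^+ 2 <= 2 * normV L u ^+ 2 + 2 * normV L v ^+ 2.
Proof.
move=> Vu Vv; have Vd := in_VD L0 Vu Vv.
have E w : in_V L w -> sqnormHs L 1 w = (normV L w ^+ 2)%:E.
  by move=> Vw; rewrite (normV_sqr (coefV L0 Vw)); exact: sqnormHs1_fin (coefV L0 Vw).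
exact: (lee_double_fin (E _ Vd) (E _ Vu) (E _ Vv) (sqnormHs1D Vu.1.1 Vv.1.1)).
Qed.

Lemma normV_bounded (a b : R) X : continuous_for (normV L) setT X ->
  (forall t, in_V L (X t)) ->
  exists M, forall x, a <= x -> x <= b -> normV L (X x) ^+ 2 <= M.
Proof.
move=> /(continuous_forP _ _ (normV_ge0 L)) cX VX.
apply: bounded_of_local => x _; exists (2 + 2 * normV L (X x) ^+ 2).
rewrite near_withinE; apply: filterS (cX x I 1 ltr01) => y /(_ I) d1 _.
have := normV_sqrD (in_VB L0 (VX y) (VX x)) (VX x); rewrite subrK => /le_trans; apply.
rewrite lerD2r -[leRHS]mulr1 ler_wpM2l//.
exact: (exprn_ile1 2 (normV_ge0 _ _) (ltW d1)).
Qed.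

Lemma continuous_for_sub (N : field R -> R) (I J : set R) X : I `<=` J ->
  continuous_for N J X -> continuous_for N I X.
Proof.
move=> IJ cX t It; apply: cvg_trans (cX t (IJ _ It)).
by apply: cvg_app; apply: within_subset; exact: IJ.
Qed.

Lemma coef_cont_meas (a b : R) (c : R -> coefs R) :
  coef_cont `[a, b] c -> coef_meas `[a, b] c.
Proof.
move=> cc k j; have [cr ci] := cc k j.
by split; exact: continuous_itv_measurable.
Qed.

Lemma sqabs_row_measurable (a b : R) (c : R -> coefs R) k : coef_cont `[a, b] c ->
  measurable_fun `[a, b] (fun t => sqabs_row (c t k)).
Proof.
move=> /coef_cont_meas mc.
have -> : (fun t => sqabs_row (c t k)) = (fun t =>
    (complex.Re (c t k 0 0) ^+ 2 + complex.Im (c t k 0 0) ^+ 2) +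
    (complex.Re (c t k 0 1) ^+ 2 + complex.Im (c t k 0 1) ^+ 2)).
  by apply/funext => t; rewrite /sqabs_row sum2E.
have [r0 i0] := mc k 0; have [r1 i1] := mc k 1.
by apply: measurable_funD; apply: measurable_funD; apply: measurable_funX.
Qed.

Lemma measurable_sqnormHs (a b : R) X : coef_cont `[a, b] (fun t => F (X t)) ->
  measurable_fun `[a, b] (fun t => sqnormHs L 1 (X t)).
Proof.
move=> cX; have -> : (fun t => sqnormHs L 1 (X t)) = (fun t =>
    (L ^+ 2)%:E * \esum_(k in setT) (sqabs k * sqabs_row (F (X t) k))%:E)%E.
  by apply/funext => t; exact: sqnormHs1E.
apply: measurable_funeM; apply: (measurable_esum (a := fun k t => sqabs k * sqabs_row (F (X t) k))).
  by move=> k t; exact: (Vsq_term_ge0 (F (X t))).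
by move=> k; apply: measurable_funM => //; exact: sqabs_row_measurable cX.
Qed.

Context (delta om alpha phi : R) (lambda : option nat) (f : field R).
Context (u Z : R -> field R) (s T : R) (sT : s <= T).
Context (Vu : forall t, in_V L (u t)) (cu : continuous_for (normV L) setT u).
Context (VZ : forall t, in_V L (Z t)) (cZ : continuous_for (normV L) setT Z).

Notation sol := (filter_solution L delta om alpha phi lambda f u Z s).

Section OneSolution.
Context (m0 : field R) (m : R -> field R) (sm : sol m0 m).

Lemma sol_H t : s <= t -> in_H L (m t).
Proof.
move=> st; have [[Hv _] _ _ _] := sm.
by have := in_HD L0 (Hv t st) (VZ t).1; rewrite subrK.
Qed.

Lemma L2_Z t : in_L2 L (Z t). Proof. exact: (VZ t).1.1. Qed.

Lemma Ray_sub : `[s, T]%classic `<=` `[s, +oo[%classic.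
Proof. by move=> t; rewrite /= !in_itv/= => /andP[->]. Qed.

Lemma Z_cont I : continuous_for (normH L) I Z.
Proof.
apply: (continuous_for_VH L0); last by move=> t _; exact: VZ.
exact: continuous_for_sub (fun _ _ => Logic.I) cZ.
Qed.

Lemma v_cont : continuous_for (normH L) `[s, +oo[ (fun t => m t - Z t).
Proof. by have [[_ cv] _ _ _] := sm. Qed.

Lemma sol_cont : continuous_for (normH L) `[s, T] m.
Proof.
have [[Hv cv] _ _ _] := sm.
have cv' := continuous_for_sub Ray_sub cv.
have := continuous_forD cv' (@Z_cont _).
have E : (fun t => m t - Z t + Z t) = m by apply/funext => t; rewrite subrK.
rewrite E; apply.
  move=> t; rewrite /= in_itv/= => /andP[st _]; exact: (Hv t st).1.
by move=> t _; exact: L2_Z.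
Qed.

Lemma sol_L2 t : `[s, T]%classic t -> in_L2 L (m t).
Proof. by rewrite /= in_itv/= => /andP[st _]; exact: (sol_H st).1. Qed.

Lemma sol_coef_cont : coef_cont `[s, T] (fun t => F (m t)).
Proof. exact (fourier_cont L0 sol_cont (@sol_L2)). Qed.

Lemma Z_coef_cont : coef_cont `[s, T] (fun t => F (Z t)).
Proof. exact (fourier_cont L0 (@Z_cont _) (fun t _ => L2_Z t)). Qed.

Lemma sol_normH_bounded : exists2 M, 0 <= M & forall t, s <= t -> t <= T -> normH L (m t) <= M.
Proof.
have [M M0 H] := continuous_itv_bounded (normH_continuous sol_cont (@sol_L2)).
by exists M => // t st tT; apply: le_trans (H t st tT); exact: ler_norm.
Qed.

(** The shifted solution m - Z has this property by assumption, and Z has it by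
    continuity in V. *)
Lemma sol_sqnorm_integrable : mu.-integrable `[s, T] (fun t => sqnormHs L 1 (m t)).
Proof.
have [[Hv _] fin _ _] := sm.
have [M HM] := normV_bounded s T cZ VZ.
have cv : coef_cont `[s, T] (fun t => F (m t - Z t)).
  refine (fourier_cont L0 (continuous_for_sub Ray_sub v_cont) _).
  by move=> t; rewrite /= in_itv/= => /andP[st _]; exact: (Hv t st).1.
have pos := sqnormHs1_ge0.
have iv : mu.-integrable `[s, T] (fun t => sqnormHs L 1 (m t - Z t)).
  apply/integrableP; split; first exact: measurable_sqnormHs cv.
  by under eq_integral => t _ do rewrite gee0_abs//; exact: fin.
have iM : mu.-integrable `[s, T] (fun=> M%:E) by exact: int_on_cst.
apply: (le_integrable _ _ _ (integrableD _ (integrableD _ iv iv) (integrableD _ iM iM))) => //.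
  exact: measurable_sqnormHs sol_coef_cont.
move=> t; rewrite /= in_itv/= => /andP[st tT]; rewrite gee0_abs//.
apply: (@le_trans _ _ ((sqnormHs L 1 (m t - Z t)%R + sqnormHs L 1 (m t - Z t)%R) +
   (sqnormHs L 1 (Z t) + sqnormHs L 1 (Z t)))%E).
  have := sqnormHs1D (Hv t st).1 (L2_Z t).
  by rewrite subrK.
have ZM : (sqnormHs L 1 (Z t) <= M%:E)%E.
  have c := coefV L0 (VZ t); rewrite (sqnormHs1_fin c) -(normV_sqr c) lee_fin.
  exact: HM.
have M0 : (0 <= M%:E :> \bar R)%E by exact: le_trans (pos _) ZM.
rewrite gee0_abs ?adde_ge0//; apply: leeD => //; exact: leeD.
Qed.

Definition sqV t : R := fine (sqnormHs L 1 (m t)).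

Lemma sqV_int : int_on s T sqV.
Proof.
have mf := measurable_sqnormHs sol_coef_cont.
have pos := sqnormHs1_ge0.
apply: (le_integrable _ _ _ sol_sqnorm_integrable) => //.
  by apply/measurable_EFinP; apply: measurable_fine_comp.
move=> t _; rewrite /= /sqV ger0_norm ?fine_ge0// gee0_abs//.
by case: (sqnormHs _ _ _) (pos (m t)) => //= r; rewrite leey.
Qed.

Lemma sol_V_ae : {ae mu, forall t, `[s, T]%classic t -> in_V L (m t)}.
Proof.
have : {ae mu, forall t, `[s, T]%classic t -> sqnormHs L 1 (m t) \is a fin_num}.
  by apply: integrable_ae sol_sqnorm_integrable.
apply: ae_imp => t H It; split; first by move: It; rewrite /= in_itv/= => /andP[st _]; exact: sol_H.
by rewrite ltey_eq H.
Qed.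

Lemma sqV_E t : in_V L (m t) -> sqV t = normV L (m t) ^+ 2.
Proof.
by move=> V; have c := coefV L0 V; rewrite /sqV (sqnormHs1_fin c) (normV_sqr c).
Qed.

(** The right-hand side of the equation for m - Z, with its linear operators
    diagonalized. *)
Definition rate k r : 'rV[R[i]]_2 :=
  F f k + phi%:C *: F (Z r) k - (delta * sqabs k)%:C *: F (m r - Z r) k
  - Bilin L (F (m r)) (F (m r)) k
  - (om * nudge_rate L alpha lambda k)%:C *: F (m r - u r) k.

Lemma rateE k r : s <= r -> rate k r =
  F f k + phi%:C *: F (Z r) k - delta%:C *: stokes L (F (m r - Z r)) k
  - B L (m r - Z r + Z r) (m r - Z r + Z r) k
  - om%:C *: nudging L alpha lambda (F (m r - Z r + Z r - u r)) k.
Proof.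
move=> sr; have [[Hv _] _ _ _] := sm.
rewrite /rate subrK nudgingE.
rewrite (stokesE L0 k (in_H_transverse L0 (Hv r sr)) (in_H_mean0 L0 (Hv r sr))).
by rewrite scalerA -rmorphM.
Qed.

Lemma rate_part b k r j : part b (rate k r 0 j) =
  part b (F f k 0 j) + phi * part b (F (Z r) k 0 j) +
  - (delta * sqabs k) * part b (F (m r - Z r) k 0 j) +
  -1 * part b (Bilin L (F (m r)) (F (m r)) k 0 j) +
  - (om * nudge_rate L alpha lambda k) * part b (F (m r - u r) k 0 j).
Proof. by rewrite /rate; exact: part_rate. Qed.

Lemma v_coef_cont : coef_cont `[s, T] (fun t => F (m t - Z t)).
Proof.
have [[Hv _] _ _ _] := sm.
refine (fourier_cont L0 (continuous_for_sub Ray_sub v_cont) _).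
by move=> t; rewrite /= in_itv/= => /andP[st _]; exact: (Hv t st).1.
Qed.

Lemma mu_coef_cont : coef_cont `[s, T] (fun t => F (m t - u t)).
Proof.
have uL2 t : in_L2 L (u t) by exact: (Vu t).1.1.
have cuI : continuous_for (normV L) `[s, T] u by exact: continuous_for_sub cu.
have cuH := continuous_for_VH L0 cuI (fun t _ => Vu t).
have cN := continuous_forN cuH (fun t _ => uL2 t).
have cD := continuous_forD sol_cont cN (@sol_L2) (fun t _ => in_L2N (uL2 t)).
exact (fourier_cont L0 cD (fun t It => in_L2D (sol_L2 It) (in_L2N (uL2 t)))).
Qed.

(** The nonlinear term is integrable in time, mode by mode: its coefficients
    are controlled by the square of the V-norm. *)
Lemma Bilin_int b k j : int_on s T (fun r => part b (Bilin L (F (m r)) (F (m r)) k 0 j)).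
Proof.
apply: (int_on_ae_dominated (G := fun r => bilin_const L * 8 / L ^+ 2 * sqV r)).
- have [mr mi] := coef_meas_Bilin L (coef_cont_meas sol_coef_cont) k j.
  by case: b.
- exact: int_onZ sqV_int.
apply: ae_imp sol_V_ae => r H Ir; have Vm := H Ir; have cm := coefV L0 Vm.
apply: (le_trans (part_le_nn _ _ _)); apply: (le_trans (nn_Bilin L0 k cm cm)).
rewrite (sqV_E Vm) (normV_sqr cm).
exact: (bilin_const_bound L0 (bilin_const_ge0 L0) (conv_le k cm)).
Qed.

Lemma rate_int b k j : int_on s T (fun r => part b (rate k r 0 j)).
Proof.
have -> : (fun r => part b (rate k r 0 j)) = (fun r =>
  part b (F f k 0 j) + phi * part b (F (Z r) k 0 j) +
  - (delta * sqabs k) * part b (F (m r - Z r) k 0 j) +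
  -1 * part b (Bilin L (F (m r)) (F (m r)) k 0 j) +
  - (om * nudge_rate L alpha lambda k) * part b (F (m r - u r) k 0 j)).
  by apply/funext => r; exact: rate_part.
apply: int_onD; [apply: int_onD; [apply: int_onD; [apply: int_onD|]|]|].
- exact: int_on_cst.
- exact (int_onZ _ (int_on_cont (coef_cont_part Z_coef_cont b k j))).
- exact (int_onZ _ (int_on_cont (coef_cont_part v_coef_cont b k j))).
- exact (int_onZ _ (Bilin_int b k j)).
- exact (int_onZ _ (int_on_cont (coef_cont_part mu_coef_cont b k j))).
Qed.

Lemma sol_from_start b k j t : s <= t ->
  part b (F (m t - Z t) k 0 j) =
  part b (F (m s - Z s) k 0 j) + \int[mu]_(r in `[s, t]) part b (rate k r 0 j).
Proof.
move=> st; have [_ _ _ eq] := sm; have := eq t st k.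
move=> /(congr1 (fun a : 'rV[R[i]]_2 => part b (a 0 j))) ->.
rewrite mxE partD; congr (_ + _); rewrite /time_integral mxE.
by case: b => /=; apply: eq_Rintegral => r; rewrite inE/= in_itv/= => /andP[sr _]; rewrite rateE.
Qed.

Lemma sol_increment b k j x y : s <= x -> x <= y -> y <= T ->
  part b (F (m y - Z y) k 0 j) - part b (F (m x - Z x) k 0 j) =
  \int[mu]_(r in `[x, y]) part b (rate k r 0 j).
Proof.
move=> sx xy yT; have sy := le_trans sx xy.
refine (increment_split (sol_from_start b k j sy) (sol_from_start b k j sx) _).
exact (Rint_split (int_on_sub (rate_int b k j) (lexx _) yT) sx xy).
Qed.

End OneSolution.

Section TwoSolutions.
Context (a1 a2 : field R) (m1 m2 : R -> field R) (s1 : sol a1 m1) (s2 : sol a2 m2).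

Definition gap r : field R := m1 r - m2 r.

Lemma gap_H t : s <= t -> in_H L (gap t).
Proof. by move=> st; exact: (in_HB L0 (sol_H s1 st) (sol_H s2 st)). Qed.

Lemma gap_shift (X : field R) t k : in_L2 L (m1 t - X) -> in_L2 L (m2 t - X) ->
  F (gap t) k = F (m1 t - X) k - F (m2 t - X) k.
Proof.
move=> l1 l2; have -> : gap t = (m1 t - X) - (m2 t - X).
  by rewrite /gap opprB addrA subrK.
by rewrite (fourierB L0 l1 l2).
Qed.

Definition gap_part b k j r := part b (F (gap r) k 0 j).

(** The same difference is obtained from the coefficients of m_i - Z and of
    m_i - u, which occur in the viscous and in the nudging term. *)
Lemma gap_partE (X : field R) b k j t : s <= t -> in_L2 L X ->
  gap_part b k j t = part b (F (m1 t - X) k 0 j) - part b (F (m2 t - X) k 0 j).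
Proof.
move=> st lX; have l1 := in_L2D (sol_H s1 st).1 (in_L2N lX).
have l2 := in_L2D (sol_H s2 st).1 (in_L2N lX).
by rewrite /gap_part (gap_shift k l1 l2) part_rowB.
Qed.

Definition bterm r k := Bilin L (F (m1 r)) (F (m1 r)) k - Bilin L (F (m2 r)) (F (m2 r)) k.

Definition gap_rate b k j r := part b (rate m1 k r 0 j) - part b (rate m2 k r 0 j).

Lemma gap_rateE b k j r : s <= r -> gap_rate b k j r =
  - (delta * sqabs k + om * nudge_rate L alpha lambda k) * gap_part b k j r
  - part b (bterm r k 0 j).
Proof.
move=> sr; have EZ := gap_partE b k j sr (L2_Z r).
have Eu := gap_partE b k j sr (Vu r).1.1.
have Eb := part_rowB b (Bilin L (F (m1 r)) (F (m1 r)) k) (Bilin L (F (m2 r)) (F (m2 r)) k) j.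
exact (rate_part_diff (rate_part m1 b k r j) (rate_part m2 b k r j) EZ Eu Eb).
Qed.

Lemma gap_rate_int b k j : int_on s T (gap_rate b k j).
Proof.
have -> : gap_rate b k j = (fun r => part b (rate m1 k r 0 j) + -1 * part b (rate m2 k r 0 j)).
  by apply/funext => r; rewrite mulN1r.
exact (int_onD (rate_int s1 b k j) (int_onZ _ (rate_int s2 b k j))).
Qed.

Lemma gap_part_increment b k j x y : s <= x -> x <= y -> y <= T ->
  gap_part b k j y - gap_part b k j x = \int[mu]_(r in `[x, y]) gap_rate b k j r.
Proof.
move=> sx xy yT; have sy := le_trans sx xy.
refine (increment_diff (gap_partE b k j sy (L2_Z y)) (gap_partE b k j sx (L2_Z x))
  (sol_increment s1 b k j sx xy yT) (sol_increment s2 b k j sx xy yT) _).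
by apply: RintegralB => //; [exact (int_on_sub (rate_int s1 b k j) sx yT)|
  exact (int_on_sub (rate_int s2 b k j) sx yT)].
Qed.

Lemma gap_part_sqr b k j x y : s <= x -> x <= y -> y <= T ->
  gap_part b k j y ^+ 2 - gap_part b k j x ^+ 2 =
  \int[mu]_(r in `[x, y]) (2 * gap_part b k j r * gap_rate b k j r).
Proof.
move=> sx xy yT.
apply: (sqr_primitive xy (int_on_sub (gap_rate_int b k j) sx yT)) => x' y' xx' xy' yy'.
by apply: gap_part_increment => //; [exact: le_trans xx'|exact: le_trans yT].
Qed.

Lemma gap_part_cont b k j : {within `[s, T], continuous (gap_part b k j)}.
Proof.
apply: (primitive_continuous (gap_rate_int b k j) sT) => x y sx xy yT.
exact: gap_part_increment.
Qed.

Definition gap_sqr k r := sqabs_row (F (gap r) k).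
Definition gap_dot k r := re_dot (bterm r k) (F (gap r) k).

Lemma gap_sqr_parts k r : gap_sqr k r =
  \sum_(i <- part_index) gap_part i.1 k i.2 r ^+ 2.
Proof. exact: sqabs_row_parts. Qed.

Lemma gap_dot_parts k r : gap_dot k r =
  \sum_(i <- part_index) part i.1 (bterm r k 0 i.2) * gap_part i.1 k i.2 r.
Proof. exact: re_dot_parts. Qed.

Lemma gap_sqr_int k : int_on s T (gap_sqr k).
Proof.
have -> : gap_sqr k = (fun r => \sum_(i <- part_index) gap_part i.1 k i.2 r ^+ 2).
  by apply/funext => r; exact: gap_sqr_parts.
apply: (int_on_sum part_index (fun i => _)).1 => i.
exact (int_on_contM (int_on_cont (@gap_part_cont i.1 k i.2)) (@gap_part_cont i.1 k i.2)).
Qed.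

Lemma bterm_int b k j : int_on s T (fun r => part b (bterm r k 0 j)).
Proof.
have -> : (fun r => part b (bterm r k 0 j)) = (fun r =>
    part b (Bilin L (F (m1 r)) (F (m1 r)) k 0 j) +
    -1 * part b (Bilin L (F (m2 r)) (F (m2 r)) k 0 j)).
  by apply/funext => r; rewrite /bterm part_rowB mulN1r.
exact (int_onD (Bilin_int s1 b k j) (int_onZ _ (Bilin_int s2 b k j))).
Qed.

Lemma gap_dot_int k : int_on s T (gap_dot k).
Proof.
have -> : gap_dot k = (fun r => \sum_(i <- part_index)
    gap_part i.1 k i.2 r * part i.1 (bterm r k 0 i.2)).
  apply/funext => r; rewrite gap_dot_parts.
  by apply: eq_bigr => i _; rewrite mulrC.
apply: (int_on_sum part_index (fun i => _)).1 => i.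
exact (int_on_contM (bterm_int i.1 k i.2) (@gap_part_cont i.1 k i.2)).
Qed.

Definition damping k : R := delta * sqabs k + om * nudge_rate L alpha lambda k.

(** Energy balance of one Fourier mode: the forcing, Z and u have cancelled. *)
Lemma gap_sqr_increment k x y : s <= x -> x <= y -> y <= T ->
  gap_sqr k y - gap_sqr k x =
  \int[mu]_(r in `[x, y]) (-2 * damping k * gap_sqr k r + -2 * gap_dot k r).
Proof.
move=> sx xy yT; rewrite !gap_sqr_parts -sumrB.
have ig i : int_on x y (fun r => 2 * gap_part i.1 k i.2 r * gap_rate i.1 k i.2 r).
  have -> : (fun r => 2 * gap_part i.1 k i.2 r * gap_rate i.1 k i.2 r) =
      (fun r => 2 * (gap_part i.1 k i.2 r * gap_rate i.1 k i.2 r)).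
    by apply/funext => r; rewrite mulrA.
  apply: int_onZ; apply: (int_on_sub _ sx yT).
  exact (int_on_contM (gap_rate_int i.1 k i.2) (@gap_part_cont i.1 k i.2)).
transitivity (\int[mu]_(r in `[x, y])
    \sum_(i <- part_index) 2 * gap_part i.1 k i.2 r * gap_rate i.1 k i.2 r).
  rewrite (int_on_sum part_index ig).2; apply: eq_bigr => i _.
  exact: gap_part_sqr.
apply: eq_Rintegral => r; rewrite inE/= in_itv/= => /andP[xr _].
rewrite gap_sqr_parts gap_dot_parts !mulr_sumr -big_split; apply: eq_bigr => i _.
rewrite (gap_rateE _ _ _ (le_trans sx xr)) -/(damping k).
exact: energy_arith.
Qed.

Lemma box_energy_int N : int_on s T (fun r => L ^+ 2 *
    \sum_(k <- box N) (-2 * damping k * gap_sqr k r + -2 * gap_dot k r)).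
Proof.
have ik k : int_on s T (fun r => -2 * damping k * gap_sqr k r + -2 * gap_dot k r).
  exact (int_onD (int_onZ _ (gap_sqr_int k)) (int_onZ _ (gap_dot_int k))).
exact (int_onZ _ (int_on_sum (box N) ik).1).
Qed.

Lemma box_energy N x y : s <= x -> x <= y -> y <= T ->
  L ^+ 2 * \sum_(k <- box N) gap_sqr k y - L ^+ 2 * \sum_(k <- box N) gap_sqr k x =
  \int[mu]_(r in `[x, y]) (L ^+ 2 *
    \sum_(k <- box N) (-2 * damping k * gap_sqr k r + -2 * gap_dot k r)).
Proof.
move=> sx xy yT.
have ik k : int_on x y (fun r => -2 * damping k * gap_sqr k r + -2 * gap_dot k r).
  apply: (int_on_sub _ sx yT).
  exact (int_onD (int_onZ _ (gap_sqr_int k)) (int_onZ _ (gap_dot_int k))).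
have [iS ES] := int_on_sum (box N) ik.
rewrite RintegralZl// ES -mulrBr -sumrB; congr (_ * _); apply: eq_bigr => k _.
exact: gap_sqr_increment.
Qed.

Context (gamma : R) (coer : coercive L delta om alpha lambda gamma).

(** What remains of the energy balance after coercivity has replaced the nudging
    and half of the viscous dissipation by gamma. *)
Definition box_bound N r :=
  - delta * (L ^+ 2 * \sum_(k <- box N) sqabs k * gap_sqr k r) +
  - gamma * (L ^+ 2 * \sum_(k <- box N) gap_sqr k r) +
  -2 * (L ^+ 2 * \sum_(k <- box N) gap_dot k r).

Lemma box_bound_int N : int_on s T (box_bound N).
Proof.
have i1 k : int_on s T (fun r => sqabs k * gap_sqr k r) by exact (int_onZ _ (gap_sqr_int k)).
have j1 := (int_on_sum (box N) i1).1.
have j2 := (int_on_sum (box N) gap_sqr_int).1.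
have j3 := (int_on_sum (box N) gap_dot_int).1.
exact (int_onD (int_onD (int_onZ _ (int_onZ _ j1)) (int_onZ _ (int_onZ _ j2)))
  (int_onZ _ (int_onZ _ j3))).
Qed.

Lemma box_rate_le N r : s <= r ->
  L ^+ 2 * (\sum_(k <- box N) (-2 * damping k * gap_sqr k r + -2 * gap_dot k r)) <=
  box_bound N r.
Proof.
move=> sr; have := coercive_box L0 N coer (gap_H sr).
rewrite -/(gap_sqr) /box_bound.
have -> : \sum_(k <- box N) (-2 * damping k * gap_sqr k r + -2 * gap_dot k r) =
    -2 * delta * (\sum_(k <- box N) sqabs k * gap_sqr k r) +
    -2 * (\sum_(k <- box N) om * nudge_rate L alpha lambda k * gap_sqr k r) +
    -2 * (\sum_(k <- box N) gap_dot k r).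
  rewrite !mulr_sumr -!big_split; apply: eq_bigr => k _.
  exact: damping_split.
exact: box_rate_arith.
Qed.

End TwoSolutions.

End Solutions.

(** * Contraction of the distance between two solutions *)

Lemma gap_shift_sub (V : zmodType) (x y z a b : V) :
  x - y = (x - z - (a - z)) - (y - z - (b - z)) + (a - b).
Proof.
have E v c : v - z - (c - z) = v - c by rewrite opprB addrA addrNK.
by rewrite !E opprB addrAC !addrA !subrK.
Qed.

Section GapArithmetic.
Context {R : realFieldType}.

Lemma box_bound_arith (d g V H P t A B C : R) :
  V = A -> H = B -> P = C -> P = t ->
  - d * A + - g * B + -2 * C = - d * V + - g * H + -2 * t.
Proof. by move=> -> -> <- ->. Qed.

Lemma trilinear_le (K' M v w h t : R) : 0 <= K' -> 0 <= v -> 0 <= w -> h <= M ->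
  0 <= M -> `|t| <= 2 * K' * v * w * h -> `|t| <= K' * M * (v ^+ 2 + w ^+ 2).
Proof.
move=> K0 v0 w0 hM M0 /le_trans; apply.
have vw0 : 0 <= 2 * K' * v * w by rewrite !mulr_ge0.
apply: (@le_trans _ _ (2 * K' * v * w * M)); first exact: ler_wpM2l.
have KM : 0 <= K' * M by rewrite mulr_ge0.
have -> : 2 * K' * v * w * M = K' * M * (2 * v * w) by ring.
by apply: ler_wpM2l => //; have := sqr_ge0 (v - w); lra.
Qed.

Lemma box_bound_le_arith (d g K' M v vN hN v1 v2 h1 h2 t1 t2 : R) :
  0 <= d -> 0 <= g -> 0 <= K' -> 0 <= M -> 0 <= v1 -> 0 <= v2 -> h1 <= M -> h2 <= M ->
  0 <= vN -> vN <= v -> v ^+ 2 <= 2 * v1 ^+ 2 + 2 * v2 ^+ 2 -> 0 <= hN -> hN <= vN ->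
  `|t1| <= 2 * K' * vN * v1 * h1 -> `|t2| <= 2 * K' * vN * v2 * h2 ->
  `|- d * vN ^+ 2 + - g * hN ^+ 2 + -2 * (t1 - t2)| <=
  (2 * d + 2 * g + 10 * K' * M) * (v1 ^+ 2 + v2 ^+ 2).
Proof.
move=> d0 g0 K0 M0 v10 v20 h1M h2M vN0 vNv vle hN0 hNv.
move=> /(trilinear_le K0 vN0 v10 h1M M0) T1 /(trilinear_le K0 vN0 v20 h2M M0) T2.
have vN2 : vN ^+ 2 <= 2 * v1 ^+ 2 + 2 * v2 ^+ 2.
  by apply: le_trans vle; rewrite ler_pXn2r// nnegrE; exact: le_trans vNv.
have hN2 : hN ^+ 2 <= 2 * v1 ^+ 2 + 2 * v2 ^+ 2.
  by apply: le_trans vN2; rewrite ler_pXn2r// nnegrE.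
have KM : 0 <= K' * M by rewrite mulr_ge0.
have q1 := ler_wpM2l d0 vN2; have q2 := ler_wpM2l g0 hN2.
have q3 := ler_wpM2l KM vN2.
have q4 := mulr_ge0 d0 (sqr_ge0 vN); have q5 := mulr_ge0 g0 (sqr_ge0 hN).
have -> : 10 * K' * M = 10 * (K' * M) by rewrite mulrA.
move: T1 T2; rewrite !ler_norml => /andP[T1 T1'] /andP[T2 T2'].
by apply/andP; split; lra.
Qed.

(** Young's inequality splits the nonlinear term between the viscosity and
    the quantity that Gronwall's lemma integrates. *)
Lemma young_gap (d g K' v v1 h t : R) : 0 < d -> - t <= K' * v1 * v * h ->
  - d * v ^+ 2 + - g * h ^+ 2 + -2 * t <= h ^+ 2 * (K' ^+ 2 / d * v1 ^+ 2 + - g).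
Proof.
move=> d0 ht; have sq := divr_ge0 (sqr_ge0 (d * v - K' * v1 * h)) (ltW d0).
have e : (d * v - K' * v1 * h) ^+ 2 / d =
    d * v ^+ 2 - 2 * (K' * v1 * v * h) + h ^+ 2 * (K' ^+ 2 / d * v1 ^+ 2).
  by field; rewrite gt_eqF.
by move: sq; rewrite e mulrDr; lra.
Qed.

End GapArithmetic.

Section Gap.
Context {R : realType} (L : R) (L0 : 0 < L).
Notation mu := (@lebesgue_measure R).
Notation F := (fourier L).
Context (K' delta gamma : R) (bounds : bilinear_bounds L K').
Context (delta0 : 0 < delta) (gamma0 : 0 < gamma).
Context (m1 m2 : R -> field R).
Notation gap := (gap m1 m2).
Notation bound := (box_bound L delta m1 m2 gamma).

Section Instant.
Context (r : R) (V1 : in_V L (m1 r)) (V2 : in_V L (m2 r)).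

Definition gap_tri (z : field R) : R :=
  tri L (F (m1 r)) (F (m1 r)) (F z) - tri L (F (m2 r)) (F (m2 r)) (F z).

Lemma gap_V : in_V L (gap r). Proof. exact (in_VB L0 V1 V2). Qed.

Lemma box_boundE N : bound N r =
  - delta * normV L (trunc L N (gap r)) ^+ 2 +
  - gamma * normH L (trunc L N (gap r)) ^+ 2 + -2 * gap_tri (trunc L N (gap r)).
Proof.
have Hg := gap_V.1.
exact (box_bound_arith _ _ (box_normV L0 N Hg) (box_parseval L0 N Hg)
  (pairing_trunc L0 N (Bilin L (F (m1 r)) (F (m1 r)) - Bilin L (F (m2 r)) (F (m2 r))) Hg)
  (pairing_BilinB L0 (coefV L0 V1) (coefV L0 V2) (coefV L0 (trunc_in_V L0 N Hg)))).
Qed.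

(** The constant 10 is 2 * (2 + 2 + 1): each trilinear term is at most
    K' M (||e||^2 + ||m_i||^2), with ||e||^2 <= 2 ||m_1||^2 + 2 ||m_2||^2. *)
Lemma box_bound_dominated M N : 0 <= M -> normH L (m1 r) <= M -> normH L (m2 r) <= M ->
  `|bound N r| <= (2 * delta + 2 * gamma + 10 * K' * M) * (sqV L m1 r + sqV L m2 r).
Proof.
move=> M0 h1 h2; have Hg := gap_V.1; have Vt := trunc_in_V L0 N Hg.
have K0 := le_trans ler01 bounds.1.
have split2 : normV L (gap r) ^+ 2 <= 2 * normV L (m1 r) ^+ 2 + 2 * normV L (m2 r) ^+ 2.
  by have := normV_sqrD L0 V1 (in_VN L0 V2); rewrite (normVN L0 V2).
rewrite box_boundE (sqV_E L0 V1) (sqV_E L0 V2).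
exact (box_bound_le_arith (ltW delta0) (ltW gamma0) K0 M0 (normV_ge0 L _) (normV_ge0 L _)
  h1 h2 (normV_ge0 L _) (normV_trunc_le L0 N gap_V) split2 (normH_ge0 L _)
  (normH_le_normV L0 Vt) (tri_bound L0 bounds V1 Vt) (tri_bound L0 bounds V2 Vt)).
Qed.

Lemma gap_dot_sums : \sum_(k <- box N) gap_dot L m1 m2 k r @[N --> \oo] -->
  rsum (fun k => re_dot (Bilin L (F (m1 r)) (F (m1 r)) k) (F (gap r) k)) -
  rsum (fun k => re_dot (Bilin L (F (m2 r)) (F (m2 r)) k) (F (gap r) k)).
Proof.
have c1 := coefV L0 V1; have c2 := coefV L0 V2; have cg := coefV L0 gap_V.
have E : (fun N => \sum_(k <- box N) gap_dot L m1 m2 k r) = (fun N : nat =>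
    \sum_(k <- box N) re_dot (Bilin L (F (m1 r)) (F (m1 r)) k) (F (gap r) k) -
    \sum_(k <- box N) re_dot (Bilin L (F (m2 r)) (F (m2 r)) k) (F (gap r) k)).
  apply/funext => N; rewrite -sumrB; apply: eq_bigr => k _.
  by rewrite /gap_dot /bterm re_dotDl re_dotNl.
rewrite E; exact (cvgB (rsum_box (Bilin_dot_sums L0 c1 c1 cg))
  (rsum_box (Bilin_dot_sums L0 c2 c2 cg))).
Qed.

Lemma box_bound_cvg : bound N r @[N --> \oo] -->
  - delta * normV L (gap r) ^+ 2 + - gamma * normH L (gap r) ^+ 2 + -2 * gap_tri (gap r).
Proof.
have cg := coefV L0 gap_V; have Hg := gap_V.1.
rewrite (normV_sqr cg) (parseval L0 Hg) /gap_tri !triE -mulrBr.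
have cV := rsum_box cg.2.
have cH : \sum_(k <- box N) gap_sqr L m1 m2 k r @[N --> \oo] -->
    rsum (fun k => sqabs_row (F (gap r) k)).
  apply: rsum_box; apply: abs_summable_pos (fourier_sums L0 Hg.1).
  by move=> k; exact: sqabs_row_ge0.
exact (cvgD (cvgD (cvgZr (cvgZr cV)) (cvgZr (cvgZr cH))) (cvgZr (cvgZr gap_dot_sums))).
Qed.

Lemma box_bound_limit_le :
  - delta * normV L (gap r) ^+ 2 + - gamma * normH L (gap r) ^+ 2 + -2 * gap_tri (gap r) <=
  normH L (gap r) ^+ 2 * (K' ^+ 2 / delta * sqV L m1 r + - gamma).
Proof.
rewrite (sqV_E L0 V1).
exact (young_gap gamma delta0 (tri_lower L0 bounds V1 V2)).
Qed.

End Instant.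

Context (om alpha phi : R) (lambda : option nat) (f : field R).
Context (u Z : R -> field R) (s T : R) (sT : s <= T).
Context (Vu : forall t, in_V L (u t)) (cu : continuous_for (normV L) setT u).
Context (VZ : forall t, in_V L (Z t)) (cZ : continuous_for (normV L) setT Z).
Context (coer : coercive L delta om alpha lambda gamma).
Notation sol := (filter_solution L delta om alpha phi lambda f u Z s).
Context (a1 a2 : field R) (s1 : sol a1 m1) (s2 : sol a2 m2).

Notation growth := (fun r => K' ^+ 2 / delta * sqV L m1 r + - gamma).

Lemma gap_normH_cont : {within `[s, T], continuous (fun r => normH L (gap r))}.
Proof.
have l1 := sol_L2 L0 VZ s1 (T := T); have l2 := sol_L2 L0 VZ s2 (T := T).
have c1 := sol_cont L0 VZ cZ s1 (T := T); have c2 := sol_cont L0 VZ cZ s2 (T := T).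
exact (normH_continuous (continuous_forD c1 (continuous_forN c2 l2) l1
  (fun t It => in_L2N (l2 t It))) (fun t It => in_L2D (l1 t It) (in_L2N (l2 t It)))).
Qed.

Lemma gap_normH_sqr_cont : {within `[s, T], continuous (fun r => normH L (gap r) ^+ 2)}.
Proof.
move=> r; have := gap_normH_cont (x := r) => c.
exact (cvgM c c).
Qed.

Lemma growth_int : int_on s T growth.
Proof. exact (int_onD (int_onZ _ (sqV_int L0 sT VZ cZ s1)) (int_on_cst _ _ _)). Qed.

(** The limit of the energy balances of the truncations.  The domination is
    integrable in time because it is linear in the squares of the V-norms. *)
Lemma gap_energy x y : s <= x -> x <= y -> y <= T ->
  normH L (gap y) ^+ 2 - normH L (gap x) ^+ 2 <=
  \int[mu]_(r in `[x, y]) (normH L (gap r) ^+ 2 * growth r).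
Proof.
move=> sx xy yT; have sy := le_trans sx xy.
have [M1 M10 B1] := sol_normH_bounded L0 T VZ cZ s1.
have [M2 M20 B2] := sol_normH_bounded L0 T VZ cZ s2.
pose M := M1 + M2.
pose G r := (2 * delta + 2 * gamma + 10 * K' * M) * (sqV L m1 r + sqV L m2 r).
have iG : int_on s T G.
  exact (int_onZ _ (int_onD (sqV_int L0 sT VZ cZ s1) (sqV_int L0 sT VZ cZ s2))).
have ib N := box_bound_int L0 sT Vu cu VZ cZ s1 s2 gamma N.
have cH t : s <= t -> L ^+ 2 * \sum_(k <- box N) gap_sqr L m1 m2 k t @[N --> \oo] -->
    normH L (gap t) ^+ 2.
  move=> st; have Hg := gap_H L0 VZ s1 s2 st; rewrite (parseval L0 Hg).
  apply: cvgZr; apply: rsum_box; apply: abs_summable_pos (fourier_sums L0 Hg.1).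
  by move=> k; exact: sqabs_row_ge0.
refine (@Rint_limit_le R x y bound (fun r => normH L (gap r) ^+ 2 * growth r) G
  (fun N => L ^+ 2 * \sum_(k <- box N) gap_sqr L m1 m2 k y -
    L ^+ 2 * \sum_(k <- box N) gap_sqr L m1 m2 k x) _
  (fun N => int_on_sub (ib N) sx yT)
  (int_on_sub (int_on_contM growth_int gap_normH_sqr_cont) sx yT)
  (int_on_sub iG sx yT) _ _ (cvgB (cH y sy) (cH x sx))).
- have := ae_and (sol_V_ae L0 sT VZ cZ s1) (sol_V_ae L0 sT VZ cZ s2).
  apply: ae_imp => r [V1 V2] Ir.
  have /andP[xr ry] : x <= r <= y by move: Ir; rewrite /= in_itv.
  have sr := le_trans sx xr; have rT := le_trans ry yT.
  have Is : `[s, T]%classic r by rewrite /= in_itv/= sr rT.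
  have {}V1 := V1 Is; have {}V2 := V2 Is.
  have b1 : normH L (m1 r) <= M by apply: le_trans (B1 r sr rT) _; rewrite lerDl.
  have b2 : normH L (m2 r) <= M by apply: le_trans (B2 r sr rT) _; rewrite lerDr.
  split=> [N|]; first exact (box_bound_dominated V1 V2 N (addr_ge0 M10 M20) b1 b2).
  by eexists; [exact (box_bound_cvg V1 V2)|exact (box_bound_limit_le V1 V2)].
move=> N; rewrite (box_energy L0 sT Vu cu VZ cZ s1 s2 N sx xy yT).
have ibe : int_on x y (fun r => L ^+ 2 * \sum_(k <- box N)
    (-2 * damping L delta om alpha lambda k * gap_sqr L m1 m2 k r +
     -2 * gap_dot L m1 m2 k r)).
  exact (int_on_sub (box_energy_int L0 sT Vu cu VZ cZ s1 s2 N) sx yT).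
apply: le_Rintegral => //; [exact (int_on_sub (ib N) sx yT)|].
move=> r; rewrite /= in_itv/= => /andP[xr _].
exact (box_rate_le L0 VZ s1 s2 coer N (le_trans sx xr)).
Qed.

Lemma gap_contraction : normH L (gap T) ^+ 2 <=
  normH L (gap s) ^+ 2 * expR (\int[mu]_(r in `[s, T]) growth r).
Proof.
apply: (gronwall (E := fun r => normH L (gap r) ^+ 2) sT gap_normH_sqr_cont growth_int).
  by move=> r _ _; exact: sqr_ge0.
exact gap_energy.
Qed.

Lemma growth_integral : \int[mu]_(r in `[s, T]) growth r =
  K' ^+ 2 / delta * \int[mu]_(r in `[s, T]) sqV L m1 r - gamma * (T - s).
Proof.
rewrite RintegralD//; [|exact (int_onZ _ (sqV_int L0 sT VZ cZ s1))|exact: int_on_cst].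
rewrite RintegralZl//; last exact (sqV_int L0 sT VZ cZ s1).
rewrite Rintegral_cst//= mulNr lebesgue_measure_itv/= lte_fin.
have [->|/negbTE sT'] := eqVneq s T; first by rewrite ltxx subrr mulr0.
by rewrite lt_neqAle sT' sT.
Qed.

(** The initial values are only prescribed up to a field of norm zero. *)
Lemma gap_start : in_L2 L a1 -> in_L2 L a2 -> normH L (gap s) <= normH L (a1 - a2).
Proof.
move=> l1 l2; have [_ _ n1 _] := s1; have [_ _ n2 _] := s2.
have lZ := (VZ s).1.1.
have lD v a : in_L2 L v -> in_L2 L a -> in_L2 L (v - Z s - (a - Z s)).
  by move=> lv la; exact (in_L2D (in_L2D lv (in_L2N lZ)) (in_L2N (in_L2D la (in_L2N lZ)))).
have d1 := lD _ _ (sol_H L0 VZ s1 (lexx s)).1 l1.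
have d2 := lD _ _ (sol_H L0 VZ s2 (lexx s)).1 l2.
have -> : gap s = (m1 s - Z s - (a1 - Z s)) - (m2 s - Z s - (a2 - Z s)) + (a1 - a2).
  exact: gap_shift_sub.
apply: (le_trans (normH_triangle (in_L2D d1 (in_L2N d2)) (in_L2D l1 (in_L2N l2)))).
apply: (le_trans (lerD (normH_triangle d1 (in_L2N d2)) (lexx _))).
by rewrite (normHN d2) n1 n2 !add0r.
Qed.

Lemma sqV_integral_le : ((\int[mu]_(r in `[s, T]) sqV L m1 r)%:E <=
  \int[mu]_(r in `[s, T]) sqnormHs L 1 (m1 r))%E.
Proof.
have iq := sqV_int L0 sT VZ cZ s1; have pos := @sqnormHs1_ge0 R L.
rewrite /Rintegral fineK; last exact: (integrable_fin_num _ iq).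
apply: ge0_le_integral => //.
- by move=> r _; rewrite lee_fin fine_ge0.
- by apply/measurable_EFinP/measurable_EFinP; exact: measurable_int iq.
- exact: measurable_int (sol_sqnorm_integrable L0 sT VZ cZ s1).
by move=> r _; rewrite /sqV; case: (sqnormHs _ _ _) (pos (m1 r)) => //= x; rewrite leey.
Qed.

End Gap.

Section Decay.
Context {R : realType}.

Lemma expR_ninfty (t c : R) : 0 < c -> expR (- c * (t - s)) @[s --> ninfty_nbhs R] --> (0 : R).
Proof.
move=> c0; apply/cvgrPdist_lt => e e0.
exists (t + c^-1 * ln e); split; first exact: num_real.
move=> s st; rewrite sub0r normrN ger0_norm ?expR_ge0//.
have h : c * s < c * t + ln e.
  by move: st; rewrite -(ltr_pM2l c0) mulrDr mulVKf ?gt_eqF.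
by rewrite -[ltRHS](lnK e0) ltr_expR; lra.
Qed.

(** With c = gamma - 2 eta, the square of the quantity that tends to 0 is at
    most D^2 exp (- 3/4 c (t - s)). *)
Lemma decay (t eta gamma K D : R) (g J : R -> R) : 0 <= D -> 0 <= K ->
  (forall s, 0 <= g s) -> (forall s, s <= t -> 0 <= J s) ->
  (forall s, s <= t -> g s ^+ 2 <= D ^+ 2 * expR (K * J s - gamma * (t - s))) ->
  (\forall s \near ninfty_nbhs R, 4 * K / (t - s) * J s < gamma - 2 * eta) ->
  g s * expR (eta * (t - s)) @[s --> ninfty_nbhs R] --> (0 : R).
Proof.
move=> D0 K0 g0 J0 gle lim; set c := gamma - 2 * eta.
have st : \forall s \near ninfty_nbhs R, s < t by exact: nbhs_ninfty_lt (num_real t).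
have small : \forall s \near ninfty_nbhs R, s < t /\ 4 * (K * J s) < c * (t - s).
  apply: filterS2 st lim => s s_t; rewrite -/c mulrAC ltr_pdivrMr ?subr_gt0// -!mulrA.
  by split.
(* the left-hand side of the last hypothesis is nonnegative *)
have c0 : 0 < c.
  have [s [s_t h]] := filter_ex small; have ts : 0 < t - s by rewrite subr_gt0.
  rewrite -(pmulr_lgt0 _ ts); apply: le_lt_trans h.
  by rewrite !mulr_ge0// J0// ltW.
have c8 : 0 < 3 / 8 * c by rewrite mulr_gt0.
have lim0 : D * expR (- (3 / 8 * c) * (t - s)) @[s --> ninfty_nbhs R] --> (0 : R).
  by rewrite -[X in _ --> X](mulr0 D); exact (cvgZr (expR_ninfty t c8)).
apply: (squeeze_cvgr _ (cvg_cst 0) lim0).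
apply: filterS small => s [s_t h].
rewrite mulr_ge0 ?expR_ge0//=.
have Dle : 0 <= D * expR (- (3 / 8 * c) * (t - s)) by rewrite mulr_ge0 ?expR_ge0.
rewrite -(@ler_pXn2r _ 2)// ?nnegrE ?mulr_ge0 ?expR_ge0//.
rewrite !exprMn -!expRM_natl.
apply: (le_trans (ler_wpM2r (expR_ge0 _) (gle s (ltW s_t)))).
rewrite -(mulrA (D ^+ 2)) -expRD ler_wpM2l ?sqr_ge0// ler_expR.
move: h; rewrite /c; set x := K * J s; set y := t - s; nra.
Qed.

End Decay.

Theorem theorem5p9 (R : realType) (d : measure_display)
  (Omega : measurableType d) (Pr : probability Omega R)
  (L nu om sigma0 alpha beta phi K' gamma : R) (lambda : option nat)
  (f : field R) (att : set (field R)) (u : R -> field R)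
  (W : mode -> R -> Omega -> R) (WW Z : R -> Omega -> field R)
  (S : R -> R -> Omega -> field R -> field R) :
  let delta := 4 * pi ^+ 2 * nu / L ^+ 2 in
  let K := K' ^+ 2 / delta in
  0 < L -> 0 < nu -> 0 < om -> 0 < sigma0 -> 0 <= phi ->
  in_H L f ->
  global_attractor L delta f att ->
  nse_solution L delta f setT u -> att (u 0) ->
  (lambda = None -> 1 < 4 * alpha + 2 * beta /\ - (2^-1) < alpha) ->
  cylindrical_brownian Pr L lambda W ->
  coloured_noise Pr L om sigma0 alpha beta lambda W WW ->
  ou_process Pr L delta phi WW Z ->
  {ae Pr, forall w, forall s m0, in_H L m0 ->
     filter_solution L delta om alpha phi lambda f u (Z ^~ w) s m0
       (fun t => S t s w m0)} ->
  bilinear_bounds L K' ->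
  largest_coercive L delta om alpha lambda gamma ->
  forall (t eta : R) (m1 : field R), in_H L m1 -> 0 < eta ->
  {ae Pr, forall w,
     (limf_esup (fun s : R => (4 * K / (t - s))%:E *
        \int[@lebesgue_measure R]_(tau in `[s, t]) sqnormHs L 1 (S tau s w m1))
        (ninfty_nbhs R) < (gamma - 2 * eta)%:E)%E} ->
  forall m2 : field R, in_H L m2 ->
  {ae Pr, forall w,
     normH L (S t s w m1 - S t s w m2) * expR (eta * (t - s))
       @[s --> ninfty_nbhs R] --> (0 : R)}.
Proof.
move=> delta K L0 nu0 _ _ _ _ _ [Vu cu _] _ _ _ _ [_ _ Zreg] solS bounds [gamma0 coer _].
move=> t eta m1 H1 eta0 lims m2 H2.
have delta0 : 0 < delta.
  by rewrite divr_gt0 ?exprn_gt0// mulr_gt0// mulr_gt0// exprn_gt0// pi_gt0.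
apply: ae_imp (ae_and (ae_and solS Zreg) lims) => w [[sw [VZ cZ]] lw].
have Vu' r := Vu r I.
pose g s := normH L (S t s w m1 - S t s w m2).
pose J s := \int[@lebesgue_measure R]_(r in `[s, t]) sqV L (fun r => S r s w m1) r.
apply: (@decay R t eta gamma K (normH L (m1 - m2)) g J).
- exact: normH_ge0.
- by rewrite divr_ge0 ?sqr_ge0// ltW.
- by move=> s; exact: normH_ge0.
- move=> s st; apply: Rintegral_ge0 => r _; exact: fine_ge0 (sqnormHs1_ge0 L _).
- move=> s st; have s1 := sw s m1 H1; have s2 := sw s m2 H2.
  apply: (le_trans (gap_contraction L0 bounds delta0 gamma0 st Vu' cu VZ cZ coer s1 s2)).
  rewrite (growth_integral L0 K' gamma st VZ cZ s1) -/K ler_wpM2r ?expR_ge0//.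
  by rewrite ler_pXn2r ?nnegrE ?normH_ge0//; exact (gap_start L0 VZ s1 s2 H1.1 H2.1).
(* a strict bound on the upper limit holds on a neighbourhood of -oo *)
have [_ [V FV <-] supV] := ereal_inf_lt lw.
have st : \forall s \near ninfty_nbhs R, s < t by exact: nbhs_ninfty_lt (num_real t).
apply: filterS2 st FV => s s_t Vs.
rewrite -lte_fin; apply: le_lt_trans supV.
apply: (@le_trans _ _ ((4 * K / (t - s))%:E * \int[@lebesgue_measure R]_(r in `[s, t])
  sqnormHs L 1 (S r s w m1))%E); last by apply: ereal_sup_ubound; exists s.
rewrite EFinM lee_wpmul2l//.
  by rewrite lee_fin divr_ge0 ?subr_ge0 ?(ltW s_t)// mulr_ge0// divr_ge0 ?sqr_ge0// ltW.
exact (sqV_integral_le L0 (ltW s_t) VZ cZ (sw s m1 H1)).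
Qed.
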